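(* Let $n\ge 1$. The assignment $\Gamma\mapsto A^\Gamma$ defines a bijection $$\mathrm{Tri}_{\mathrm{ct}}(S(A_n))\to\mathsf{T}_{\mathrm{nh}}(A_n)$$ from the set $\mathrm{Tri}_{\mathrm{ct}}(S(A_n))$ of all triangulations of $S(A_n)$ which contain $c_{P(1)}$ and have at least one complete triangle to the set $\mathsf{T}_{\mathrm{nh}}(A_n)$ of all (isomorphism classes of basic) non-hereditary tilted algebras of type $A_n$.
   Context: $\Bbbk$ is an algebraically closed field, $A_n=\Bbbk\mathcal{Q}$ is the path algebra of the quiver $\mathcal{Q}:1\to2\to\cdots\to n$; paths are composed from left to right ($\alpha\beta$ means first $\alpha$, then $\beta$) and modules are finitely generated right modules. An algebra is tilted of type $A_n$ if it is isomorphic to $\operatorname{End}_{A_n}(T)$ for a tilting $A_n$-module $T$; here $T$ is taken basic and algebras are considered up to isomorphism. The surface $S(A_n)$. It is a closed disk with $n+3$ points on its boundary, in counterclockwise order $p,x_0,x_1,\dots,x_n,x_{n+1}$. The points $p,x_1,\dots,x_n$ are the marked points and $x_0,x_{n+1}$ are the two extra marked points. The disk carries the $n$ arcs $\Delta=\{px_1,\dots,px_n\}$, the arc $px_i$ corresponding to the vertex $i$ of $\mathcal{Q}$. Permissible curves in $S(A_n)$ (up to equivalence) are the curves joining two of these $n+3$ points, taken up to isotopy fixing endpoints and with minimal intersection; there is one for each pair of distinct points. A boundary segment is a segment of the boundary circle between two consecutive points among the $n+3$ points. A partial generalized dissection is a set of permissible curves, none homotopic to a boundary segment, any two of which do not meet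 in the interior of the disk; a generalized dissection is a maximal partial generalized dissection. Generalized dissections of $S(A_n)$ are exactly its triangulations. The curve $c_{P(1)}$, corresponding to the indecomposable projective module $P(1)$, is the curve joining $x_0$ and $x_{n+1}$. A triangle of $\Gamma$ is one of the triangles into which $\Gamma$ divides the disk (sides are curves of $\Gamma$ or boundary segments); it is complete if all its three sides belong to $\Gamma$. The algebra $A^\Gamma$. For a triangulation $\Gamma$ containing $c_{P(1)}$, $A^\Gamma=\Bbbk Q/I$, where the vertices of $Q$ are the elements of $\Gamma$ (these all join points among $x_0,\dots,x_{n+1}$), and arrows and relations are given as follows. If $c_1,c_2\in\Gamma$ are two sides of a triangle of $\Gamma$ with common endpoint $q$, there is an arrow $c_1\to c_2$ if $c_1$ is obtained from $c_2$ by keeping $q$ fixed and moving the other endpoint clockwise along the boundary through successive points so that all curves obtained on the way, including $c_1$, are non-trivial, i.e. cross at least one arc of $\Delta$ in the interior. (Concretely, in a triangle with vertices $x_i,x_j,x_k$, $i<j<k$, the arrows are $x_ix_j\to x_ix_k$ and $x_ix_k\to x_jx_k$, whenever the curves involved lie in $\Gamma$.) The ideal $I$ is generated by all products $\alpha\beta$ of arrows such that $s(\alpha)$, $t(\alpha)=s(\beta)$ and $t(\beta)$ are the sides of one and the same triangle. *)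

(* Defs.v *)
From HB Require Import structures.
From mathcomp Require Import all_boot all_order all_algebra.
From mathcomp Require Import generic_quotient ring_quotient.
From mathcomp Require Import finmap.
From mathcomp.multinomials Require Import monalg.
From mathcomp Require Import boolp classical_sets functions.

Set Implicit Arguments.
Unset Strict Implicit.
Unset Printing Implicit Defensive.

Import GRing.Theory.
Local Open Scope ring_scope.
Local Open Scope quotient_scope.

(* Two-sided proper ideals and quotient algebras.  The library's [idealr] is
   a proper left ideal; its quotient is a ring only over commutative rings. *)

HB.mixin Record isRightStable (R : nzRingType) (S : R -> bool) := {
  right_stable : forall a u : R, u \in S -> u * a \in S
}.

#[short(type="ideal2")]
HB.structure Definition Ideal2 (R : nzRingType) :=
  {S of Idealr R S & isRightStable R S}.

Definition quot_alg (k : nzRingType) (A : algType k) (I : ideal2 A) : Type :=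
  {ideal_quot (I : idealr A)}.

Section QuotAlg.
Variables (k : nzRingType) (A : algType k) (I : ideal2 A).
Local Notation Q := (quot_alg I).
Local Notation pQ := (\pi_({ideal_quot (I : idealr A)})).

HB.instance Definition _ := GRing.Zmodule.on Q.

Let Q0 := {ideal_quot (I : idealr A)}.

Lemma quot_ideal (x y : A) : (pQ x == pQ y :> Q0) = (x - y \in (I : pred A)).
Proof. by rewrite -Quotient.idealrBE. Qed.

Definition quot_one : Q := pQ 1.
Definition quot_mul (x y : Q) : Q := pQ (repr (x : Q0) * repr (y : Q0)).
Definition quot_scale (a : k) (x : Q) : Q := pQ (a *: repr (x : Q0)).

Lemma quot_piD (x y : A) : (pQ x : Q) + pQ y = pQ (x + y).
Proof. exact: esym (Quotient.pi_add (I : idealr A) x y). Qed.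

Lemma quot_piM (x y : A) : quot_mul (pQ x) (pQ y) = pQ (x * y).
Proof.
apply/eqP; rewrite quot_ideal.
set x' := repr _; set y' := repr _.
have hx : x' - x \in (I : pred A) by rewrite -quot_ideal /x' reprK.
have hy : y' - y \in (I : pred A) by rewrite -quot_ideal /y' reprK.
have -> : x' * y' - x * y = x' * (y' - y) + (x' - x) * y.
  by rewrite mulrBr mulrBl addrA subrK.
by apply: rpredD; [exact: idealMr|exact: right_stable].
Qed.

Lemma quot_piZ (a : k) (x : A) : quot_scale a (pQ x) = pQ (a *: x).
Proof.
apply/eqP; rewrite quot_ideal.
set x' := repr _.
have hx : x' - x \in (I : pred A) by rewrite -quot_ideal /x' reprK.
by rewrite -scalerBr -[x' - x]mul1r scalerAl idealMr.
Qed.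

Lemma quot_ind (P : Q -> Prop) : (forall x : A, P (pQ x)) -> forall x, P x.
Proof. by move=> h x; rewrite -[x](@reprK _ Q0). Qed.

Lemma quot_mulA : associative quot_mul.
Proof.
by elim/quot_ind=> x; elim/quot_ind=> y; elim/quot_ind=> z; rewrite !quot_piM mulrA.
Qed.
Lemma quot_mul1 : left_id quot_one quot_mul.
Proof. by elim/quot_ind=> x; rewrite quot_piM mul1r. Qed.
Lemma quot_mulr1 : right_id quot_one quot_mul.
Proof. by elim/quot_ind=> x; rewrite quot_piM mulr1. Qed.
Lemma quot_mulDl : left_distributive quot_mul +%R.
Proof.
elim/quot_ind=> x; elim/quot_ind=> y; elim/quot_ind=> z.
by rewrite !(quot_piM, quot_piD) mulrDl.
Qed.
Lemma quot_mulDr : right_distributive quot_mul +%R.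
Proof.
elim/quot_ind=> x; elim/quot_ind=> y; elim/quot_ind=> z.
by rewrite !(quot_piM, quot_piD) mulrDr.
Qed.
Lemma quot_one_neq0 : quot_one != 0.
Proof.
have -> : (0 : Q) = pQ 0 by exact: esym (@pi_zeror _ _ _ _ _ Q0).
by rewrite quot_ideal subr0 idealr1.
Qed.
HB.instance Definition _ := GRing.Zmodule_isNzRing.Build Q
  quot_mulA quot_mul1 quot_mulr1 quot_mulDl quot_mulDr quot_one_neq0.

Lemma quot_scaleA (a b : k) (x : Q) :
  quot_scale a (quot_scale b x) = quot_scale (a * b) x.
Proof. by elim/quot_ind: x => x; rewrite !quot_piZ scalerA. Qed.
Lemma quot_scale1 : left_id 1 quot_scale.
Proof. by elim/quot_ind=> x; rewrite quot_piZ scale1r. Qed.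
Lemma quot_scaleDr : right_distributive quot_scale +%R.
Proof.
by move=> a; elim/quot_ind=> x; elim/quot_ind=> y;
  rewrite !(quot_piZ, quot_piD) scalerDr.
Qed.
Lemma quot_scaleDl (x : Q) : {morph quot_scale^~ x : a b / a + b}.
Proof.
by move=> a b; elim/quot_ind: x => x; rewrite !(quot_piZ, quot_piD) scalerDl.
Qed.
HB.instance Definition _ := GRing.Zmodule_isLmodule.Build k Q
  quot_scaleA quot_scale1 quot_scaleDr quot_scaleDl.

Lemma quot_scaleAl (a : k) (x y : Q) : a *: (x * y) = (a *: x) * y.
Proof.
elim/quot_ind: x => x; elim/quot_ind: y => y.
rewrite -[_ * _]/(quot_mul _ _) -[_ *: _]/(quot_scale _ _).
by rewrite quot_piM quot_piZ scalerAl -quot_piM -quot_piZ.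
Qed.
HB.instance Definition _ := GRing.Lmodule_isLalgebra.Build k Q quot_scaleAl.
Lemma quot_scaleAr (a : k) (x y : Q) : a *: (x * y) = x * (a *: y).
Proof.
elim/quot_ind: x => x; elim/quot_ind: y => y.
rewrite -[_ * _]/(quot_mul _ _) -[_ *: _]/(quot_scale _ _).
by rewrite quot_piM quot_piZ scalerAr -quot_piM -quot_piZ.
Qed.
HB.instance Definition _ := GRing.Lalgebra_isAlgebra.Build k Q quot_scaleAr.

End QuotAlg.

Definition is_ideal (R : nzRingType) (J : set R) : Prop :=
  [/\ J 0, (forall x y, J x -> J y -> J (x - y)),
      (forall a x, J x -> J (a * x)) & (forall a x, J x -> J (x * a))].

Definition gen_ideal (R : nzRingType) (S : set R) : set R :=
  fun x => forall J : set R, is_ideal J -> (S `<=` J)%classic -> J x.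

(* Quivers are finite, nonempty and have at most one arrow from a vertex to
   another; this covers all quivers below, since two distinct curves with a
   common end point are sides of at most one triangle. *)

Record quiver := Quiver {
  vertex :> finType;
  arrow : rel vertex;
  quiver_nonempty : (0 < #|vertex|)%N
}.

(* (x, [:: y1; ...; ym]) is the path x -> y1 -> ... -> ym. *)
Definition qpath (Q : quiver) : choiceType :=
  [the choiceType of {p : Q * seq Q | path (@arrow Q) p.1 p.2}].

Definition psource (Q : quiver) (p : qpath Q) : Q := (val p).1.
Definition ptarget (Q : quiver) (p : qpath Q) : Q := last (val p).1 (val p).2.

Definition path_alg (k : fieldType) (Q : quiver) : Type := {malg k[qpath Q]}.

HB.instance Definition _ (k : fieldType) (Q : quiver) :=
  GRing.Lmodule.on (path_alg k Q).

(* Locked only to keep unification from unfolding finitely supported maps. *)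
HB.lock Definition path_elt (k : fieldType) (Q : quiver) (p : qpath Q) :
  path_alg k Q := << p >>.

Definition basis_path (k : fieldType) (Q : quiver) (p : Q * seq Q) : path_alg k Q :=
  if insub p is Some p' then path_elt k p' else 0.

(* The product of two paths: p followed by q if p ends where q starts, else 0. *)
Definition path_cat (k : fieldType) (Q : quiver) (p q : qpath Q) : path_alg k Q :=
  if ptarget p == psource q
  then basis_path k (psource p, (val p).2 ++ (val q).2) else 0.

HB.lock Definition path_mul (k : fieldType) (Q : quiver) (f g : path_alg k Q) :
    path_alg k Q :=
  \sum_(p <- msupp f) f@_p *: \sum_(q <- msupp g) g@_q *: path_cat k p q.

Section PathAlg.
Variables (k : fieldType) (Q : quiver).
Local Notation kQ := (path_alg k Q).
Implicit Types (p q r : qpath Q) (f g h : kQ).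

Definition path_one : kQ := \sum_(v : Q) basis_path k (v, [::]).

Definition lext (V : lmodType k) (F : qpath Q -> V) (g : kQ) : V :=
  \sum_(p <- msupp g) g@_p *: F p.

Lemma lextEw (V : lmodType k) (F : qpath Q -> V) (d : {fset qpath Q}) g :
  (msupp g `<=` d)%fset -> lext F g = \sum_(p <- d) g@_p *: F p.
Proof.
move=> le; rewrite /lext (big_fset_incl _ le) // => p _ /mcoeff_outdom ->.
by rewrite scale0r.
Qed.

Lemma lextP (V : lmodType k) (F : qpath Q -> V) a f g :
  lext F (a *: f + g) = a *: lext F f + lext F g.
Proof.
pose d := (msupp f `|` msupp g `|` msupp (a *: f + g))%fset.
have l1 : (msupp f `<=` d)%fset by rewrite /d -fsetUA fsubsetUl.
have l2 : (msupp g `<=` d)%fset by rewrite /d -fsetUA fsetUCA fsubsetUl.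
have l3 : (msupp (a *: f + g) `<=` d)%fset by rewrite fsubsetUr.
rewrite (lextEw _ l1) (lextEw _ l2) (lextEw _ l3).
rewrite scaler_sumr -big_split /=; apply: eq_bigr => p _.
by rewrite mcoeffD mcoeffZ scalerDl scalerA.
Qed.

Lemma coef_elt p q : (path_elt k p)@_q = (p == q)%:R.
Proof. by rewrite path_elt.unlock mcoeffU. Qed.

Lemma lextU (V : lmodType k) (F : qpath Q -> V) p : lext F (path_elt k p) = F p.
Proof.
rewrite (@lextEw _ _ [fset p]%fset) ?path_elt.unlock ?msuppU_le //.
by rewrite big_seq_fset1 mcoeffUU scale1r.
Qed.

Lemma path_mulPl h a f g : path_mul (a *: f + g) h = a *: path_mul f h + path_mul g h.
Proof. rewrite path_mul.unlock; exact: lextP. Qed.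

Lemma path_mulPr h a f g : path_mul h (a *: f + g) = a *: path_mul h f + path_mul h g.
Proof.
rewrite path_mul.unlock scaler_sumr -big_split /=; apply: eq_bigr => p _.
have E : h@_p *: lext (path_cat k p) (a *: f + g) =
    a *: (h@_p *: lext (path_cat k p) f) + h@_p *: lext (path_cat k p) g.
  by rewrite lextP scalerDr !scalerA mulrC.
exact: E.
Qed.

Lemma path_mul_basis p q : path_mul (path_elt k p) (path_elt k q) = path_cat k p q.
Proof.
rewrite path_mul.unlock.
apply: (etrans (lextU (fun r => lext (path_cat k r) (path_elt k q)) p)).
exact: lextU.
Qed.

Lemma path_mul0f f : path_mul 0 f = 0.
Proof. by rewrite path_mul.unlock msupp0 big_seq_fset0. Qed.

Lemma path_mulf0 f : path_mul f 0 = 0.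
Proof.
by rewrite path_mul.unlock big1 // => p _; rewrite msupp0 big_seq_fset0 scaler0.
Qed.

Lemma path_basisZ a p : << a *g p >> = a *: path_elt k p.
Proof.
by apply/malgP => q; rewrite mcoeffU mcoeffZ coef_elt mulr_natr.
Qed.

Lemma path_alg_ind (P : kQ -> Prop) :
  P 0 -> (forall a p g, P g -> P (a *: path_elt k p + g)) -> forall g, P g.
Proof.
move=> P0 PD g; rewrite [g]monalgE.
elim: (enum_fset _) => [|p s IH]; first by rewrite big_nil.
rewrite big_cons.
by rewrite path_basisZ; exact: PD.
Qed.

Lemma basis_pathE p : basis_path k (val p) = path_elt k p.
Proof. by rewrite /basis_path valK. Qed.

Variant path_cat_spec p q : kQ -> Prop :=
| PathCat r of ptarget p = psource q & val r = (psource p, (val p).2 ++ (val q).2) :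
    path_cat_spec p q (path_elt k r)
| PathCat0 of ptarget p <> psource q : path_cat_spec p q 0.

Lemma path_catP p q : path_cat_spec p q (path_cat k p q).
Proof.
rewrite /path_cat; case: eqP => [e|]; last exact: PathCat0.
rewrite /basis_path; case: insubP => [r _ er|]; first exact: PathCat.
rewrite /= cat_path; case/negP; apply/andP; split; first exact: (valP p).
by rewrite -/(ptarget p) e; exact: (valP q).
Qed.

Lemma path_cat_src p q r : val r = (psource p, (val p).2 ++ (val q).2) ->
  psource r = psource p.
Proof. by move=> er; rewrite [LHS]/psource er. Qed.

Lemma path_cat_tgt p q r : ptarget p = psource q ->
  val r = (psource p, (val p).2 ++ (val q).2) -> ptarget r = ptarget q.
Proof.
by move=> e er; rewrite [LHS]/ptarget er /= last_cat -/(ptarget p) e.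
Qed.

Lemma path_catA p q r :
  path_mul (path_cat k p q) (path_elt k r) = path_mul (path_elt k p) (path_cat k q r).
Proof.
case: (path_catP p q) => [u e1 e2|e1]; case: (path_catP q r) => [v e3 e4|e3].
- rewrite !path_mul_basis; case: path_catP => [u1 f1 f2|f1]; last first.
    by case: f1; rewrite (path_cat_tgt e1 e2).
  case: path_catP => [v1 g1 g2|g1]; last by case: g1; rewrite (path_cat_src e4).
  congr (path_elt k _); apply: val_inj; rewrite f2 g2 (path_cat_src e2) e2 e4 /=.
  by rewrite catA.
- rewrite path_mulf0 path_mul_basis; case: path_catP => // u1 f1 f2.
  by case: e3; rewrite -f1 (path_cat_tgt e1 e2).
- rewrite path_mul0f path_mul_basis; case: path_catP => // u1 f1 f2.
  by case: e1; rewrite f1 (path_cat_src e4).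
- by rewrite path_mul0f path_mulf0.
Qed.

Definition lin (F : kQ -> kQ) := forall a f g, F (a *: f + g) = a *: F f + F g.

Lemma lin0 F : lin F -> F 0 = 0.
Proof. by move=> FP; have := FP (-1) 0 0; rewrite scaler0 addr0 scaleN1r addNr. Qed.

Lemma linZ F a f : lin F -> F (a *: f) = a *: F f.
Proof. by move=> FP; rewrite -[a *: f]addr0 FP lin0 // addr0. Qed.

Lemma lin_eq F G : lin F -> lin G ->
  (forall p, F (path_elt k p) = G (path_elt k p)) -> F =1 G.
Proof.
move=> FP GP FG; elim/path_alg_ind=> [|a p f IH]; first by rewrite !lin0.
by rewrite FP GP FG IH.
Qed.

Lemma lin_mull h : lin (fun f => path_mul f h).
Proof. by move=> a f g; rewrite (path_mulPl h a f g). Qed.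

Lemma lin_mulr h : lin (fun f => path_mul h f).
Proof. by move=> a f g; rewrite (path_mulPr h a f g). Qed.

Lemma lin_comp F G : lin F -> lin G -> lin (fun f => F (G f)).
Proof. by move=> FP GP a f g; rewrite GP FP. Qed.

Lemma path_mulA : associative (@path_mul k Q).
Proof.
move=> f g h; move: f; apply: lin_eq => [||p].
- exact: lin_mull.
- exact: lin_comp (lin_mull h) (lin_mull g).
move: g; apply: lin_eq => [||q].
- exact: lin_comp (lin_mulr (path_elt k p)) (lin_mull h).
- exact: lin_comp (lin_mull h) (lin_mulr (path_elt k p)).
move: h; apply: lin_eq => [||r].
- exact: lin_comp (lin_mulr (path_elt k p)) (lin_mulr (path_elt k q)).
- exact: lin_mulr.
by rewrite (path_mul_basis q r) (path_mul_basis p q) path_catA.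
Qed.

Definition trivial_path (v : Q) : qpath Q := Sub (v, [::]) isT.

Lemma path_oneE : path_one = \sum_(v : Q) path_elt k (trivial_path v).
Proof.
by apply: eq_bigr => v _; rewrite -[(v, _)]/(val (trivial_path v)) basis_pathE.
Qed.

Lemma path_cat_triv_l v p :
  path_cat k (trivial_path v) p = if v == psource p then path_elt k p else 0.
Proof.
rewrite /path_cat -[ptarget _]/v -[psource (trivial_path v)]/v /=.
by case: eqP => // ->; rewrite -basis_pathE [val p in RHS]surjective_pairing.
Qed.

Lemma path_cat_triv_r v p :
  path_cat k p (trivial_path v) = if ptarget p == v then path_elt k p else 0.
Proof.
rewrite /path_cat -[psource (trivial_path v)]/v /= cats0.
by case: eqP => // _; rewrite -basis_pathE [val p in RHS]surjective_pairing.
Qed.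

Lemma lin_sum F (s : seq Q) (G : Q -> kQ) : lin F ->
  F (\sum_(v <- s) G v) = \sum_(v <- s) F (G v).
Proof.
move=> FP; apply: (big_morph F _ (lin0 FP)) => f g.
by have := FP 1 f g; rewrite !scale1r.
Qed.

Lemma path_mul1 : left_id path_one (@path_mul k Q).
Proof.
apply: lin_eq => [||p]; [exact: lin_mulr | by [] |].
rewrite path_oneE (lin_sum _ _ (lin_mull (path_elt k p))) (bigD1 (psource p)) //=.
rewrite path_mul_basis path_cat_triv_l eqxx big1 ?addr0 // => v nv.
by rewrite path_mul_basis path_cat_triv_l (negPf nv).
Qed.

Lemma path_mulr1 : right_id path_one (@path_mul k Q).
Proof.
apply: lin_eq => [||p]; [exact: lin_mull | by [] |].
rewrite path_oneE (lin_sum _ _ (lin_mulr (path_elt k p))) (bigD1 (ptarget p)) //=.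
rewrite path_mul_basis path_cat_triv_r eqxx big1 ?addr0 // => v nv.
by rewrite path_mul_basis path_cat_triv_r eq_sym (negPf nv).
Qed.

Lemma path_mulDl : left_distributive (@path_mul k Q) +%R.
Proof. by move=> f g h; have := path_mulPl h 1 f g; rewrite !scale1r. Qed.

Lemma path_mulDr : right_distributive (@path_mul k Q) +%R.
Proof. by move=> h f g; have := path_mulPr h 1 f g; rewrite !scale1r. Qed.

Lemma coefP p a f g : (a *: f + g)@_p = a * f@_p + g@_p.
Proof. by rewrite mcoeffD mcoeffZ. Qed.

Lemma coef_trivial_mul (v : Q) f g :
  (path_mul f g)@_(trivial_path v) = f@_(trivial_path v) * g@_(trivial_path v).
Proof.
set e := trivial_path v.
elim/path_alg_ind: f => [|a p f IH]; first by rewrite path_mul0f mcoeff0 mul0r.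
rewrite (path_mulPl g a (path_elt k p) f).
rewrite (coefP e a (path_mul (path_elt k p) g)) (coefP e a (path_elt k p)).
rewrite IH mulrDl -mulrA; congr (_ * _ + _).
elim/path_alg_ind: g {f IH a} => [|a q g IH]; first by rewrite path_mulf0 mcoeff0 mulr0.
rewrite (path_mulPr (path_elt k p) a (path_elt k q) g).
rewrite (coefP e a (path_mul _ (path_elt k q))) (coefP e a (path_elt k q)).
rewrite IH mulrDr mulrCA; congr (_ * _ + _).
rewrite path_mul_basis !coef_elt; case: path_catP => [r e1 e2|e1].
  rewrite coef_elt -natrM mulnb; congr (_ *+ nat_of_bool _).
  apply/eqP/andP => [re|[/eqP pe /eqP qe]].
    move: e2; rewrite re => -[ev /esym/nilP]; rewrite /nilp size_cat addn_eq0.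
    case/andP=> /nilP p0 /nilP q0; split; apply/eqP/val_inj.
      by rewrite [val p]surjective_pairing p0 -[(val p).1]ev.
    rewrite [val q]surjective_pairing q0 -[(val q).1]e1 /ptarget p0 /=.
    by rewrite -[(val p).1]ev.
  by apply: val_inj; rewrite e2 pe qe.
rewrite mcoeff0; case: eqP => [pe|]; last by rewrite mul0r.
by case: eqP => [qe|]; [case: e1; rewrite pe qe|rewrite mulr0].
Qed.

Lemma coef_trivial_one (v : Q) : path_one@_(trivial_path v) = 1.
Proof.
rewrite path_oneE raddf_sum (bigD1 v) //= big1 ?addr0 => [|w nw].
  by rewrite coef_elt eqxx.
by rewrite coef_elt; case: eqP => // /(congr1 val) [ew]; rewrite ew eqxx in nw.
Qed.

Lemma path_one_neq0 : path_one != 0.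
Proof.
have /card_gt0P[v _] := quiver_nonempty Q.
apply/eqP => /(congr1 (mcoeff (trivial_path v))).
by rewrite coef_trivial_one mcoeff0 => /eqP; rewrite oner_eq0.
Qed.

HB.instance Definition _ := GRing.Zmodule_isNzRing.Build kQ
  path_mulA path_mul1 path_mulr1 path_mulDl path_mulDr path_one_neq0.

Lemma path_scaleAl (a : k) f g : a *: (f * g) = (a *: f) * g.
Proof. exact: esym (linZ a f (lin_mull g)). Qed.
HB.instance Definition _ := GRing.Lmodule_isLalgebra.Build k kQ path_scaleAl.

Lemma path_scaleAr (a : k) f g : a *: (f * g) = f * (a *: g).
Proof. exact: esym (linZ a g (lin_mulr f)). Qed.
HB.instance Definition _ := GRing.Lalgebra_isAlgebra.Build k kQ path_scaleAr.

End PathAlg.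

(* A right A-module is a left module over the converse ring A^c, and (A^c)^o
   is A as a right module over itself.  The next definitions are for left
   modules over an arbitrary ring R and are used with R = A^c. *)

Section Modules.
Variable R : nzRingType.
Implicit Types M N P E T : lmodType R.

Definition surj (X Y : Type) (f : X -> Y) : Prop := forall y, exists x, f x = y.

Definition mod_iso M N : Prop := exists f : {linear M -> N}, bijective f.

Definition fin_gen M : Prop :=
  exists (m : nat) (e : 'I_m -> M),
    forall x, exists c : 'I_m -> R, x = \sum_i c i *: e i.

Definition short_exact M E N (f : {linear M -> E}) (g : {linear E -> N}) : Prop :=
  [/\ injective f, surj g & forall y, g y = 0 <-> exists x, f x = y].

Definition projective P : Prop :=
  forall M N (g : {linear M -> N}), surj g ->
  forall h : {linear P -> N}, exists h' : {linear P -> M}, forall x, g (h' x) = h x.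

Definition pd_le1 T : Prop :=
  exists (P1 P0 : lmodType R) (f : {linear P1 -> P0}) (g : {linear P0 -> T}),
    [/\ projective P1, projective P0 & short_exact f g].

(* Ext^1(M, N) = 0 in Yoneda's description: every extension of M by N splits. *)
Definition Ext1_zero M N : Prop :=
  forall E (f : {linear N -> E}) (g : {linear E -> M}),
    short_exact f g -> exists s : {linear M -> E}, cancel s g.

(* N is in add T: it is a direct summand of some T^m. *)
Definition in_add T N : Prop :=
  exists (m : nat) (i : {linear N -> {ffun 'I_m -> T}})
         (p : {linear {ffun 'I_m -> T} -> N}), cancel i p.

Definition indecomposable M : Prop :=
  (exists x : M, x <> 0) /\
  forall X Y : lmodType R, mod_iso M (X * Y)%type ->
    (forall x : X, x = 0) \/ (forall y : Y, y = 0).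

Definition is_direct_sum M (r : nat) (X : 'I_r -> lmodType R) : Prop :=
  exists (i : forall j, {linear X j -> M}) (p : forall j, {linear M -> X j}),
    [/\ forall j, cancel (i j) (p j),
        forall j l, j <> l -> forall x, p l (i j x) = 0
      & forall x, x = \sum_j i j (p j x)].

Definition basic_module M : Prop :=
  exists (r : nat) (X : 'I_r -> lmodType R),
    [/\ is_direct_sum M X, forall j, indecomposable (X j)
      & forall j l, j <> l -> ~ mod_iso (X j) (X l)].

End Modules.

(* The endomorphism algebra of a right module; f * g is the map x |-> f (g x).
   The zero module has the zero ring as endomorphism ring, so this is a
   [pzRingType] with a compatible k-module structure and not an [algType]. *)
Definition End_alg (k : comNzRingType) (A : algType k) (T : lmodType A^c) : Type :=
  {linear T -> T}.

Section EndAlg.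
Variables (k : comNzRingType) (A : algType k) (T : lmodType A^c).
Local Notation E := (End_alg T).
Implicit Types (a b : k) (f g h : E).

HB.instance Definition _ := gen_eqMixin E.
HB.instance Definition _ := gen_choiceMixin E.

Lemma endP f g : (f : T -> T) =1 g -> f = g.
Proof.
case: f g => [f [[f0] [fZ]]] [g [[g0] [gZ]]] /= /funext fg.
rewrite fg in f0 fZ *; congr GRing.Linear.Pack; congr GRing.Linear.Class.
  by congr Algebra.isNmodMorphism.phant_Build; exact: Prop_irrelevance.
by congr GRing.isScalable.phant_Build; exact: Prop_irrelevance.
Qed.

Definition end_zero : E := [the {linear T -> T} of \0].
Definition end_opp f : E := [the {linear T -> T} of \- f].
Definition end_add f g : E := [the {linear T -> T} of f \+ g].
Definition end_one : E := [the {linear T -> T} of idfun].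
Definition end_mul f g : E := [the {linear T -> T} of f \o g].

Definition end_scale_fun a f (x : T) : T := (a%:A : A^c) *: f x.

Lemma scalar_convC a (b : A^c) : (a%:A : A^c) * b = b * (a%:A : A^c).
Proof.
rewrite -[LHS]/((b : A) * a%:A) -[RHS]/(a%:A * (b : A)).
by rewrite -scalerAr -scalerAl mulr1 mul1r.
Qed.

Lemma end_scale_linear a f : linear (end_scale_fun a f).
Proof.
move=> b x y; rewrite /end_scale_fun linearP scalerDr !scalerA.
by rewrite scalar_convC.
Qed.

HB.instance Definition _ a f :=
  GRing.isLinear.Build A^c T T *:%R (end_scale_fun a f) (end_scale_linear a f).

Definition end_scale a f : E := [the {linear T -> T} of end_scale_fun a f].

Lemma end_addA : associative end_add.
Proof. by move=> f g h; apply: endP => x /=; rewrite addrA. Qed.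
Lemma end_addC : commutative end_add.
Proof. by move=> f g; apply: endP => x /=; rewrite addrC. Qed.
Lemma end_add0 : left_id end_zero end_add.
Proof. by move=> f; apply: endP => x /=; rewrite add0r. Qed.
Lemma end_addN : left_inverse end_zero end_opp end_add.
Proof. by move=> f; apply: endP => x /=; rewrite addNr. Qed.
HB.instance Definition _ :=
  GRing.isZmodule.Build E end_addA end_addC end_add0 end_addN.

Lemma end_mulA : associative end_mul.
Proof. by move=> f g h; apply: endP. Qed.
Lemma end_mul1 : left_id end_one end_mul.
Proof. by move=> f; apply: endP. Qed.
Lemma end_mulr1 : right_id end_one end_mul.
Proof. by move=> f; apply: endP. Qed.
Lemma end_mulDl : left_distributive end_mul +%R.
Proof. by move=> f g h; apply: endP. Qed.
Lemma end_mulDr : right_distributive end_mul +%R.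
Proof. by move=> f g h; apply: endP => x /=; rewrite linearD. Qed.
HB.instance Definition _ := GRing.Zmodule_isPzRing.Build E
  end_mulA end_mul1 end_mulr1 end_mulDl end_mulDr.

Lemma end_scaleA a b f : end_scale a (end_scale b f) = end_scale (a * b) f.
Proof.
apply: endP => x /=; rewrite /end_scale_fun /= /end_scale_fun scalerA.
congr (_ *: _); rewrite -[LHS]/((b%:A : A) * a%:A).
by rewrite -scalerAl mul1r scalerA mulrC.
Qed.
Lemma end_scale1 : left_id 1 end_scale.
Proof.
by move=> f; apply: endP => x /=; rewrite /end_scale_fun scale1r [LHS]scale1r.
Qed.
Lemma end_scaleDr : right_distributive end_scale +%R.
Proof. by move=> a f g; apply: endP => x /=; rewrite /end_scale_fun scalerDr. Qed.
Lemma end_scaleDl f : {morph end_scale^~ f : a b / a + b}.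
Proof.
by move=> a b; apply: endP => x /=; rewrite /end_scale_fun scalerDl [LHS]scalerDl.
Qed.
HB.instance Definition _ := GRing.Zmodule_isLmodule.Build k E
  end_scaleA end_scale1 end_scaleDr end_scaleDl.

End EndAlg.

Definition tilting (k : comNzRingType) (A : algType k) (T : lmodType A^c) : Prop :=
  [/\ fin_gen T, pd_le1 T, Ext1_zero T T
    & exists (T' T'' : lmodType A^c) (f : {linear (A^c)^o -> T'})
             (g : {linear T' -> T''}),
        [/\ in_add T T', in_add T T'' & short_exact f g]].

(* Right ideals are taken up to isomorphism, as right modules embedded in A. *)
Definition right_hereditary (k : comNzRingType) (A : algType k) : Prop :=
  forall (M : lmodType A^c) (f : {linear M -> (A^c)^o}), injective f -> projective M.

Definition alg_iso (k : comNzRingType) (A B : algType k) : Prop :=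
  exists f : {lrmorphism A -> B}, bijective f.

Section TypeA.
Variables (k : closedFieldType) (n : nat) (n_gt0 : (0 < n)%N).

Lemma linear_quiver_nonempty : (0 < #|'I_n|)%N.
Proof. by rewrite card_ord. Qed.

(* i : 'I_n stands for the vertex i + 1 of the quiver 1 -> 2 -> ... -> n. *)
Definition linear_quiver : quiver :=
  @Quiver 'I_n (fun i j => j == i.+1 :> nat) linear_quiver_nonempty.

Definition tilted_typeA (B : algType k) : Prop :=
  exists T : lmodType (path_alg k linear_quiver)^c,
    [/\ tilting T, basic_module T
      & exists f : {lrmorphism B -> End_alg T}, bijective f].

Definition nonhereditary_tilted_typeA (B : algType k) : Prop :=
  tilted_typeA B /\ ~ right_hereditary B.

End TypeA.

(* The disk with n + 3 boundary points: 0 is p and i.+1 is x_i, numbered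
   counterclockwise.  A permissible curve is determined by its pair of end
   points and is represented by it. *)

Section Surface.
Variable n : nat.
Local Notation point := 'I_n.+3.
Local Notation curve := {set point}.
Implicit Types (a b q u v : point) (c d t : curve) (G : {set curve}).

Definition pt_p : point := ord0.
Definition pt_x (i : nat) : point := inord i.+1.

Definition permissible c : bool := #|c| == 2.

(* [ordS a] is the cyclic successor of a, [ord_pred a] its predecessor. *)
Definition boundary_segment c : bool := [exists a, c == [set a; ordS a]].

Definition chords_cross c d : bool :=
  [exists a, exists b, exists u, exists v,
    [&& c == [set a; b], d == [set u; v], (a < u)%N, (u < b)%N & (b < v)%N]].

(* The curves meet in the interior of the disk: their end points interlace. *)
Definition crosses c d : bool := chords_cross c d || chords_cross d c.

Definition partial_dissection G : bool :=
  [forall c in G, permissible c && ~~ boundary_segment c] &&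
  [forall c in G, forall d in G, ~~ crosses c d].

Definition triangulation G : bool := maxset partial_dissection G.

Definition c_P1 : curve := [set pt_x 0; pt_x n.+1].

(* In a triangulation, three points pairwise joined by curves of G or boundary
   segments are the vertices of a triangle, as no curve can enter it. *)
Definition sides t : {set curve} := [set c : curve | (c \subset t) && (#|c| == 2)].

Definition triangle G t : bool :=
  (#|t| == 3) && [forall c in sides t, (c \in G) || boundary_segment c].

Definition complete_triangle G t : bool := triangle G t && (sides t \subset G).

(* Delta consists of the arcs p x_1, ..., p x_n. *)
Definition nontrivial c : bool :=
  [exists i : 'I_n, crosses c [set pt_p; pt_x i.+1]].

(* {q, a} is obtained from {q, b} by moving b clockwise in m > 0 steps, all
   curves obtained on the way being nontrivial; in particular q is not
   passed, a one-point set being trivial. *)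
Definition clockwise_move q b a : bool :=
  [exists m : 'I_n.+3,
    [&& (0 < m)%N, a == iter m (@ord_pred _) b
      & [forall l : 'I_n.+3, (0 < l <= m)%N ==>
           nontrivial [set q; iter l (@ord_pred _) b]]]].

Definition tri_arrow G c1 c2 : bool :=
  [exists t, [&& triangle G t, c1 \in sides t & c2 \in sides t]] &&
  [exists q, exists a, exists b,
    [&& c1 == [set q; a], c2 == [set q; b], c1 != c2 & clockwise_move q b a]].

Definition has_complete_triangle G : bool := [exists t, complete_triangle G t].

Definition Tri_ct : Type :=
  {G : {set curve} |
    [&& triangulation G, c_P1 \in G & has_complete_triangle G]}.

Lemma Tri_ct_P1 (G : Tri_ct) : c_P1 \in val G.
Proof. by case/and3P: (valP G). Qed.

End Surface.

Section AlgebraOfTriangulation.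
Variables (k : closedFieldType) (n : nat) (G : {set {set 'I_n.+3}}).
Variable P1G : c_P1 n \in G.

Lemma tri_quiver_nonempty : (0 < #|{: {c | c \in G}}|)%N.
Proof. by apply/card_gt0P; exists (exist _ (c_P1 n) P1G). Qed.

Definition tri_quiver : quiver :=
  @Quiver {c | c \in G} (fun c1 c2 => tri_arrow G (val c1) (val c2))
          tri_quiver_nonempty.

Local Notation kQ := (path_alg k tri_quiver).

Definition arrow_elt (c1 c2 : tri_quiver) : kQ := basis_path k (c1, [:: c2]).

Definition tri_relations : set kQ :=
  fun x => exists c1 c2 c3 : tri_quiver,
     [/\ arrow c1 c2, arrow c2 c3,
         exists t, triangle G t /\ sides t = [set val c1; val c2; val c3]
       & x = arrow_elt c1 c2 * arrow_elt c2 c3].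

Definition tri_ideal (x : kQ) : bool := `[< gen_ideal tri_relations x >].

Lemma tri_ideal_closed : zmod_closed tri_ideal.
Proof.
split=> [|x y /asboolP xI /asboolP yI]; apply/asboolP => J JI SJ; case: (JI) => // _.
by move=> JB _ _; apply: JB; [exact: xI | exact: yI].
Qed.

Lemma tri_ideal_proper : ring_quotient.proper_ideal tri_ideal.
Proof.
split=> [|a x /asboolP xI]; last first.
  by apply/asboolP => J JI SJ; case: (JI) => _ _ Jl _; apply: Jl; exact: xI.
pose v : tri_quiver := exist _ (c_P1 n) P1G.
pose J : set kQ := [set x : kQ | mcoeff (trivial_path v) x = 0]%classic.
apply/asboolP => /(_ J) J1.
suff /J1 H : is_ideal J.
  suff /H /eqP : (tri_relations `<=` J)%classic.
    by rewrite coef_trivial_one oner_eq0.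
  move=> x [c1 [c2 [c3 [_ _ _ ->]]]]; rewrite /J /= coef_trivial_mul.
  rewrite /arrow_elt /basis_path; case: insubP => [p _ ep|_].
    by rewrite coef_elt; case: eqP => [/(congr1 val)|]; rewrite ?ep // mul0r.
  by rewrite mcoeff0 mul0r.
split=> [|x y|a x|a x]; rewrite /J /=.
  - exact: mcoeff0.
  - by move=> x0 y0; rewrite mcoeffB x0 y0 subrr.
  - by move=> x0; rewrite coef_trivial_mul x0 mulr0.
  - by move=> x0; rewrite coef_trivial_mul x0 mul0r.
Qed.

Lemma tri_ideal_right (a x : kQ) : x \in tri_ideal -> x * a \in tri_ideal.
Proof.
move=> /asboolP xI.
by apply/asboolP => J JI SJ; case: (JI) => _ _ _ Jr; apply: Jr; exact: xI.
Qed.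

HB.instance Definition _ := GRing.isZmodClosed.Build kQ tri_ideal tri_ideal_closed.
HB.instance Definition _ := isProperIdeal.Build kQ tri_ideal tri_ideal_proper.
HB.instance Definition _ := isRightStable.Build kQ tri_ideal tri_ideal_right.

Definition tri_alg : algType k := [the algType k of quot_alg tri_ideal].

End AlgebraOfTriangulation.

(* Main.v *)
(* A triangulation containing c_P(1) triangulates the polygon x_0, ..., x_{n+1}.
   Its chord x_a x_b corresponds to the indecomposable A_n-module supported on
   the vertices a+1, ..., b-1.  Two chords cross iff there is a nonsplit
   extension between the modules, and a maximal noncrossing set of chords is
   the same as a basic tilting module T: the coresolution of A_n by add T is
   read off the chain of chords above a given point, and conversely a chord
   that could be added would make a path act bijectively on T, hence on A_n.
   For noncrossing chords c, d the space Hom(T_d, T_c) is zero or a line, and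
   it is nonzero iff c and d share their left or their right end point and are
   suitably nested; the algebras End T and A^Gamma both have a basis indexed by
   these pairs, with the same multiplication.

   The chords form a binary tree rooted at c_P(1), the triangle below a chord
   having its two children as further sides, and complete triangles are the
   zero relations left child -> parent -> right child.  Without any, the algebra
   is the path algebra of a tree and is hereditary; otherwise the right ideal
   generated by the first arrow of a relation is not projective.  An algebra
   isomorphism preserves the arrows and the zero relations.  A zero relation
   shows which neighbours of its middle vertex are the children, and this
   information propagates through the tree, first up to the root and then
   down, so that the tree, hence Gamma, is determined. *)

Require Import Defs.
From HB Require Import structures.
From mathcomp Require Import all_boot all_algebra.
From mathcomp Require Import generic_quotient ring_quotient.
From mathcomp Require Import boolp zify.

Set Implicit Arguments.
Unset Strict Implicit.
Unset Printing Implicit Defensive.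

(** * Noncrossing families of intervals *)

(* The pair (L v, H v) stands for the chord from x_(L v) to x_(H v).+1 and for
   the interval module supported on the vertices i : 'I_n with L v <= i < H v. *)
Record tri_family (n : nat) (V : Type) (L H : V -> nat) : Prop := TriFamily {
  tf_range : forall v, L v < H v <= n;
  tf_inj : forall v w, L v = L w -> H v = H w -> v = w;
  tf_nocross : forall v w, L v < L w -> L w <= H v -> H v < H w -> False;
  tf_max : forall l h, l < h <= n ->
    (forall v, ~ (l < L v <= h /\ h < H v) /\ ~ (L v < l <= H v /\ H v < h)) ->
    exists v, L v = l /\ H v = h
}.

(* hom_rel c d means Hom(T_d, T_c) <> 0 for the interval modules T_c and T_d. *)
Definition hom_rel (V : Type) (L H : V -> nat) : rel V :=
  fun c d => [&& L c <= L d, L d < H c & H c <= H d].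

(* The pair (l, l) stands for the boundary segment from x_l to x_l.+1. *)
Definition seg (n : nat) (V : Type) (L H : V -> nat) (l h : nat) : Prop :=
  l = h /\ h <= n \/ exists v, L v = l /\ H v = h.

Section Family.
Variables (n : nat) (V : Type) (L H : V -> nat).
Hypothesis F : tri_family n L H.
Local Notation K := (seg n L H).
Local Notation R := (hom_rel L H).

Lemma seg_range l h : K l h -> l <= h <= n.
Proof. by case=> [[-> hn]|[v [<- <-]]]; [lia | have := tf_range F v; lia]. Qed.

Lemma seg_nocross l h l' h' : K l h -> K l' h' -> l < l' -> l' <= h -> h < h' -> False.
Proof.
case=> [[-> _]|[v [<- <-]]]; first by lia.
by case=> [[-> _]|[w [<- <-]]]; [lia | exact: (tf_nocross F)].
Qed.

Lemma seg_max l h : l <= h <= n ->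
  (forall l' h', K l' h' -> ~ (l < l' <= h /\ h < h') /\ ~ (l' < l <= h' /\ h' < h)) ->
  K l h.
Proof.
move=> lh nc; have [<-|nlh] := eqVneq l h; first by left; lia.
right; apply: (tf_max F); first by lia.
by move=> v; apply: nc; right; exists v.
Qed.

Lemma seg_curve l h : K l h -> l < h -> exists v, L v = l /\ H v = h.
Proof. by move=> [[e _]|//]; lia. Qed.

Lemma seg_of v : K (L v) (H v).
Proof. by right; exists v. Qed.

Lemma seg_root : K 0 n.
Proof. by apply: seg_max => [|l' h' /seg_range]; lia. Qed.

Lemma seg_split l h : K l h -> l < h -> exists m, [/\ l <= m < h, K l m & K m.+1 h].
Proof.
move=> Klh lh.
have Kll : K l l by left; have := seg_range Klh; lia.
have ub m : `[< l <= m < h /\ K l m >] -> m <= h by move/asboolP; lia.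
have ex : exists m, `[< l <= m < h /\ K l m >].
  by exists l; apply/asboolP; split => //; lia.
case: (ex_maxnP ex ub) => m /asboolP[lm Klm] mmax.
exists m; split => //; apply: seg_max; first by have := seg_range Klh; lia.
move=> u v Kuv; have := seg_range Kuv; split=> [[h1 h2]|[h1 h2]].
  by apply: (seg_nocross Klh Kuv); lia.
have [ul|[ul|lu]] : u < l \/ u = l \/ l < u by lia.
- by apply: (seg_nocross Kuv Klh); lia.
- have : v <= m by apply: mmax; apply/asboolP; subst u; split => //; lia.
  by lia.
by apply: (seg_nocross Klm Kuv); lia.
Qed.

Lemma seg_parent l h : K l h -> (l, h) <> (0, n) ->
  (exists2 h', h < h' & K l h' /\ K h.+1 h') \/
  (exists2 l', l' < l & K l' h /\ K l' l.-1).
Proof.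
move=> Klh nroot.
pose P s := `[< exists l' h', [/\ h' - l' = s, l' <= l, h <= h', h - l < h' - l' & K l' h'] >].
have ex : exists s, P s.
  exists (n - 0); apply/asboolP; exists 0, n; have := seg_range Klh.
  split => //; last exact: seg_root.
    by lia.
  suff : l <> 0 \/ h <> n by lia.
  by case: (eqVneq l 0) => [l0|]; [right=> hn; apply: nroot; congr pair | left; lia].
case: (ex_minnP ex) => s /asboolP[l' [h' [es ll hh lt Klh']]] smin.
have r := seg_range Klh; have r' := seg_range Klh'.
have [m [lm K1 K2]] := seg_split Klh' ltac:(lia).
have [hm|[lm'|mid]] : h <= m \/ m < l \/ l <= m < h by lia.
- have [e|ne] : h - l = m - l' \/ h - l < m - l' by lia.
    left; exists h'; first by lia.
    have -> : l = l' by lia.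
    by have -> : h = m by lia.
  suff : s <= m - l' by lia.
  by apply: smin; apply/asboolP; exists l', m; split => //; lia.
- have [e|ne] : h - l = h' - m.+1 \/ h - l < h' - m.+1 by lia.
    right; exists l'; first by lia.
    have -> : l.-1 = m by lia.
    by have -> : h = h' by lia.
  suff : s <= h' - m.+1 by lia.
  by apply: smin; apply/asboolP; exists m.+1, h'; split => //; lia.
have [ll'|ll'] : l' < l \/ l' = l by lia.
  by case: (seg_nocross K1 Klh); lia.
by case: (seg_nocross Klh K2); lia.
Qed.

Lemma seg_next_r l h h2 : K l h -> K l h2 -> h < h2 ->
  exists h', [/\ h < h' <= h2, K l h' & K h.+1 h'].
Proof.
move=> Klh; have r := seg_range Klh.
have [s] := ubnP (h2 - h); elim: s h2 => // s IH h2 hs Kl2 hh.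
have [m [lm K1 K2]] := seg_split Kl2 ltac:(lia).
have [hm|[mh|hm]] : h = m \/ m < h \/ h < m by lia.
- by exists h2; subst m; split => //; lia.
- by case: (seg_nocross Klh K2); lia.
have [h' [a b c]] := IH m ltac:(lia) K1 hm.
by exists h'; split => //; lia.
Qed.

Lemma seg_next_l l l2 h : K l h -> K l2 h -> l < l2 -> l2 < h ->
  exists l', [/\ l < l' <= l2, K l' h & K l l'.-1].
Proof.
move=> Klh Kl2 ll lh; have [m [lm K1 K2]] := seg_split Klh ltac:(lia).
have [a|b] : m < l2 \/ l2 <= m by lia.
  by exists m.+1; split => //; lia.
by case: (seg_nocross K1 Kl2); lia.
Qed.

Lemma hom_relE c d : R c d <->
  (L c = L d /\ H c <= H d) \/ (H c = H d /\ L c <= L d).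
Proof.
have := tf_range F c; have := tf_range F d; rewrite /hom_rel.
split; last by lia.
move=> /and3P[h1 h2 h3]; have [a|[a|b]] : L c = L d \/ H c = H d \/ (L c < L d /\ H c < H d) by lia.
- by left.
- by right.
- by case: (tf_nocross F (v := c) (w := d)); lia.
Qed.

Lemma hom_rel_refl c : R c c.
Proof. by rewrite /hom_rel; have := tf_range F c; lia. Qed.

Lemma hom_rel_anti : antisymmetric R.
Proof. by move=> c d; rewrite /hom_rel => h; apply: (tf_inj F); lia. Qed.

(* The triangle below the chord y has the sides y, (L y, m) and (m.+1, H y) for
   some m; the last two are its children, unless they are boundary segments. *)
Definition left_child (x y : V) : Prop := [/\ L x = L y, H x < H y & K (H x).+1 (H y)].
Definition right_child (x y : V) : Prop := [/\ H x = H y, L y < L x & K (L y) (L x).-1].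
Definition child x y := left_child x y \/ right_child x y.
Definition arr c d : Prop := left_child c d \/ right_child d c.

Lemma arr_hom c d : arr c d -> R c d.
Proof. 
have := tf_range F c; have := tf_range F d.
by move=> ? ? [[]|[]] *; apply/hom_relE; lia.
Qed.

Lemma arr_next c d : R c d -> c <> d -> exists2 y, arr c y & R y d.
Proof.
have rc := tf_range F c; have rd := tf_range F d.
case/hom_relE=> [[e h]|[e h]] ncd.
  have hh : H c < H d.
    suff : H c <> H d by lia.
    by move=> e'; case: ncd; exact: (tf_inj F).
  have Kcd : K (L c) (H d) by rewrite e; exact: seg_of.
  have [h' [r K1 K2]] := seg_next_r (seg_of c) Kcd hh.
  have [y [Ly Hy]] := seg_curve K1 ltac:(lia).
  exists y; first by left; split; rewrite ?Hy //; lia.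
  by apply/hom_relE; lia.
have hh : L c < L d.
  suff : L c <> L d by lia.
  by move=> e'; case: ncd; exact: (tf_inj F).
have Kcd : K (L d) (H c) by rewrite e; exact: seg_of.
have [l' [r K1 K2]] := seg_next_l (seg_of c) Kcd hh ltac:(lia).
have [y [Ly Hy]] := seg_curve K1 ltac:(lia).
exists y; first by right; split; rewrite ?Ly //; lia.
by apply/hom_relE; lia.
Qed.

Lemma left_child_inj c y z : left_child c y -> left_child c z -> y = z.
Proof.
have rc := tf_range F c.
move=> [a1 a2 a3] [b1 b2 b3]; have [e|[e|e]] : H y = H z \/ H y < H z \/ H z < H y by lia.
- by apply: (tf_inj F) => //; lia.
- by case: (seg_nocross (seg_of y) b3); lia.
- by case: (seg_nocross (seg_of z) a3); lia.
Qed.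

Lemma right_child_coinj c y z : right_child y c -> right_child z c -> y = z.
Proof.
have ry := tf_range F y; have rz := tf_range F z.
move=> [a1 a2 a3] [b1 b2 b3]; have [e|[e|e]] : L y = L z \/ L y < L z \/ L z < L y by lia.
- by apply: (tf_inj F) => //; lia.
- by case: (seg_nocross b3 (seg_of y)); lia.
- by case: (seg_nocross a3 (seg_of z)); lia.
Qed.

Lemma left_child_coinj c y z : left_child y c -> left_child z c -> y = z.
Proof.
have ry := tf_range F y; have rz := tf_range F z.
move=> [a1 a2 a3] [b1 b2 b3]; have [e|[e|e]] : H y = H z \/ H y < H z \/ H z < H y by lia.
- by apply: (tf_inj F) => //; lia.
- by case: (seg_nocross (seg_of z) a3); lia.
- by case: (seg_nocross (seg_of y) b3); lia.
Qed.

Lemma right_child_inj c y z : right_child c y -> right_child c z -> y = z.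
Proof.
have rc := tf_range F c.
move=> [a1 a2 a3] [b1 b2 b3]; have [e|[e|e]] : L y = L z \/ L y < L z \/ L z < L y by lia.
- by apply: (tf_inj F) => //; lia.
- by case: (seg_nocross a3 (seg_of z)); lia.
- by case: (seg_nocross b3 (seg_of y)); lia.
Qed.

Lemma arr_inj c y z d : arr c y -> arr c z -> R y d -> R z d -> y = z.
Proof.
have cross a b : left_child c a -> right_child b c -> R a d -> R b d -> a = b.
  move=> [a1 a2 a3] [b1 b2 b3]; rewrite /hom_rel => Ra Rb.
  by case: (tf_nocross F (v := c) (w := d)); lia.
move=> [a1|a1] [b1|b1] Ry Rz.
- exact: left_child_inj a1 b1.
- exact: cross.
- by apply/esym/cross.
- exact: right_child_coinj a1 b1.
Qed.

Lemma arr_rel_zero c y z d : arr c y -> arr y z -> R y d -> R z d -> ~~ R c d ->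
  left_child c y /\ right_child z y.
Proof.
have rc := tf_range F c; have ry := tf_range F y; have rd := tf_range F d.
rewrite /hom_rel; move=> [[a1 a2 a3]|[a1 a2 a3]] yz Ry Rz nR; last by lia.
split=> //; case: yz => // -[b1 b2 b3].
case: (tf_nocross F (v := y) (w := d)); lia.
Qed.

Lemma rel_arr c y z : left_child c y -> right_child z y -> arr c y /\ arr y z /\ ~~ R c z.
Proof.
move=> a b; split; [by left | split; first by right].
move: a b => [a1 a2 a3] [b1 b2 b3]; have rz := tf_range F z.
rewrite /hom_rel; apply/negP => h.
by apply: (tf_nocross F (v := c) (w := z)); lia.
Qed.

Lemma rel_arr_child c y z : arr c y -> arr y z -> ~~ R c z -> left_child c y /\ right_child z y.
Proof.
have rc := tf_range F c; have ry := tf_range F y; have rd := tf_range F z.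
move=> [a|a] [b|b] nR; last first.
- by move: a b nR => [? ? ?] [? ? ?]; rewrite /hom_rel; lia.
- move: a b nR => [a1 a2 a3] [b1 b2 b3] _.
  by case: (tf_nocross F (v := c) (w := z)); lia.
- by split.
- by move: a b nR => [? ? ?] [? ? ?]; rewrite /hom_rel; lia.
Qed.

Lemma arr_cover c d : arr c d <->
  [/\ R c d, c <> d & forall e, R c e -> R e d -> e = c \/ e = d].
Proof.
split=> [a|[Rcd ncd h]]; last first.
  have [y cy Ryd] := arr_next Rcd ncd.
  case: (h y (arr_hom cy) Ryd) => [e|<- //]; subst y.
  by case: cy => [[]|[]]; lia.
have Rcd := arr_hom a.
split=> // [e|e Rce Red]; first by subst d; case: a => [[]|[]]; lia.
have [->|nce] := pselect (e = c); first by left.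
right; have [y cy Rye] := arr_next Rce (fun h => nce (esym h)).
have rc := tf_range F c; have rd := tf_range F d; have ry := tf_range F y. 
have re := tf_range F e.
have Ryd : R y d by move: Rye Red Rcd (arr_hom cy); rewrite /hom_rel; lia.
have e1 := arr_inj cy a Ryd (hom_rel_refl d); subst y.
by apply: hom_rel_anti; rewrite Rye Red.
Qed.
End Family.

(** * Recovering a triangulation from the Hom relation *)

Section ChildFacts.
Variables (n : nat) (V : Type) (L H : V -> nat).
Hypothesis F : tri_family n L H.
Local Notation child := (child n L H).
Local Notation left_child := (left_child n L H).
Local Notation right_child := (right_child n L H).
Local Notation arr := (arr n L H).

Lemma child_size x y : child x y -> H x - L x < H y - L y.
Proof. by have := tf_range F x; have := tf_range F y; move=> ? ? [[]|[]]; lia. Qed.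

Lemma child_arr x y : child x y -> arr x y \/ arr y x.
Proof. by case=> h; [left; left | right; right]. Qed.

Lemma arr_child x y : arr x y -> child x y \/ child y x.
Proof. by case=> h; [left; left | right; right]. Qed.

Lemma child_inj x y z : child x y -> child x z -> y = z.
Proof.
have rx := tf_range F x.
have cross a b : left_child x a -> right_child x b -> False.
  have rb := tf_range F b; move=> [a1 a2 a3] [b1 b2 b3].
  by apply: (tf_nocross F (v := b) (w := a)); lia.
move=> [a|a] [b|b].
- exact: left_child_inj F _ _ _ a b.
- by case: (cross _ _ a b).
- by case: (cross _ _ b a).
- exact: right_child_inj F _ _ _ a b.
Qed.

Lemma children x x' y : child x y -> child x' y -> x <> x' ->
  left_child x y /\ right_child x' y \/ left_child x' y /\ right_child x y.
Proof.
move=> [a|a] [b|b] nx; [|by left|by right|].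
- by case: nx; apply: (left_child_coinj F a b).
- by case: nx; apply: (right_child_coinj F a b).
Qed.

Lemma parent_ex x : (L x, H x) <> (0, n) -> exists y, child x y.
Proof.
have rx := tf_range F x.
case/(seg_parent F (seg_of n L H x)) => [[h' lt [K1 K2]]|[l' lt [K1 K2]]].
  have [y [Ly Hy]] := seg_curve K1 ltac:(lia).
  by exists y; left; split; rewrite ?Ly ?Hy.
have [y [Ly Hy]] := seg_curve K1 ltac:(lia).
by exists y; right; split; rewrite ?Ly ?Hy.
Qed.

Lemma left_child_arr x y : child x y -> arr x y -> left_child x y.
Proof.
by case=> // -[? ? ?] [//|[? ? ?]]; lia.
Qed.

Lemma right_child_arr x y : child x y -> arr y x -> right_child x y.
Proof.
by case=> // -[? ? ?] [[? ? ?]|//]; lia.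
Qed.

End ChildFacts.

Section Rigid.
Variables (n : nat) (V V' : Type) (L H : V -> nat) (L' H' : V' -> nat).
Hypotheses (F : tri_family n L H) (F' : tri_family n L' H').
Variables (s : V -> V') (t : V' -> V).
Hypotheses (st : cancel s t) (ts : cancel t s).
Hypothesis sR : forall c d, hom_rel L' H' (s c) (s d) = hom_rel L H c d.
Variables (x0 y0 z0 : V).
Hypotheses (xy0 : left_child n L H x0 y0) (zy0 : right_child n L H z0 y0).

Local Notation ch := (child n L H).
Local Notation ch' := (child n L' H').
Local Notation ar := (arr n L H).
Local Notation ar' := (arr n L' H').
Local Notation R := (hom_rel L H).
Local Notation R' := (hom_rel L' H').

Lemma arr_iso c d : ar' (s c) (s d) <-> ar c d.
Proof.
rewrite (arr_cover F) (arr_cover F') sR; split=> -[h1 h2 h3]; split=> //.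
- by move=> e; apply: h2; rewrite e.
- move=> e h4 h5; have := h3 (s e); rewrite !sR => /(_ h4 h5).
  by case=> /(can_inj st); [left | right].
- by move=> /(can_inj st).
- move=> e h4 h5; have := h3 (t e); rewrite -!sR !ts => /(_ h4 h5).
  by case=> <-; rewrite ts; [left | right].
Qed.

Lemma relation_iso c d e : left_child n L' H' (s c) (s d) /\ right_child n L' H' (s e) (s d) <->
  left_child n L H c d /\ right_child n L H e d.
Proof.
split=> [[a b]|[a b]].
  have [h1 [h2 h3]] := rel_arr F' a b.
  by apply: (rel_arr_child F); [apply/arr_iso | apply/arr_iso | rewrite -sR].
have [h1 [h2 h3]] := rel_arr F a b.
by apply: (rel_arr_child F'); [apply/arr_iso | apply/arr_iso | rewrite sR].
Qed.

Lemma adj_iso x y : ch x y -> ch' (s x) (s y) \/ ch' (s y) (s x).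
Proof.
move=> xy; case: (child_arr xy) => /arr_iso a; first exact: (arr_child a).
by case: (arr_child a); [right | left].
Qed.

(* Otherwise the images of x and z are the two children of the image of y, so
   that x, y, z form a zero relation and z is a child of y. *)
Lemma child_up x y z : ch x y -> ch' (s x) (s y) -> ch y z -> ch' (s y) (s z).
Proof.
move=> xy sxy yz; case: (adj_iso yz) => // szy.
have nxz : x <> z by move=> e; subst z; have := child_size F xy; have := child_size F yz; lia.
have bad : ch z y -> False.
  by move=> zy; have := child_size F zy; have := child_size F yz; lia.
have nsxz : s x <> s z by move/(can_inj st).
by case: (children F' sxy szy nsxz) => /relation_iso [h1 h2]; case: bad; [right | left].
Qed.

Lemma child_down x y z : ch y z -> ch' (s y) (s z) -> ch x y -> ch' (s x) (s y).
Proof.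
move=> yz syz xy; case: (adj_iso xy) => // syx.
have /(can_inj st) e := child_inj F' syz syx; subst z.
by have := child_size F xy; have := child_size F yz; lia.
Qed.

Lemma child_side x x' y : ch x y -> ch x' y -> x <> x' -> ch' (s x) (s y).
Proof.
move=> a b nx; case: (children F a b nx) => /relation_iso [h1 h2].
  by left.
by right.
Qed.

Lemma root_matched : exists r, (L r = 0 /\ H r = n) /\ 
  exists x, ch x r /\ ch' (s x) (s r).
Proof.
suff up y : (exists x, ch x y /\ ch' (s x) (s y)) ->
    exists r, (L r = 0 /\ H r = n) /\ exists x, ch x r /\ ch' (s x) (s r).
  apply: (up y0); exists x0; split; first by left.
  by left; have /relation_iso[] := conj xy0 zy0.
have [m] := ubnP (n - (H y - L y)); elim: m y => // m IH y hm [x [xy sxy]].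
have [[Ly Hy]|nr] := pselect ((L y, H y) = (0, n)); first by exists y; split => //; exists x.
have [z yz] := parent_ex F nr.
apply: (IH z).
  by have := child_size F yz; have := tf_range F z; lia.
by exists y; split => //; apply: child_up xy sxy yz.
Qed.

Lemma child_iso x y : ch x y -> ch' (s x) (s y).
Proof.
have [r [[Lr Hr] [c [cr scr]]]] := root_matched.
have [m] := ubnP (n - (H x - L x)); elim: m x y => // m IH x y hm xy.
have [[Ly Hy]|nr] := pselect ((L y, H y) = (0, n)).
  have yr : y = r by apply: (tf_inj F); lia.
  subst y; have [->//|nxc] := pselect (x = c).
  exact: child_side xy cr nxc.
have [z yz] := parent_ex F nr.
apply: (child_down yz _ xy); apply: IH => //.
by have := child_size F xy; have := tf_range F y; lia.
Qed.

Lemma left_child_iso x y : left_child n L' H' (s x) (s y) <-> left_child n L H x y.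
Proof.
split=> h; last first.
  by apply: left_child_arr; [apply: child_iso; left | apply/arr_iso; left].
have /arr_iso a : ar' (s x) (s y) by left.
case: (arr_child a) => [c|/child_iso c]; first exact: left_child_arr c a.
have c' : ch' (s x) (s y) by left.
by have := child_size F' c; have := child_size F' c'; lia.
Qed.

Lemma right_child_iso x y : right_child n L' H' (s x) (s y) <-> right_child n L H x y.
Proof.
split=> h; last first.
  by apply: right_child_arr; [apply: child_iso; right | apply/arr_iso; right].
have /arr_iso a : ar' (s y) (s x) by right.
case: (arr_child a) => [/child_iso c|c]; last exact: right_child_arr c a.
have c' : ch' (s x) (s y) by right.
by have := child_size F' c; have := child_size F' c'; lia.
Qed.

Lemma shift d : H' (s d) - L' (s d) = H d - L d /\
  forall c, L d <= L c -> H c <= H d ->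
    L' (s c) + L d = L c + L' (s d) /\ H' (s c) + L d = H c + L' (s d).
Proof.
have [N] := ubnP (H d - L d); elim: N d => // N IH d hN.
have rd := tf_range F d; have rd' := tf_range F' (s d).
have [m [lm K1 K2]] := seg_split F (seg_of n L H d) ltac:(lia).
have [m' [lm' K1' K2']] := seg_split F' (seg_of n L' H' (s d)) ltac:(lia).
have lft v : L v = L d -> H v = m -> left_child n L H v d.
  by move=> e1 e2; split; rewrite ?e2 //; lia.
have rgt v : L v = m.+1 -> H v = H d -> right_child n L H v d.
  by move=> e1 e2; split; rewrite ?e1 //; lia.
have lft' v : left_child n L' H' v (s d) -> H' v = m'.
  have rv := tf_range F' v.
  move=> [a1 a2 a3]; have [//|[h|h]] : H' v = m' \/ H' v < m' \/ m' < H' v by lia.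
    by case: (seg_nocross F' K1' a3); lia.
  by case: (seg_nocross F' (seg_of n L' H' v) K2'); lia.
have rgt' v : right_child n L' H' v (s d) -> L' v = m'.+1.
  have rv := tf_range F' v.
  move=> [a1 a2 a3]; have [//|[h|h]] : L' v = m'.+1 \/ L' v <= m' \/ m'.+1 < L' v by lia.
    by case: (seg_nocross F' K1' (seg_of n L' H' v)); lia.
  by case: (seg_nocross F' a3 K2'); lia.
have cut c : L d <= L c -> H c <= H d -> c <> d -> H c <= m \/ m < L c.
  move=> h1 h2 nc; have [//|[//|h3]] : H c <= m \/ m < L c \/ L c <= m < H c by lia.
    by left.
    by right.
  have [h4|h4] : L d < L c \/ L d = L c by lia.
    by case: (seg_nocross F K1 (seg_of n L H c)); lia.
  have [h5|h5] : H c < H d \/ H d = H c by lia.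
    by case: (seg_nocross F (seg_of n L H c) K2); lia.
  by case: nc; apply: (tf_inj F).
have left_part : m' - L' (s d) = m - L d /\ forall c, L d <= L c -> H c <= m ->
    L' (s c) + L d = L c + L' (s d) /\ H' (s c) + L d = H c + L' (s d).
  have [lt|e] : L d < m \/ m = L d by lia.
    have [v [Lv Hv]] := seg_curve K1 lt.
    have lv := lft v Lv Hv; have slv := (left_child_iso v d).2 lv.
    have [e1 e2] := IH v ltac:(lia).
    have hv := lft' _ slv; case: slv => a1 _ _.
    rewrite hv a1 in e1; split; first by lia.
    by move=> c h1 h2; have := e2 c; lia.
  have e' : m' = L' (s d).
    apply: contrapT => ne.
    have [v [Lv Hv]] := seg_curve K1' ltac:(lia).
    have slv : left_child n L' H' v (s d) by split; rewrite ?Hv //; lia.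
    move: slv; rewrite -(ts v) => /left_child_iso [b1 b2 b3].
    have rtv := tf_range F (t v).
    by case: (seg_nocross F (seg_of n L H (t v)) K2); lia.
  split; first by lia.
  by move=> c; have := tf_range F c; lia.
have right_part : H' (s d) - m' = H d - m /\ forall c, m < L c -> H c <= H d ->
    L' (s c) + m = L c + m' /\ H' (s c) + m = H c + m'.
  have [lt|e] : m.+1 < H d \/ H d = m.+1 by lia.
    have [v [Lv Hv]] := seg_curve K2 lt.
    have rv := rgt v Lv Hv; have srv := (right_child_iso v d).2 rv.
    have [e1 e2] := IH v ltac:(lia).
    have hv := rgt' _ srv; case: srv => a1 _ _.
    rewrite hv a1 in e1; split; first by lia.
    by move=> c h1 h2; have := e2 c; lia.
  have e' : H' (s d) = m'.+1.
    apply: contrapT => ne.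
    have [v [Lv Hv]] := seg_curve K2' ltac:(lia).
    have srv : right_child n L' H' v (s d) by split; rewrite ?Lv //; lia.
    move: srv; rewrite -(ts v) => /right_child_iso [b1 b2 b3].
    have rtv := tf_range F (t v).
    by case: (seg_nocross F K1 (seg_of n L H (t v))); lia.
  split; first by lia.
  by move=> c; have := tf_range F c; lia.
case: left_part right_part => p1 p2 [q1 q2].
split=> [|c h1 h2]; first by lia.
have [->|nc] := pselect (c = d); first by lia.
by case: (cut c h1 h2 nc) => h3; [have := p2 c h1 h3 | have := q2 c h3 h2]; lia.
Qed.

Theorem rigid c : L' (s c) = L c /\ H' (s c) = H c.
Proof.
have [r [[Lr Hr] _]] := root_matched.
have [h1 h2] := shift r; have := h2 c; have := tf_range F c.
have := tf_range F' (s r); lia.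
Qed.

End Rigid.

(** * Triangulations of the disk *)

(* The point x_i is the element i.+1 of 'I_n.+3. *)
Definition chord (n l h : nat) : {set 'I_n.+3} := [set inord l.+1; inord h.+2].

Lemma set2_lt n (a b c d : 'I_n) : a < b -> c < d -> [set a; b] = [set c; d] ->
  a = c /\ b = d.
Proof.
move=> ab cd e; have ha := set21 a b; have hb := set22 a b.
rewrite e in ha hb; have hc := set21 c d; have hd := set22 c d.
rewrite -e in hc hd; move: ha hb hc hd ab cd.
by move=> /set2P[]-> /set2P[]-> /set2P[] e1 /set2P[] e2 ab cd; split => //; apply/val_inj;
  move: (congr1 val e1) (congr1 val e2) => /=; lia.
Qed.

Lemma chords_cross2 n (a b u v : 'I_n.+3) : a < b -> u < v ->
  chords_cross [set a; b] [set u; v] = (a < u < b) && (b < v).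
Proof.
move=> ab uv; apply/existsP/andP => [[a' /existsP[b' /existsP[u' /existsP[v']]]]|[/andP[h1 h2] h3]].
  case/and5P=> /eqP e1 /eqP e2 h1 h2 h3.
  have [-> ->] := set2_lt ab (ltn_trans h1 h2) e1.
  have [-> ->] := set2_lt uv (ltn_trans h2 h3) e2.
  by rewrite h1 h2 h3.
exists a; apply/existsP; exists b; apply/existsP; exists u; apply/existsP; exists v.
by rewrite !eqxx h1 h2 h3.
Qed.

Lemma crosses2 n (a b u v : 'I_n.+3) : a < b -> u < v ->
  crosses [set a; b] [set u; v] = (a < u < b) && (b < v) || (u < a < v) && (v < b).
Proof. by move=> ab uv; rewrite /crosses !chords_cross2. Qed.

Lemma boundary2 n (a b : 'I_n.+3) : 0 < a -> a < b ->
  boundary_segment [set a; b] = (b == a.+1 :> nat).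
Proof.
move=> a0 ab; apply/existsP/eqP => [[x /eqP e]|e].
  have hS : ordS x = x.+1 %% n.+3 :> nat by [].
  have [lx|lx] := ltnP x.+1 n.+3.
    rewrite modn_small // in hS.
    have [ea eb] := set2_lt ab (ltac:(by rewrite hS) : x < ordS x) e.
    by rewrite ea eb hS.
  have xn : x.+1 = n.+3 by have := ltn_ord x; lia.
  rewrite xn modnn in hS.
  have := set2_lt ab (ltac:(by rewrite hS; have := ltn_ord a; lia) : ordS x < x).
  rewrite [[set ordS x; x]]setUC => /(_ e) [ea _].
  by move: a0; rewrite ea hS.
exists a; apply/eqP; congr [set a; _]; apply/val_inj; rewrite /= modn_small //.
by rewrite -e ltn_ord.
Qed.

Lemma boundary0 n (b : 'I_n.+3) : (b == 1 :> nat) || (b == n.+2 :> nat) ->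
  boundary_segment [set ord0; b].
Proof.
case/orP=> /eqP e; apply/existsP.
  exists ord0; apply/eqP; congr [set _; _]; apply: val_inj; rewrite /= e.
  by rewrite modn_small.
exists b; rewrite setUC; apply/eqP; congr [set _; _]; apply: val_inj => /=.
by rewrite e modnn.
Qed.

Section Curves.
Variable n : nat.
Implicit Types (l h m : nat).

Lemma chord_lo l : l <= n.+1 -> (inord l.+1 : 'I_n.+3) = l.+1 :> nat.
Proof. by move=> ?; rewrite inordK. Qed.

Lemma chord_hi h : h <= n -> (inord h.+2 : 'I_n.+3) = h.+2 :> nat.
Proof. by move=> ?; rewrite inordK. Qed.

Lemma chord_lt l h : l <= h <= n -> (inord l.+1 : 'I_n.+3) < (inord h.+2 : 'I_n.+3).
Proof. by move=> ?; rewrite chord_lo ?chord_hi; lia. Qed.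

Lemma chord_inj l h l' h' : l <= h <= n -> l' <= h' <= n ->
  chord n l h = chord n l' h' -> l = l' /\ h = h'.
Proof.
move=> r r' /(set2_lt (chord_lt r) (chord_lt r')) [e1 e2].
have := congr1 (@nat_of_ord _) e1; have := congr1 (@nat_of_ord _) e2.
by rewrite !chord_hi ?chord_lo; lia.
Qed.

Lemma crosses_chord l h l' h' : l <= h <= n -> l' <= h' <= n ->
  crosses (chord n l h) (chord n l' h') =
  (l < l' <= h) && (h < h') || (l' < l <= h') && (h' < h).
Proof.
move=> r r'; rewrite (crosses2 (chord_lt r) (chord_lt r')) !chord_lo ?chord_hi; lia.
Qed.

Lemma boundary_chord l h : l <= h <= n -> boundary_segment (chord n l h) = (l == h).
Proof. by move=> r; rewrite (boundary2 _ (chord_lt r)) ?chord_lo ?chord_hi; lia. Qed.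

Lemma chord_card l h : l <= h <= n -> #|chord n l h| = 2.
Proof.
move=> r; rewrite cards2; case: eqP => // /(congr1 (@nat_of_ord _)).
by rewrite chord_lo ?chord_hi; lia.
Qed.

Lemma c_P1E : c_P1 n = chord n 0 n.
Proof. by []. Qed.

Lemma chord_cover (c : {set 'I_n.+3}) : permissible c -> ~~ boundary_segment c ->
  ~~ crosses c (c_P1 n) -> exists l h, l < h <= n /\ c = chord n l h.
Proof.
case/cards2P=> a [b] [ab ->]; wlog lab : a b ab / a < b.
  move=> hw; have [lab|lba|/val_inj e] := ltngtP a b; first exact: hw.
    by rewrite setUC; apply: hw; rewrite 1?eq_sym.
  by rewrite e eqxx in ab.
have [a0|a0] := posnP a.
  have e : a = ord0 by apply: val_inj.
  rewrite {}e in lab *; move=> nb; have /norP[b1 b2] := contra (@boundary0 n b) nb.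
  rewrite c_P1E (crosses2 lab) ?chord_lt ?leqnn //.
  by rewrite chord_lo ?chord_hi //=; have := ltn_ord b; lia.
rewrite boundary2 // => ba _; exists a.-1, b.-2; have := ltn_ord b; split; first by lia.
by congr [set _; _]; apply: val_inj; rewrite /= inordK; lia.
Qed.

Lemma nontrivial_chord l h : l < h <= n -> nontrivial (chord n l h).
Proof.
move=> r; have ln : l < n by lia.
apply/existsP; exists (Ordinal ln); rewrite /crosses /pt_p /pt_x orbC.
have lh : l <= h <= n by lia.
rewrite (chords_cross2 _ (chord_lt lh)) ?chord_lo ?chord_hi //=; lia.
Qed.

Lemma nontrivial0 (q : 'I_n.+3) : nontrivial [set q; ord0] = false.
Proof.
apply/existsP => -[i]; rewrite /crosses /pt_p /pt_x.
have i0 : (ord0 : 'I_n.+3) < (inord i.+2 : 'I_n.+3) by rewrite inordK //; have := ltn_ord i; lia.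
rewrite setUC; have [q0|q0] := posnP q.
  have -> : q = ord0 by apply: val_inj.
  rewrite setUid /chords_cross => /orP[] /existsP[a /existsP[b /existsP[u /existsP[v]]]].
    case/and5P=> /eqP e _ h1 h2 _; have := set21 a b; have := set22 a b.
    by rewrite -e !inE => /eqP eb /eqP ea; move: h1 h2; rewrite ea eb.
  case/and5P=> _ /eqP e _ h1 h2; have := set21 u v; have := set22 u v.
  by rewrite -e !inE => /eqP eb /eqP ea; move: h1 h2; rewrite ea eb.
by rewrite !chords_cross2 // ltnn.
Qed.

Lemma nontrivial1 (q : 'I_n.+3) : nontrivial [set q; q] = false.
Proof.
apply/existsP => -[i]; rewrite /crosses /chords_cross.
case/orP => /existsP[a /existsP[b /existsP[u /existsP[v]]]].
  case/and5P=> /eqP e _ h1 h2 _; have := set21 a b; have := set22 a b.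
  by rewrite -e !inE => /orP[] /eqP eb /orP[] /eqP ea; move: h1 h2; rewrite ea eb; lia.
case/and5P=> _ /eqP e _ h1 h2; have := set21 u v; have := set22 u v.
by rewrite -e !inE => /orP[] /eqP eb /orP[] /eqP ea; move: h1 h2; rewrite ea eb; lia.
Qed.

Lemma iter_pred (b : 'I_n.+3) m : m <= b -> iter m (@ord_pred _) b = b - m :> nat.
Proof.
elim: m => [|m IH] mb; first by rewrite subn0.
rewrite iterS /= IH; last by lia.
have -> : (b - m + n.+3).-1 = (b - m.+1) + n.+3 by lia.
by rewrite modnDr modn_small //; have := ltn_ord b; lia.
Qed.

Lemma clockwise_lt (q b a : 'I_n.+3) : 0 < b -> clockwise_move q b a -> a < b /\ ~ (a <= q < b).
Proof.
move=> b0 /existsP[m /and3P[m0 /eqP -> /forallP h]].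
have [mb|bm] := ltnP m b.
  rewrite iter_pred; last by lia.
  split=> [|r]; first by lia.
  have i3 : b - q < n.+3 by have := ltn_ord b; lia.
  have := h (Ordinal i3); rewrite /=.
  have -> : iter (b - q) (@ord_pred _) b = q by apply: val_inj; rewrite /= iter_pred; lia.
  by rewrite nontrivial1; lia.
have := h b; rewrite bm b0 /=.
have -> : iter b (@ord_pred _) b = ord0 by apply: val_inj; rewrite /= iter_pred; lia.
by rewrite nontrivial0.
Qed.
End Curves.

Lemma partial_dissectionP n (G : {set {set 'I_n.+3}}) :
  reflect ((forall c, c \in G -> permissible c /\ ~~ boundary_segment c) /\
           (forall c d, c \in G -> d \in G -> ~~ crosses c d)) (partial_dissection G).
Proof.
apply: (iffP andP) => [[/forall_inP h1 /forall_inP h2]|[h1 h2]].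
  split=> [c /h1 /andP //|c d /h2 /forall_inP]; exact.
split; apply/forall_inP => c cG; first by have [-> ->] := h1 c cG.
by apply/forall_inP => d; exact: h2.
Qed.

Lemma crosses_sym n (c d : {set 'I_n.+3}) : crosses c d = crosses d c.
Proof. by rewrite /crosses orbC. Qed.

Lemma crosses_self n l h : l <= h <= n -> crosses (chord n l h) (chord n l h) = false.
Proof. by move=> r; rewrite crosses_chord //; lia. Qed.

Lemma tri_family_of n (G : {set {set 'I_n.+3}}) : triangulation G -> c_P1 n \in G ->
  exists L H : {c | c \in G} -> nat,
    (forall c, val c = chord n (L c) (H c)) /\ tri_family n L H.
Proof.
move=> /maxsetP[/partial_dissectionP[G1 G2] Gmax] G0.
have cov (c : {c | c \in G}) : exists lh : nat * nat, lh.1 < lh.2 <= n /\ val c = chord n lh.1 lh.2.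
  have [p nb] := G1 _ (valP c); have [l [h [r e]]] := chord_cover p nb (G2 _ _ (valP c) G0).
  by exists (l, h).
have [f hf] := choice cov; exists (fun c => (f c).1), (fun c => (f c).2).
split; first by move=> c; case: (hf c).
split=> [c|c d e1 e2|c d h1 h2 h3|l h r nc].
- by case: (hf c).
- by apply: val_inj; have [_ ->] := hf c; have [_ ->] := hf d; rewrite e1 e2.
- have [rc ec] := hf c; have [rd ed] := hf d.
  have := G2 _ _ (valP c) (valP d); rewrite ec ed crosses_chord; lia.
have r' : l <= h <= n by lia.
have nc2 c : c \in G -> ~~ crosses (chord n l h) c.
  move=> cG; have := nc (exist _ c cG); have := hf (exist _ c cG).
  by move: (f _) => [l' h'] /= [rc ->] ?; rewrite crosses_chord; lia.
have lhG : chord n l h \in G.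
  rewrite -(Gmax (chord n l h |: G)) ?setU11 ?subsetUr //.
  apply/partial_dissectionP; split.
    move=> c /setU1P[->|/G1 //]; rewrite /permissible chord_card // boundary_chord //; lia.
  move=> c d /setU1P[->|cG] /setU1P[->|dG]; last exact: G2.
  - by rewrite crosses_self.
  - exact: nc2.
  - by rewrite crosses_sym nc2.
exists (exist (fun c => c \in G) _ lhG); have := hf (exist (fun c => c \in G) _ lhG);
  move: (f _) => [l' h'] /= [rc ec].
have r2 : l' <= h' <= n by lia.
by have [-> ->] := chord_inj r' r2 ec.
Qed.

Lemma triangulation_of n (V : finType) (L H : V -> nat) (F : tri_family n L H) :
  (0 < n)%N ->
  let G := [set chord n (L v) (H v) | v : V] in triangulation G && (c_P1 n \in G).
Proof.
move=> n0 /=; set G := [set _ | _ in _].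
have rg v : L v <= H v <= n by have := tf_range F v; lia.
have P1 : c_P1 n \in G.
  have [v [Lv Hv]] := seg_curve (seg_root F) n0.
  by apply/imsetP; exists v; rewrite ?Lv ?Hv.
rewrite P1 andbT; apply/maxsetP; split.
  apply/partial_dissectionP; split=> [c|c d] /imsetP[v _ ->].
    by rewrite /permissible chord_card // boundary_chord //; have := tf_range F v; lia.
  case/imsetP=> w _ ->; rewrite crosses_chord //; apply/negP => h.
  have [h'|h'] : (L v < L w <= H v) && (H v < H w) \/ (L w < L v <= H w) && (H w < H v) by lia.
    by apply: (tf_nocross F (v := v) (w := w)); lia.
  by apply: (tf_nocross F (v := w) (w := v)); lia.
move=> G' /partial_dissectionP[G1 G2] GG'; apply/eqP; rewrite eqEsubset GG' andbT.
apply/subsetP => c cG'; have [p nb] := G1 _ cG'.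
have [l [h [r ec]]] := chord_cover p nb (G2 _ _ cG' (subsetP GG' _ P1)).
have [v|v [Lv Hv]] := tf_max F r; last by apply/imsetP; exists v; rewrite ?Lv ?Hv.
have vG' : chord n (L v) (H v) \in G' by apply: (subsetP GG'); apply: imset_f.
have := G2 _ _ cG' vG'; rewrite ec crosses_chord //; clear -v r; lia.
Qed.

Section Triangles.
Variables (n : nat) (G : {set {set 'I_n.+3}}) (L H : {c | c \in G} -> nat).
Hypotheses (GE : forall c, val c = chord n (L c) (H c)) (F : tri_family n L H).
Local Notation K := (seg n L H).

Lemma segE l h : l <= h <= n -> K l h <-> (chord n l h \in G) || boundary_segment (chord n l h).
Proof.
move=> r; rewrite boundary_chord //; split.
  case=> [[-> _]|[v [<- <-]]]; first by rewrite eqxx orbT.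
  by rewrite -GE (valP v).
case/orP=> [hG|/eqP ->]; last by left; split=> //; lia.
right; exists (exist (fun c => c \in G) _ hG).
by have [] := chord_inj _ _ (GE (exist (fun c => c \in G) _ hG)) => //;
  have := tf_range F (exist (fun c => c \in G) _ hG); lia.
Qed.

Definition triangle_at (l m h : nat) : {set 'I_n.+3} :=
  [set inord l.+1; inord m.+2; inord h.+2].

Lemma sides3 (a b c : 'I_n.+3) : a < b -> b < c ->
  sides [set a; b; c] = [set [set a; b]; [set b; c]; [set a; c]].
Proof.
move=> ab bc; have ac := ltn_trans ab bc.
have nab : a != b by apply/eqP => e; rewrite e ltnn in ab.
have nbc : b != c by apply/eqP => e; rewrite e ltnn in bc.
have nac : a != c by apply/eqP => e; rewrite e ltnn in ac.
apply/setP => s; rewrite !inE; apply/andP/idP => [[st /cards2P[x [y [xy es]]]]|].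
  subst s; wlog lxy : x y xy st / x < y.
    move=> hw; have [/hw->//|lba|/val_inj e] := ltngtP x y.
      by rewrite [[set x; y]]setUC; apply: hw; rewrite 1?eq_sym // setUC.
    by rewrite e eqxx in xy.
  have := subsetP st x (set21 x y); have := subsetP st y (set22 x y).
  rewrite !inE => /orP[/orP[]|] /eqP ey /orP[/orP[]|] /eqP ex; subst x y;
    rewrite ?eqxx ?orbT //; clear -lxy ab bc; lia.
case/orP=> [/orP[]|] /eqP->; rewrite cards2 ?nab ?nbc ?nac eqxx; split=> //;
  by apply/subsetP => x; rewrite !inE => /orP[] ->; rewrite ?orbT.
Qed.

Lemma sorted3 (t : {set 'I_n.+3}) : #|t| = 3 ->
  exists a b c : 'I_n.+3, [/\ a < b, b < c & t = [set a; b; c]].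
Proof.
move=> t3; have es : sorted (relpre (@nat_of_ord n.+3) ltn) (enum t).
  rewrite /enum_mem; apply: sorted_filter; first by move=> x y z; exact: ltn_trans.
  by rewrite -sorted_map -enumT val_enum_ord iota_ltn_sorted.
move: es (cardE t); rewrite t3; case et : (enum t) => [|a [|b [|c [|]]]] //=.
case/and3P=> ab bc _ _; exists a, b, c; split=> //.
apply/setP => x; rewrite -mem_enum et !inE; by rewrite orbA.
Qed.

Lemma triangle_at_lt l m h : l <= m -> m < h <= n ->
  (inord l.+1 : 'I_n.+3) < (inord m.+2 : 'I_n.+3) /\
  (inord m.+2 : 'I_n.+3) < (inord h.+2 : 'I_n.+3).
Proof. by move=> lm mh; rewrite !inordK; lia. Qed.

Lemma sides_triangle_at l m h : l <= m -> m < h <= n ->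
  sides (triangle_at l m h) = [set chord n l m; chord n m.+1 h; chord n l h].
Proof. by move=> lm mh; have [h1 h2] := triangle_at_lt lm mh; rewrite sides3. Qed.

Lemma card_set3 (a b c : 'I_n.+3) : a < b -> b < c -> #|[set a; b; c]| = 3.
Proof.
move=> ab bc; rewrite -setUA cardsU1 cards2 !inE.
have -> : (a == b) = false by apply/eqP => e; rewrite e ltnn in ab.
have -> : (a == c) = false by apply/eqP => e; have := ltn_trans ab bc; rewrite e ltnn.
have -> // : (b == c) = false by apply/eqP => e; rewrite e ltnn in bc.
Qed.

Lemma triangleE l m h : l <= m -> m < h <= n ->
  triangle G (triangle_at l m h) <-> [/\ K l m, K m.+1 h & K l h].
Proof.
move=> lm mh; have [h1 h2] := triangle_at_lt lm mh.
rewrite /triangle card_set3 // eqxx sides_triangle_at //=.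
have E1 := @segE l m ltac:(lia); have E2 := @segE m.+1 h ltac:(lia).
have E3 := @segE l h ltac:(lia).
split=> [/forall_inP hs|[/E1 k1 /E2 k2 /E3 k3]].
  by split; [apply/E1|apply/E2|apply/E3]; apply: hs; rewrite !inE eqxx ?orbT.
by apply/forall_inP => c; rewrite !inE => /orP[/orP[]|] /eqP->.
Qed.

Lemma inordL c : (inord (L c).+1 : 'I_n.+3) = (L c).+1 :> nat.
Proof. by have r := tf_range F c; rewrite inordK; lia. Qed.

Lemma inordH c : (inord (H c).+2 : 'I_n.+3) = (H c).+2 :> nat.
Proof. by have r := tf_range F c; rewrite inordK; lia. Qed.

Lemma tri_arrowE (c d : {c | c \in G}) : tri_arrow G (val c) (val d) <-> arr n L H c d.
Proof.
have rc := tf_range F c; have rd := tf_range F d.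
have rc' : L c <= H c <= n by lia. have rd' : L d <= H d <= n by lia.
split=> [/andP[/existsP[t /and3P[tt ct dt]] /existsP[q /existsP[a /existsP[b]]]]|].
  case/and4P=> /eqP ec /eqP ed ncd cw.
  have [st3 ssd] := andP tt.
  have side3 : [set a; b] \in sides t.
    move: ct dt ncd; rewrite ec ed !inE => /andP[c1 c2] /andP[d1 d2] ncd.
    have -> /= : [set a; b] \subset t.
      apply/subsetP => x /set2P[]->; [apply: (subsetP c1)|apply: (subsetP d1)]; exact: set22.
    by rewrite cards2; case: (a =P b) ncd => // ->; rewrite eqxx.
  have hb := forall_inP ssd _ side3.
  have := GE c; have := GE d; rewrite ec ed => ed' ec'.
  have b0 : 0 < b.
    by have := set22 q b; rewrite ed' => /set2P[]->; rewrite ?inordL ?inordH.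
  have [ab nab] := clockwise_lt b0 cw.
  have nqa : q != a.
    by apply/eqP => e; have := chord_card rc'; rewrite -ec' e setUid cards1.
  have nqb : q != b.
    by apply/eqP => e; have := chord_card rd'; rewrite -ed' e setUid cards1.
  clear cw side3 ssd st3 tt ct dt ec ed ncd.
  have [qa|aq|/val_inj e] := ltngtP q a; last by rewrite e eqxx in nqa.
    have qb : q < b := ltn_trans qa ab.
    have [e1 e2] := set2_lt qa (chord_lt rc') ec'.
    have [e3 e4] := set2_lt qb (chord_lt rd') ed'.
    have eL : L c = L d.
      by have := inordL c; rewrite -e1 e3 inordL => -[].
    have eH : H c < H d by move: ab; rewrite e2 e4 !inordH.
    rewrite e2 e4 in hb; left; split => //.
    by apply/segE; [clear -rd eH; lia | exact: hb].
  have qb : b < q.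
    have [//|qb|/val_inj e] := ltngtP b q; last by rewrite e eqxx in nqb.
    by case: nab; rewrite qb ltnW.
  rewrite setUC in ec'; rewrite [[set q; b]]setUC in ed'.
  have [e1 e2] := set2_lt aq (chord_lt rc') ec'.
  have [e3 e4] := set2_lt qb (chord_lt rd') ed'.
  have eH : H c = H d.
    by have := inordH c; rewrite -e2 e4 inordH => -[].
  have eL : L c < L d by move: ab; rewrite e1 e3 !inordL.
  rewrite e1 e3 in hb; right; split => //.
  apply/segE; first by clear -rd eL; lia.
  suff -> : chord n (L c) (L d).-1 = [set inord (L c).+1; inord (L d).+1] by [].
  by rewrite /chord prednK //; clear -eL; lia.
move=> A; apply/andP; split.
  apply/existsP; case: A => -[e1 e2 e3].
    exists (triangle_at (L c) (H c) (H d)); apply/and3P; split.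
    - apply/triangleE; [lia|lia|split=> //; first exact: seg_of].
      by rewrite e1; exact: seg_of.
    - by rewrite sides_triangle_at ?GE ?inE ?eqxx ?orbT //; lia.
    - by rewrite GE -e1 sides_triangle_at ?inE ?eqxx ?orbT //; lia.
  exists (triangle_at (L c) (L d).-1 (H c)).
  have e4 : (L d).-1.+1 = L d by lia.
  apply/and3P; split.
  - apply/triangleE; [lia|lia|split=> //; last exact: seg_of].
    by rewrite e4 -e1; exact: seg_of.
  - by rewrite sides_triangle_at ?GE ?inE ?eqxx ?orbT //; lia.
  - by rewrite GE -e1 sides_triangle_at ?e4 ?inE ?eqxx ?orbT //; lia.
have ncd : val c != val d.
  apply/eqP => /val_inj e; move: A; rewrite e => -[[]|[]]; lia.
case: A => -[e1 e2 e3].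
  apply/existsP; exists (inord (L c).+1); apply/existsP; exists (inord (H c).+2).
  apply/existsP; exists (inord (H d).+2); rewrite ncd GE [val d]GE -e1 /chord !eqxx /=.
  have hm : H d - H c < n.+3 by lia.
  apply/existsP; exists (Ordinal hm); apply/and3P; split=> /=; first by lia.
    by apply/eqP/val_inj; rewrite /= iter_pred !inordK; lia.
  apply/forallP => i; apply/implyP => hi.
  have -> : iter i (@ord_pred _) (inord (H d).+2 : 'I_n.+3) = inord (H d - i).+2.
    by apply: val_inj; rewrite /= iter_pred !inordK; lia.
  by apply: nontrivial_chord; clear -rc rd hi e1 e2; rewrite /= in hi; lia.
apply/existsP; exists (inord (H c).+2); apply/existsP; exists (inord (L c).+1).
apply/existsP; exists (inord (L d).+1).
rewrite [[set _; inord (L c).+1]]setUC [[set _; inord (L d).+1]]setUC.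
rewrite ncd GE [val d]GE -e1 /chord !eqxx /=.
have hm : L d - L c < n.+3 by lia.
apply/existsP; exists (Ordinal hm); apply/and3P; split=> /=; first by lia.
  by apply/eqP/val_inj; rewrite /= iter_pred !inordK; lia.
apply/forallP => i; apply/implyP => hi.
have -> : iter i (@ord_pred _) (inord (L d).+1 : 'I_n.+3) = inord (L d - i).+1.
  by apply: val_inj; rewrite /= iter_pred !inordK; lia.
by rewrite setUC; apply: nontrivial_chord; clear -rc rd hi e1 e2; rewrite /= in hi; lia.
Qed.

Lemma tri_relationP (c y z : {c | c \in G}) : left_child n L H c y -> right_child n L H z y ->
  exists t, triangle G t /\ sides t = [set val c; val y; val z].
Proof.
have rc := tf_range F c; have ry := tf_range F y; have rz := tf_range F z.
move=> [a1 a2 a3] [b1 b2 b3].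
have [mz|mz] : L z = (H c).+1 \/ L z <> (H c).+1 by lia.
  exists (triangle_at (L y) (H c) (H y)); split.
    by apply/triangleE; [lia|lia|split=> //; [rewrite -a1; exact: seg_of|exact: seg_of]].
  rewrite sides_triangle_at; [|lia|lia].
  by rewrite !GE mz a1 b1; apply/setP => s; rewrite !inE -!orbA; congr (_ || _); rewrite orbC.
have [h|h] : L z < (H c).+1 \/ (H c).+1 < L z by lia.
  by case: (tf_nocross F (v := c) (w := z)); lia.
by case: (seg_nocross F b3 a3); lia.
Qed.

Lemma uniq_inord (a b e f : nat) : a < b -> b < e -> e < f -> f < n.+3 ->
  uniq [:: (inord a : 'I_n.+3); inord b; inord e; inord f].
Proof.
clear; move=> ? ? ? ?; rewrite -(map_inj_uniq val_inj) /= !inordK ?inE; lia.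
Qed.

Lemma tri_relation_zero (c y z : {c | c \in G}) : tri_arrow G (val c) (val y) ->
  tri_arrow G (val y) (val z) ->
  (exists t, triangle G t /\ sides t = [set val c; val y; val z]) -> ~~ hom_rel L H c z.
Proof.
have rc := tf_range F c; have ry := tf_range F y; have rz := tf_range F z.
move=> /tri_arrowE cy /tri_arrowE yz [t [/andP[/eqP t3 _] st]].
have sub (x : {c | c \in G}) : x \in [set c; y; z] -> val x \subset t.
  move=> xs; have : val x \in sides t.
    by rewrite st; move: xs; rewrite !inE => /orP[/orP[]|] /eqP ->; rewrite eqxx ?orbT.
  by rewrite inE => /andP[].
have sl x : x \in [set c; y; z] -> (inord (L x).+1 \in t) && (inord (H x).+2 \in t).
  by move/sub; rewrite GE => /subsetP h; rewrite !h ?set21 ?set22.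
have /andP[c1 c2] := sl c ltac:(by rewrite !inE eqxx).
have /andP[y1 y2] := sl y ltac:(by rewrite !inE eqxx orbT).
have /andP[z1 z2] := sl z ltac:(by rewrite !inE eqxx orbT).
have big (a b e f : 'I_n.+3) : a \in t -> b \in t -> e \in t -> f \in t ->
    uniq [:: a; b; e; f] -> False.
  move=> at_ bt et ft u; have : #|[set x in [:: a; b; e; f]]| <= #|t|.
    apply: subset_leq_card; apply/subsetP => x; rewrite !inE.
    by case/or4P=> /eqP->.
  by rewrite cardsE (card_uniqP u) t3.
case: cy yz => -[a1 a2 a3] [] [b1 b2 b3].
- case: (big _ _ _ _ c1 c2 y2 z2); clear -rc ry rz a1 a2 b1 b2; apply: uniq_inord; lia.
- apply/negP; rewrite /hom_rel => h; apply: (tf_nocross F (v := c) (w := z));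
  clear -rc ry rz a1 a2 b1 b2 h; lia.
- case: (tf_nocross F (v := c) (w := z)); clear -rc ry rz a1 a2 b1 b2; lia.
case: (big _ _ _ _ c1 y1 z1 c2); clear -rc ry rz a1 a2 b1 b2; apply: uniq_inord; lia.
Qed.

Lemma complete_triangleP : has_complete_triangle G <->
  exists c y z, left_child n L H c y /\ right_child n L H z y.
Proof.
split=> [/existsP[t /andP[tt sG]]|[c [y [z [hc hz]]]]]; last first.
  have [t [tt st]] := tri_relationP hc hz; apply/existsP; exists t.
  rewrite /complete_triangle tt st; apply/subsetP => s; rewrite !inE.
  by case/orP=> [/orP[]|] /eqP->; exact: valP.
have [a [b [e [ab be et]]]] := sorted3 (eqP (andP tt).1).
rewrite et sides3 // in sG.
have abG : [set a; b] \in G by apply: (subsetP sG); rewrite !inE eqxx.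
have beG : [set b; e] \in G by apply: (subsetP sG); rewrite !inE eqxx orbT.
have aeG : [set a; e] \in G by apply: (subsetP sG); rewrite !inE eqxx orbT.
pose c : {c | c \in G} := exist (fun c => c \in G) _ abG;
  pose z : {c | c \in G} := exist (fun c => c \in G) _ beG.
pose y : {c | c \in G} := exist (fun c => c \in G) _ aeG.
have rc := tf_range F c; have ry := tf_range F y; have rz := tf_range F z.
have [c1 c2] := set2_lt ab (chord_lt (ltac:(lia) : L c <= H c <= n)) (GE c).
have [z1 z2] := set2_lt be (chord_lt (ltac:(lia) : L z <= H z <= n)) (GE z).
have [y1 y2] := set2_lt (ltn_trans ab be) (chord_lt (ltac:(lia) : L y <= H y <= n)) (GE y).
have := congr1 (@nat_of_ord _) (etrans (esym c1) y1).
have := congr1 (@nat_of_ord _) (etrans (esym c2) z1).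
have := congr1 (@nat_of_ord _) (etrans (esym z2) y2).
rewrite !inordL !inordH; clear -rc ry rz F => -[e3] [e2] [e1].
exists c, y, z; split; split; try lia.
  have -> : (H c).+1 = L z by lia.
  have -> : H y = H z by lia.
  exact: seg_of.
have -> : (L z).-1 = H c by lia.
have -> : L y = L c by lia.
exact: seg_of.
Qed.
End Triangles.

Import GRing.Theory.
Local Open Scope ring_scope.

(** * Algebras with a multiplicative basis *)

(* The elements bas c d with R c d form a basis with coordinates cf, and
   bas c d * bas d e is bas c e if R c e and 0 otherwise.  The relation R need
   not be transitive; bas c d is unspecified if R c d fails. *)
Record inc_alg (k : fieldType) (B : algType k) (V : finType) (R : rel V)
    (bas : V -> V -> B) (cf : B -> V -> V -> k) : Prop := IncAlg {
  cf_lin : forall a x y c d, cf (a *: x + y) c d = a * cf x c d + cf y c d;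
  cf_mul : forall x y c d,
    cf (x * y) c d = if R c d then \sum_e cf x c e * cf y e d else 0;
  cf_one : forall c d, cf 1 c d = (c == d)%:R;
  cf_out : forall x c d, ~~ R c d -> cf x c d = 0;
  cf_bas : forall c d c' d', R c d -> cf (bas c d) c' d' = ((c' == c) && (d' == d))%:R;
  cf_inj : forall x y, (forall c d, cf x c d = cf y c d) -> x = y
}.

Section IncAlg.
Variables (k : fieldType) (B : algType k) (V : finType) (R : rel V).
Variables (bas : V -> V -> B) (cf : B -> V -> V -> k).
Hypothesis incB : inc_alg R bas cf.

Lemma inc_refl c : R c c.
Proof.
apply/negPn/negP => /(cf_out incB 1); rewrite (cf_one incB) eqxx.
exact/eqP/oner_neq0.
Qed.

Lemma cf0 c d : cf 0 c d = 0.
Proof. by have := cf_lin incB (-1) 0 0 c d; rewrite scaler0 addr0 mulN1r addNr. Qed.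

Lemma cfD x y c d : cf (x + y) c d = cf x c d + cf y c d.
Proof. by have := cf_lin incB 1 x y c d; rewrite scale1r mul1r. Qed.

Lemma cfZ a x c d : cf (a *: x) c d = a * cf x c d.
Proof. by have := cf_lin incB a x 0 c d; rewrite !addr0 cf0 addr0. Qed.

Lemma cfB x y c d : cf (x - y) c d = cf x c d - cf y c d.
Proof. by rewrite cfD -scaleN1r cfZ mulN1r. Qed.

Lemma cf_sum (I : Type) (r : seq I) (P : pred I) (F : I -> B) c d :
  cf (\sum_(i <- r | P i) F i) c d = \sum_(i <- r | P i) cf (F i) c d.
Proof.
by apply: (big_morph (fun x => cf x c d)) => [x y|]; [exact: cfD|exact: cf0].
Qed.

Lemma cf_mul_basr x c d u v : R c d ->
  cf (x * bas c d) u v = if R u v && (v == d) then cf x u c else 0.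
Proof.
move=> Rcd; rewrite (cf_mul incB); case: ifP => //= Ruv.
rewrite (bigD1 c) //= (cf_bas incB _ _ Rcd) eqxx /= big1 ?addr0.
  by case: (v == d); rewrite ?mulr1 ?mulr0.
by move=> e /negPf ne; rewrite (cf_bas incB _ _ Rcd) ne mulr0.
Qed.

Lemma cf_mul_basl x c d u v : R c d ->
  cf (bas c d * x) u v = if R u v && (u == c) then cf x d v else 0.
Proof.
move=> Rcd; rewrite (cf_mul incB); case: ifP => //= Ruv.
rewrite (bigD1 d) //= (cf_bas incB _ _ Rcd) eqxx andbT big1 ?addr0.
  by case: (u == c); rewrite ?mul1r ?mul0r.
by move=> e /negPf ne; rewrite (cf_bas incB _ _ Rcd) ne andbF mul0r.
Qed.

Lemma bas_mul c d e : R c d -> R d e ->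
  bas c d * bas d e = if R c e then bas c e else 0.
Proof.
move=> Rcd Rde; apply: (cf_inj incB) => u v; rewrite cf_mul_basr //.
rewrite (cf_bas incB _ _ Rcd) eqxx andbT.
case: ifP => [/andP[Ruv /eqP ve]|].
  subst v; case: eqP => [uc|nuc].
    by subst u; rewrite Ruv (cf_bas incB _ _ Ruv) !eqxx.
  by case: ifP => Rce; rewrite ?cf0 // (cf_bas incB _ _ Rce); case: eqP.
case: ifP => Rce; rewrite ?cf0 // (cf_bas incB _ _ Rce).
move=> Ruv; case: eqP => // uc; case: eqP => // ve.
by rewrite uc ve Rce eqxx in Ruv.
Qed.

Lemma bas_mul0 c d d' e : R c d -> R d' e -> d != d' -> bas c d * bas d' e = 0.
Proof.
move=> Rcd Rde nd; apply: (cf_inj incB) => u v; rewrite cf_mul_basr // cf0.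
by rewrite (cf_bas incB _ _ Rcd) [d' == d]eq_sym (negPf nd) andbF if_same.
Qed.

Lemma inc_comb (f : V -> V -> k) u v :
  cf (\sum_c \sum_(d | R c d) f c d *: bas c d) u v = if R u v then f u v else 0.
Proof.
have E c : cf (\sum_(d | R c d) f c d *: bas c d) u v =
    if c == u then if R u v then f u v else 0 else 0.
  rewrite cf_sum (eq_bigr (fun d => f c d * ((u == c) && (v == d))%:R)); last first.
    by move=> d Rcd; rewrite cfZ (cf_bas incB _ _ Rcd).
  rewrite [u == c]eq_sym; case: eqP => [->|_] /=; last by rewrite big1 // => d; rewrite mulr0.
  case: ifP => Ruv.
    rewrite (bigD1 v) //= eqxx mulr1 big1 ?addr0 // => d /andP[_].
    by rewrite eq_sym => /negPf ->; rewrite mulr0.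
  rewrite big1 // => d Rud; case: eqP => [vd|]; last by rewrite mulr0.
  by rewrite vd Rud in Ruv.
rewrite cf_sum (eq_bigr _ (fun c _ => E c)) (bigD1 u) //= eqxx.
by rewrite big1 ?addr0 // => c /negPf ->.
Qed.

Lemma cf_expand x : x = \sum_c \sum_(d | R c d) cf x c d *: bas c d.
Proof.
apply: (cf_inj incB) => u v; rewrite inc_comb; case: ifPn => // nR.
by rewrite (cf_out incB).
Qed.

Lemma bas_neq0 c d : R c d -> bas c d <> 0.
Proof.
move=> Rcd /(congr1 (fun x => cf x c d)); rewrite cf0 (cf_bas incB _ _ Rcd) !eqxx.
exact/eqP/oner_neq0.
Qed.

Lemma bas_one : 1 = \sum_c bas c c.
Proof.
rewrite [LHS]cf_expand; apply: eq_bigr => c _.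
rewrite (bigD1 c) ?inc_refl //= (cf_one incB) eqxx scale1r big1 ?addr0 // => d.
by case/andP=> _ nd; rewrite (cf_one incB) eq_sym (negPf nd) scale0r.
Qed.

End IncAlg.

Lemma alg_isoP (k : fieldType) (B B' : algType k) (f : B -> B') :
  (forall a x y, f (a *: x + y) = a *: f x + f y) -> (forall x y, f (x * y) = f x * f y) ->
  f 1 = 1 -> bijective f -> alg_iso B B'.
Proof.
move=> fl fM f1 fb.
have fadd : zmod_morphism f.
  by move=> x y; rewrite addrC -scaleN1r fl scaleN1r addrC.
have fscal : scalable f.
  have f0 : f 0 = 0 by have := fadd 0 0; rewrite !subrr.
  by move=> a x; have := fl a x 0; rewrite f0 !addr0.
pose m1 := GRing.isZmodMorphism.Build B B' f fadd.
pose m2 := GRing.isMonoidMorphism.Build B B' f (conj f1 fM).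
pose m3 := GRing.isScalable.Build k B B' *:%R f fscal.
pose F : {lrmorphism B -> B'} := HB.pack f m1 m2 m3.
by exists F.
Qed.

Lemma inc_alg_iso (k : fieldType) (B B' : algType k) (V V' : finType)
  (R : rel V) (R' : rel V') bas bas' cf cf' (s : V -> V') :
  @inc_alg k B V R bas cf -> @inc_alg k B' V' R' bas' cf' -> bijective s ->
  (forall c d, R' (s c) (s d) = R c d) -> alg_iso B B'.
Proof.
move=> H H' bs Rs; case: (bs) => t st ts.
pose f (x : B) : B' :=
  \sum_c \sum_(d | R' c d) cf x (t c) (t d) *: bas' c d.
have fE x c d : cf' (f x) c d = cf x (t c) (t d).
  rewrite /f (inc_comb H'); case: ifP => // /negbT nR.
  by rewrite (cf_out H) // -Rs !ts.
have Rt c d : R (t c) (t d) = R' c d by rewrite -Rs !ts.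
apply: (@alg_isoP _ _ _ f) => [a x y|x y||].
- apply: (cf_inj H') => c d.
  by rewrite fE (cf_lin H) (cf_lin H') !fE.
- apply: (cf_inj H') => c d; rewrite fE (cf_mul H) (cf_mul H') Rt.
  case: ifP => // _; rewrite (reindex t); last by exists s => e _; rewrite ?ts ?st.
  by apply: eq_bigr => e _; rewrite !fE.
- apply: (cf_inj H') => c d; rewrite fE (cf_one H) (cf_one H').
  by rewrite (can_eq ts).
pose g (y : B') : B := \sum_c \sum_(d | R c d) cf' y (s c) (s d) *: bas c d.
have gE x c d : cf (g x) c d = cf' x (s c) (s d).
  rewrite /g (inc_comb H); case: ifP => // /negbT nR.
  by rewrite (cf_out H') // Rs.
exists g => x.
  by apply: (cf_inj H) => c d; rewrite gE fE !st.
by apply: (cf_inj H') => c d; rewrite fE gE !ts.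
Qed.

Lemma alg_iso_sym (k : fieldType) (B B' : algType k) (f : {lrmorphism B -> B'}) :
  bijective f -> exists g : {lrmorphism B' -> B}, cancel f g /\ cancel g f.
Proof.
case=> g fg gf.
have gD : zmod_morphism g by move=> x y; apply: (can_inj fg); rewrite rmorphB /= !gf.
have g1 : g 1 = 1 by apply: (can_inj fg); rewrite rmorph1 ?gf.
have gM : {morph g : x y / x * y} by move=> x y; apply: (can_inj fg); rewrite rmorphM /= !gf.
have gZ : scalable g by move=> a x; apply: (can_inj fg); rewrite linearZ /= !gf.
pose m1 := GRing.isZmodMorphism.Build B' B g gD.
pose m2 := GRing.isMonoidMorphism.Build B' B g (conj g1 gM).
pose m3 := GRing.isScalable.Build k B' B *:%R g gZ.
pose G : {lrmorphism B' -> B} := HB.pack g m1 m2 m3.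
by exists G.
Qed.

Section Characters.
Variables (k : fieldType) (B B' : algType k) (V V' : finType).
Variables (R : rel V) (R' : rel V') (bas : V -> V -> B) (cf : B -> V -> V -> k).
Variables (bas' : V' -> V' -> B') (cf' : B' -> V' -> V' -> k).
Hypotheses (H : inc_alg R bas cf) (H' : inc_alg R' bas' cf').
Hypotheses (Ra : antisymmetric R) (Ra' : antisymmetric R').
Variable f : {lrmorphism B -> B'}.

Lemma chiM x y v : cf' (x * y) v v = cf' x v v * cf' y v v.
Proof.
rewrite (cf_mul H') (inc_refl H') (bigD1 v) //= big1 ?addr0 // => e ne.
case: (boolP (R' v e)) => Re; last by rewrite (cf_out H') // mul0r.
case: (boolP (R' e v)) => Re'; last by rewrite [X in _ * X](cf_out H') // mulr0.
by rewrite (Ra' (x := e) (y := v)) ?Re' ?Re ?eqxx // in ne.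
Qed.

(* An algebra map to the ground field kills the radical, so pulling back the
   diagonal coefficients along an isomorphism permutes them. *)
Lemma character_pullback v' :
  exists v, forall x, cf' (f x) v' v' = cf x v v.
Proof.
pose ep c := cf' (f (bas c c)) v' v'.
have s1 : \sum_c ep c = 1.
  have := cf_one H' v' v'; rewrite eqxx -(rmorph1 f) (bas_one H) rmorph_sum /=.
  by rewrite (cf_sum H').
have [v nv] : exists v, ep v != 0.
  apply: contrapT => /forallNP h; move: s1; rewrite big1 => [|c _].
    by move/esym/eqP; rewrite oner_eq0.
  by apply/eqP; have /negP := h c; rewrite negbK.
have epM c d : c != d -> ep c * ep d = 0.
  move=> ncd; rewrite -chiM -rmorphM /= (bas_mul0 H) ?(inc_refl H) //.
  by rewrite rmorph0 (cf0 H').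
have ep0 c : c != v -> ep c = 0.
  by move=> nc; apply: (mulIf nv); rewrite epM // mul0r.
have ev : ep v = 1 by rewrite -s1 (bigD1 v) //= big1 ?addr0.
have off c d : R c d -> c != d -> cf' (f (bas c d)) v' v' = 0.
  move=> Rcd ncd; apply/eqP; rewrite -sqrf_eq0 expr2 -chiM -rmorphM /=.
  by rewrite (bas_mul0 H) 1?eq_sym // rmorph0 (cf0 H').
exists v => x; rewrite {1}(cf_expand H x) rmorph_sum /= (cf_sum H').
have E c : cf' (f (\sum_(d | R c d) cf x c d *: bas c d)) v' v' =
    if c == v then cf x v v else 0.
  rewrite rmorph_sum /= (cf_sum H') (bigD1 c) ?(inc_refl H) //= big1 ?addr0.
    rewrite linearZ /= (cfZ H') -/(ep c); case: eqP => [->|/eqP nc].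
      by rewrite ev mulr1.
    by rewrite ep0 // mulr0.
  by move=> d /andP[Rcd nd]; rewrite linearZ /= (cfZ H') off ?mulr0 // eq_sym.
rewrite (eq_bigr _ (fun c _ => E c)) (bigD1 v) //= eqxx.
by rewrite big1 ?addr0 // => c /negPf ->.
Qed.

Lemma pullback_rel (g : B' -> B) (s : V' -> V) : cancel g f ->
  (forall v x, cf' (f x) v v = cf x (s v) (s v)) ->
  forall a b, R' a b -> R (s a) (s b).
Proof.
move=> gf hs a b Rab; apply/negPn/negP => nR.
pose e c := bas (s c) (s c); pose x := g (bas' a b).
have z0 : e a * x * e b = 0.
  apply: (cf_inj H) => u v; rewrite (cf_mul_basr H) ?(inc_refl H) // (cf0 H).
  case: ifP => // /andP[Ruv /eqP vb]; rewrite (cf_mul_basl H) ?(inc_refl H) //.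
  case: ifP => // /andP[_ /eqP ua].
  by move: Ruv nR; rewrite vb ua => ->.
have := congr1 (fun y => cf' (f y) a b) z0.
rewrite rmorph0 (cf0 H') !rmorphM /= gf (cf_mul H') Rab.
rewrite (bigD1 b) //= big1 ?addr0 => [|u nu].
  rewrite (cf_mul H') Rab (bigD1 a) //= big1 ?addr0 => [|u nu].
    rewrite (cf_bas H' _ _ Rab) !eqxx !hs !(cf_bas H) ?(inc_refl H) // !eqxx !mulr1.
    by move/eqP; rewrite oner_eq0.
  by rewrite (cf_bas H' _ _ Rab) (negPf nu) mulr0.
rewrite (cf_mul H'); case: ifP => _; last by rewrite mul0r.
by rewrite big1 ?mul0r // => w _; rewrite (cf_bas H' _ _ Rab) (negPf nu) andbF mulr0.
Qed.

End Characters.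

Lemma alg_iso_rel (k : fieldType) (B B' : algType k) (V V' : finType)
  (R : rel V) (R' : rel V') bas bas' cf cf' :
  @inc_alg k B V R bas cf -> @inc_alg k B' V' R' bas' cf' ->
  antisymmetric R -> antisymmetric R' -> alg_iso B B' ->
  exists2 s : V -> V', bijective s & forall c d, R' (s c) (s d) = R c d.
Proof.
move=> H H' Ra Ra' [f bf]; have [g [fg gf]] := alg_iso_sym bf.
have /choice[t ht] := character_pullback H H' Ra' f.
have /choice[s hs] := character_pullback H' H Ra g.
have Rt := pullback_rel H H' gf ht.
have Rs := pullback_rel H' H fg hs.
have diag_inj v w : (forall x, cf x v v = cf x w w) -> v = w.
  move=> /(_ (bas v v)); rewrite !(cf_bas H) ?(inc_refl H) // eqxx andbb.
  by case: eqP => // _ /eqP; rewrite oner_eq0.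
have diag_inj' v w : (forall x, cf' x v v = cf' x w w) -> v = w.
  move=> /(_ (bas' v v)); rewrite !(cf_bas H') ?(inc_refl H') // eqxx andbb.
  by case: eqP => // _ /eqP; rewrite oner_eq0.
have st : cancel s t by move=> v; apply: diag_inj => x; rewrite -ht -hs fg.
have ts : cancel t s by move=> v; apply: diag_inj' => x; rewrite -hs -ht gf.
exists s; first by exists t.
move=> c d; apply/idP/idP => [/Rt|/Rs //]; by rewrite !st.
Qed.

(** * Bound path algebras *)

Section PathCriterion.
Variables (k : fieldType) (Q : quiver) (M R : rel Q) (mu : Q -> nat).
Local Notation kQ := (path_alg k Q).
Hypotheses (Mrefl : reflexive M) (Mtrans : transitive M).
Hypothesis Mmu : forall c d, M c d -> (mu c <= mu d)%N.
Hypothesis RM : forall c d, R c d -> M c d.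
Hypothesis Rrefl : reflexive R.
Hypothesis Rmid : forall c e d, R c d -> M c e -> M e d -> R c e && R e d.
Hypothesis arrR : forall c d : Q, arrow c d -> R c d && (mu c < mu d)%N.
Hypothesis arr_uniq : forall c y z d : Q,
  arrow c y -> arrow c z -> R y d -> R z d -> y = z.
Hypothesis arr_ex : forall c d : Q, R c d -> c <> d -> exists2 y, arrow c y & R y d.

Lemma path_M c s : path (@arrow Q) c s -> M c (last c s).
Proof.
elim: s c => [|y s IH] c /=; first by rewrite Mrefl.
by case/andP=> /arrR/andP[/RM cy _] /IH; exact: Mtrans.
Qed.

Lemma path_unique c s s' : path (@arrow Q) c s -> path (@arrow Q) c s' ->
  last c s = last c s' -> R c (last c s) -> s = s'.
Proof.
have loop e z u : path (@arrow Q) e (z :: u) -> e = last z u -> False.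
  move=> /= /andP[/arrR/andP[_ h1] /path_M/Mmu h2] h3.
  by rewrite -h3 in h2; lia.
elim: s c s' => [|y s IH] c [|z s'] //.
- by move=> _ /loop h /h.
- by move=> /loop h _ /esym/h.
move=> /= /andP[cy ys] /andP[cz zs] e Rc.
have [/andP[Ry _] /andP[Mc _]] := (arrR cy, arrR cz).
have Ry' : R y (last y s) by case/andP: (Rmid Rc (RM Ry) (path_M ys)).
have Rz' : R z (last y s) by rewrite e in Rc *; case/andP: (Rmid Rc (RM Mc) (path_M zs)).
have yz := arr_uniq cy cz Ry' Rz'; subst z.
by rewrite (IH y s').
Qed.

Lemma path_ex c d : R c d -> exists2 s, path (@arrow Q) c s & last c s = d.
Proof.
have [N] := ubnP (mu d - mu c)%N; elim: N c => // N IH c hN Rcd.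
have [->|/eqP ncd] := eqVneq c d; first by exists [::].
have [y cy Ryd] := arr_ex Rcd ncd.
have [|s ys e] := IH y _ Ryd.
  by have /andP[_ h1] := arrR cy; have h2 := Mmu (RM Ryd); lia.
by exists (y :: s); rewrite //= cy.
Qed.

Definition pcoef (x : kQ) (c d : Q) : k :=
  lext (fun p => ([&& psource p == c, ptarget p == d & R c d])%:R : k^o) x.

Lemma pcoef_lin a x y c d : pcoef (a *: x + y) c d = a * pcoef x c d + pcoef y c d.
Proof. exact: (@lextP k Q k^o _ a x y). Qed.

Lemma pcoef0 c d : pcoef 0 c d = 0.
Proof. by have := pcoef_lin (-1) 0 0 c d; rewrite scaler0 addr0 mulN1r addNr. Qed.

Lemma pcoefU p c d :
  pcoef (path_elt k p) c d = ([&& psource p == c, ptarget p == d & R c d])%:R.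
Proof. exact: (@lextU k Q k^o _ p). Qed.

Lemma pcoef_mul x y c d :
  pcoef (path_mul x y) c d = if R c d then \sum_e pcoef x c e * pcoef y e d else 0.
Proof.
elim/path_alg_ind: x => [|a p x IH].
  rewrite path_mul0f pcoef0; case: ifP => // _; rewrite big1 // => e _.
  by rewrite pcoef0 mul0r.
rewrite path_mulPl pcoef_lin {}IH.
have -> : pcoef (path_mul (path_elt k p) y) c d =
    if R c d then \sum_e pcoef (path_elt k p) c e * pcoef y e d else 0.
  elim/path_alg_ind: y => [|b q y IH].
    rewrite path_mulf0 pcoef0; case: ifP => // _; rewrite big1 // => e _.
    by rewrite pcoef0 mulr0.
  rewrite path_mulPr pcoef_lin {}IH.
  have -> : pcoef (path_mul (path_elt k p) (path_elt k q)) c d =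
      if R c d then \sum_e pcoef (path_elt k p) c e * pcoef (path_elt k q) e d else 0.
    rewrite path_mul_basis; case: path_catP => [r e1 e2|ne].
      rewrite pcoefU (path_cat_src e2) (path_cat_tgt e1 e2).
      case: ifP => Rcd; last by rewrite !andbF.
      rewrite (bigD1 (ptarget p)) //= !pcoefU eqxx -e1 eqxx /= big1 ?addr0.
        rewrite -natrM mulnb; congr (_ %:R); congr nat_of_bool.
        case: eqP => //= ec; case: eqP => /= ed; last by rewrite andbF.
        move: (Rcd) => /(@Rmid c (ptarget p) d) -> //.
          by rewrite -ec; exact: path_M (valP p).
        by rewrite e1 -ed; exact: path_M (valP q).
      move=> e /negPf ne; rewrite !pcoefU [ptarget p == e]eq_sym ne /=.
      by rewrite andbF mul0r.
    rewrite pcoef0; case: ifP => // _; rewrite big1 // => e _.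
    rewrite !pcoefU; case: (ptarget p =P e) => [e1|]; last by rewrite andbF mul0r.
    case: (psource q =P e) => [e2|]; last by rewrite mulr0.
    by case: ne; rewrite e1 e2.
  case: ifP => _; last by rewrite mulr0 addr0.
  rewrite mulr_sumr -big_split /=; apply: eq_bigr => e _.
  by rewrite pcoef_lin mulrDr mulrCA.
case: ifP => _; last by rewrite mulr0 addr0.
rewrite mulr_sumr -big_split /=; apply: eq_bigr => e _.
by rewrite pcoef_lin mulrDl mulrA.
Qed.

Lemma pcoef_one c d : pcoef 1 c d = (c == d)%:R.
Proof.
have s (r : seq Q) (F : Q -> kQ) : pcoef (\sum_(v <- r) F v) c d = \sum_(v <- r) pcoef (F v) c d.
  apply: (big_morph (fun x => pcoef x c d)) => [x y|]; last exact: pcoef0.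
  by have := pcoef_lin 1 x y c d; rewrite scale1r mul1r.
rewrite -[1]/(path_one k Q) path_oneE s.
rewrite (bigD1 c) //= big1 ?addr0 => [|v nv].
  rewrite pcoefU /psource /ptarget /= eqxx /=.
  by case: eqP => //= <-; rewrite Rrefl.
by rewrite pcoefU /psource /= (negPf nv).
Qed.

Lemma basis_cat c s s' : path (@arrow Q) c s -> path (@arrow Q) (last c s) s' ->
  basis_path k (c, s) * basis_path k (last c s, s') = basis_path k (c, s ++ s').
Proof.
move=> cs cs'; pose p : qpath Q := exist _ (c, s) cs;
  pose p' : qpath Q := exist _ (last c s, s') cs'.
rewrite -[(c, s)]/(val p) -[(last c s, s')]/(val p') !basis_pathE.
rewrite -[_ * _]/(path_mul _ _) path_mul_basis; case: path_catP => [r e1 e2|[]//].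
by rewrite -basis_pathE e2.
Qed.

Variable I : kQ -> Prop.
Hypothesis idI : is_ideal I.
Hypothesis rel0 : forall c y z d : Q, arrow c y -> arrow y z -> R y d -> R z d ->
  ~~ R c d -> I (basis_path k (c, [:: y; z])).

Lemma path_zero c s : path (@arrow Q) c s -> ~~ R c (last c s) -> I (basis_path k (c, s)).
Proof.
have [I0 IB Il Ir] := idI.
elim: s c => [|y s IH] c /=; first by rewrite Rrefl.
case/andP=> cy ys nR; have cy' : path (@arrow Q) c [:: y] by rewrite /= cy.
have [Ry|nRy] := boolP (R y (last y s)); last first.
  by rewrite -[y :: s]/([:: y] ++ s) -basis_cat //; apply: Il; exact: IH.
case: s ys nR Ry {IH} => [|z s] /= ys nR Ry.
  by have /andP[Rcy _] := arrR cy; rewrite Rcy in nR.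
case/andP: ys => yz zs; have /andP[Ryz _] := arrR yz.
have /andP[_ Rz] := Rmid Ry (RM Ryz) (path_M zs).
have cyz : path (@arrow Q) c [:: y; z] by rewrite /= cy yz.
rewrite -[[:: y, z & s]]/([:: y; z] ++ s) -basis_cat //; apply: Ir.
exact: rel0 Ry Rz nR.
Qed.

Hypothesis I_coef : forall x, I x -> forall c d, pcoef x c d = 0.

Lemma path_inc_alg (B : algType k) (f : kQ -> B) :
  (forall a x y, f (a *: x + y) = a *: f x + f y) ->
  (forall x y, f (x * y) = f x * f y) -> f 1 = 1 -> (forall b, exists x, f x = b) ->
  (forall x, f x = 0 <-> I x) -> 
  exists bas cf, inc_alg R bas cf /\ forall x c d, cf (f x) c d = pcoef x c d.
Proof.
move=> fl fM f1 /choice[g fg] fI; have [I0 IB Il Ir] := idI.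
have f0 : f 0 = 0 by have := fl (-1) 0 0; rewrite scaler0 addr0 scaleN1r addNr.
have fD x y : f (x + y) = f x + f y by have := fl 1 x y; rewrite !scale1r.
have fZ a x : f (a *: x) = a *: f x by have := fl a x 0; rewrite f0 !addr0.
have fB x y : f (x - y) = f x - f y by rewrite fD -scaleN1r fZ scaleN1r.
have fsum (J : Type) (r : seq J) (P : pred J) (F : J -> kQ) :
    f (\sum_(j <- r | P j) F j) = \sum_(j <- r | P j) f (F j).
  by apply: (big_morph f) => [x y|]; [exact: fD | exact: f0].
pose cf (b : B) c d := pcoef (g b) c d.
have cff x c d : cf (f x) c d = pcoef x c d.
  have : I (g (f x) - x) by apply/fI; rewrite fB fg subrr.
  move/I_coef/(_ c d) => h; apply/eqP; rewrite -subr_eq0; apply/eqP.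
  rewrite -{}h /cf; move: (g (f x)) => y.
  by have := pcoef_lin (-1) x y c d; rewrite scaleN1r mulN1r addrC => ->; rewrite addrC.
have /choice[pi0 hpi0] : forall cd : Q * Q, exists s, R cd.1 cd.2 ->
    path (@arrow Q) cd.1 s /\ last cd.1 s = cd.2.
  move=> [c d] /=; have [/path_ex[s h1 h2]|nR] := boolP (R c d); first by exists s.
  by exists [::].
pose b0 c d : kQ := basis_path k (c, pi0 (c, d)).
have b0coef c d u v : R c d -> pcoef (b0 c d) u v = ((u == c) && (v == d))%:R.
  move=> Rcd; have [/= h1 h2] := hpi0 (c, d) Rcd; pose p : qpath Q := exist _ (c, pi0 (c, d)) h1.
  rewrite /b0 -[(c, _)]/(val p) basis_pathE pcoefU /psource /ptarget /= h2.
  rewrite eq_sym [d == v]eq_sym; case: eqP => //= ->; case: eqP => //= ->.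
  by rewrite Rcd.
have comb a x y : I x -> I y -> I (a *: x + y).
  by move=> /fI hx /fI hy; apply/fI; rewrite fl hx hy scaler0 addr0.
have expand x : I (x - \sum_c \sum_(d | R c d) pcoef x c d *: b0 c d).
  elim/path_alg_ind: x => [|a p x IH].
    rewrite big1 ?subrr // => c _; rewrite big1 // => d _; by rewrite pcoef0 scale0r.
  have -> : \sum_c \sum_(d | R c d) pcoef (a *: path_elt k p + x) c d *: b0 c d =
     a *: (\sum_c \sum_(d | R c d) pcoef (path_elt k p) c d *: b0 c d) +
      \sum_c \sum_(d | R c d) pcoef x c d *: b0 c d.
    rewrite scaler_sumr -big_split; apply: eq_bigr => c _ /=.
    rewrite scaler_sumr -big_split; apply: eq_bigr => d _ /=.
    by rewrite pcoef_lin scalerDl scalerA.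
  rewrite opprD addrACA -scalerBr; apply: comb; last exact: IH.
  have zero c d : ~~ ((c == psource p) && (d == ptarget p)) -> pcoef (path_elt k p) c d = 0.
    by rewrite pcoefU [c == _]eq_sym [d == _]eq_sym; do 2!case: eqP.
  rewrite (bigD1 (psource p)) //= [X in _ - (_ + X)]big1 ?addr0; last first.
    move=> c nc; rewrite big1 // => d _; rewrite zero ?scale0r //.
    by rewrite (negPf nc).
  have [Rp|nRp] := boolP (R (psource p) (ptarget p)); last first.
    rewrite big1 ?subr0; last first.
      move=> d Rd; rewrite zero ?scale0r // eqxx /=; apply/eqP => e.
      by rewrite -e Rd in nRp.
    rewrite -basis_pathE [val p]surjective_pairing; apply: path_zero => //.
    exact: valP p.
  rewrite (bigD1 (ptarget p)) //= [X in _ - (_ + X)]big1 ?addr0; last first.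
    by move=> d /andP[_ nd]; rewrite zero ?scale0r // (negPf nd) andbF.
  rewrite pcoefU !eqxx Rp scale1r -basis_pathE.
  have [/= h1 h2] := hpi0 (psource p, ptarget p) Rp.
  rewrite /b0 [val p in X in X - _]surjective_pairing.
  rewrite (@path_unique (val p).1 (val p).2 (pi0 (psource p, ptarget p))) ?subrr //.
  exact: valP p.
exists (fun c d => f (b0 c d)), cf; split=> //; split.
- move=> a x y c d; rewrite -(fg x) -(fg y) -fl !cff; exact: pcoef_lin.
- by move=> x y c d; rewrite -(fg x) -(fg y) -fM !cff pcoef_mul; case: ifP => // _;
    apply: eq_bigr => e _; rewrite !cff.
- by move=> c d; rewrite -f1 cff pcoef_one.
- move=> x c d nR; rewrite -(fg x) cff.
  elim/path_alg_ind: (g x) => [|a p y IH]; first exact: pcoef0.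
  by rewrite pcoef_lin IH pcoefU (negPf nR) !andbF mulr0 addr0.
- by move=> c d u v Rcd; rewrite cff b0coef.
move=> x y h; rewrite -(fg x) -(fg y).
have ex z : f z = \sum_c \sum_(d | R c d) pcoef z c d *: f (b0 c d).
  have /fI := expand z; rewrite fB => /eqP; rewrite subr_eq0 => /eqP ->.
  rewrite fsum; apply: eq_bigr => c _; rewrite fsum; apply: eq_bigr => d _; exact: fZ.
rewrite ex [RHS]ex; apply: eq_bigr => c _; apply: eq_bigr => d _.
by rewrite -!cff !fg h.
Qed.

End PathCriterion.

Lemma quot_map (k : nzRingType) (A : algType k) (I : ideal2 A) :
  exists f : A -> quot_alg I,
    [/\ (forall a x y, f (a *: x + y) = a *: f x + f y), (forall x y, f (x * y) = f x * f y),
      f 1 = 1, (forall b, exists x, f x = b) & (forall x, f x = 0 <-> x \in (I : pred A))].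
Proof.
exists (fun x => (\pi_({ideal_quot (I : idealr A)})%qT x)); split.
- move=> a x y; have h1 := quot_piD I (a *: x) y; have h2 := quot_piZ I a x.
  by rewrite -h1 -h2.
- by move=> x y; exact: esym (quot_piM I x y).
- by [].
- by elim/quot_ind => x; exists x.
move=> x; have -> : (0 : quot_alg I) = \pi_({ideal_quot (I : idealr A)})%qT 0.
  exact: esym (@pi_zeror _ _ _ _ _ {ideal_quot (I : idealr A)}).
by rewrite -[x in x \in _]subr0 -quot_ideal; split=> [->|/eqP].
Qed.

Section Linear.
Variables (k : closedFieldType) (n : nat) (n_gt0 : (0 < n)%N).

Lemma linear_inc_alg : exists bas cf,
  @inc_alg k (path_alg k (linear_quiver n_gt0)) 'I_n
    (fun i j : 'I_n => (i <= j)%N) bas cf.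
Proof.
pose Q := linear_quiver n_gt0; pose le : rel Q := fun i j : 'I_n => (i <= j)%N.
have [] := @path_inc_alg k Q le le (fun i : 'I_n => nat_of_ord i) _ _ _ _ _ _ _ _ _
  (fun x => x = 0) _ _ _ (path_alg k Q) id.
- by move=> i; exact: leqnn.
- by move=> i j l; exact: leq_trans.
- by [].
- by [].
- by move=> i; exact: leqnn.
- by move=> c e d; rewrite /le => _ -> ->.
- by move=> c d; rewrite /= /le => /eqP->; lia.
- by move=> c y z d /= /eqP h1 /eqP h2 _ _; apply: val_inj; rewrite /= h1 h2.
- move=> c d; rewrite /le => cd ncd.
  have lt : (c < d)%N by rewrite ltn_neqAle cd andbT; apply/eqP => /val_inj.
  by exists (Ordinal (leq_ltn_trans lt (ltn_ord d))) => //=.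
- split=> [//|x y -> ->|a x ->|a x ->]; first by rewrite subrr.
    by rewrite mulr0.
  by rewrite mul0r.
- by move=> c y z d; rewrite /= /le => /eqP h1 /eqP h2 h3 h4; lia.
- by move=> x -> c d; rewrite pcoef0.
- by [].
- by [].
- by [].
- by move=> b; exists b.
- by move=> x; split.
by move=> bas [cf [h _]]; exists bas, cf.
Qed.

End Linear.

Section Tri.
Variables (k : closedFieldType) (n : nat) (G : {set {set 'I_n.+3}}).
Variables (P1G : c_P1 n \in G) (L H : {c | c \in G} -> nat).
Hypotheses (GE : forall c, val c = chord n (L c) (H c)) (F : tri_family n L H).

Lemma tri_inc_alg : exists bas cf,
  @inc_alg k (tri_alg k P1G) {c | c \in G} (hom_rel L H) bas cf.
Proof.
pose Q := tri_quiver P1G; pose R : rel Q := hom_rel L H.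
pose M : rel Q := fun c d => (L c <= L d)%N && (H c <= H d)%N.
pose I (x : path_alg k Q) :=  gen_ideal (@tri_relations k n G P1G) x.
have arrE (c d : Q) : arrow c d <-> arr n L H c d by exact: tri_arrowE.
have Rrefl : reflexive R by move=> c; exact: hom_rel_refl F c.
have RM (c d : Q) : R c d -> M c d by rewrite /R /M /hom_rel; lia.
have Mtrans : transitive M by move=> c d e; rewrite /M; lia.
have Mrefl : reflexive M by move=> c; rewrite /M; lia.
have Mmu (c d : Q) : M c d -> (L c + H c <= L d + H d)%N by rewrite /M; lia.
have Rmid (c e d : Q) : R c d -> M c e -> M e d -> R c e && R e d.
  by rewrite /R /M /hom_rel; lia.
have arrR (c d : Q) : arrow c d -> R c d && (L c + H c < L d + H d)%N.
  move=> /arrE a; rewrite /R (arr_hom F a) /=.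
  by case: a => -[]; lia.
have arru (c y z d : Q) : arrow c y -> arrow c z -> R y d -> R z d -> y = z.
  by move=> /arrE h1 /arrE h2; exact: (arr_inj F h1 h2).
have arre (c d : Q) : R c d -> c <> d -> exists2 y : Q, arrow c y & R y d.
  move=> h1 h2; have [y h3 h4] := arr_next F h1 h2.
  by exists y => //; apply/arrE.
have idI : is_ideal I.
  split=> [|x y hx hy|a x hx|a x hx] J JI SJ; case: (JI) => J0 JB Jl Jr.
  - exact: J0.
  - by apply: JB; [exact: hx | exact: hy].
  - by apply: Jl; exact: hx.
  - by apply: Jr; exact: hx.
have rel0 (c y z d : Q) : arrow c y -> arrow y z -> R y d -> R z d ->
    ~~ R c d -> I (basis_path k (c, [:: y; z])).
  move=> cy yz Ry Rz nR J JI SJ; apply: SJ; exists c, y, z; split=> //.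
    have [h1 h2] := arr_rel_zero F ((arrE _ _).1 cy) ((arrE _ _).1 yz) Ry Rz nR.
    exact: (tri_relationP GE F h1 h2).
  rewrite /arrow_elt -[[:: y; z]]/([:: y] ++ [:: z]) basis_cat //= andbT; [exact: cy|exact: yz].
have I_coef x : I x -> forall c d : Q, pcoef R x c d = 0.
  move=> Ix; apply: (Ix (fun x => forall c d : Q, pcoef R x c d = 0)).
    split=> [c d|y z hy hz c d|a y hy c d|a y hy c d].
    - exact: pcoef0.
    - by rewrite addrC -scaleN1r pcoef_lin hy hz mulr0 addr0.
    - rewrite -[a * y]/(path_mul a y) (pcoef_mul Mrefl Mtrans RM Rmid arrR).
      by case: ifP => // _; rewrite big1 // => e _; rewrite hy mulr0.
    rewrite -[y * a]/(path_mul y a) (pcoef_mul Mrefl Mtrans RM Rmid arrR).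
    by case: ifP => // _; rewrite big1 // => e _; rewrite hy mul0r.
  move=> y [c1 [c2 [c3 [a12 a23 ht ->]]]] c d.
  have nR := tri_relation_zero GE F a12 a23 ht.
  rewrite /arrow_elt -[c2 in X in _ * X]/(last c1 [:: c2]) basis_cat /= ?andbT;
    [|exact: a12|exact: a23].
    have pth : path (@arrow Q) c1 [:: c2; c3].
      by rewrite /= andbT; apply/andP; split; [exact: a12|exact: a23].
    pose p : qpath Q := exist _ (c1, [:: c2; c3]) pth.
    rewrite -[(c1, _)]/(val p) basis_pathE pcoefU /psource /ptarget /=.
    by case: eqP => //= <-; case: eqP => //= <-; rewrite /R (negPf nR).
have [f [fl fM f1 fs fI]] := quot_map (tri_ideal (k := k) (P1G := P1G) : ideal2 _).
have fI' x : f x = 0 <-> I x by rewrite fI; split=> /asboolP.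
have [bas [cf [h _]]] := @path_inc_alg k Q M R (fun c => L c + H c)%N Mrefl Mtrans Mmu RM Rrefl
  Rmid arrR arru arre I idI rel0 I_coef (tri_alg k P1G) f fl fM f1 fs fI'.
by exists bas, cf.
Qed.
End Tri.

(** * Heredity *)

Definition ract (k : comNzRingType) (A : algType k) (M : lmodType A^c) (x : M) (a : A) : M :=
  (a : A^c) *: x.

Section Ract.
Variables (k : comNzRingType) (A : algType k).
Implicit Types (M N : lmodType A^c) (a b : A).

Lemma ractM M (x : M) a b : ract (ract x a) b = ract x (a * b).
Proof. by rewrite /ract scalerA. Qed.
Lemma ract1 M (x : M) : ract x 1 = x.
Proof. exact: scale1r. Qed.
Lemma ractDl M (x y : M) a : ract (x + y) a = ract x a + ract y a.
Proof. exact: scalerDr. Qed.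
Lemma ractDr M (x : M) a b : ract x (a + b) = ract x a + ract x b.
Proof. exact: scalerDl. Qed.
Lemma ract0l M a : ract (0 : M) a = 0.
Proof. exact: scaler0. Qed.
Lemma ract0r M (x : M) : ract x 0 = 0.
Proof. exact: scale0r. Qed.
Lemma ractBl M (x y : M) a : ract (x - y) a = ract x a - ract y a.
Proof. exact: scalerBr. Qed.
Lemma ractBr M (x : M) a b : ract x (a - b) = ract x a - ract x b.
Proof. exact: scalerBl. Qed.
Lemma ractZr M (x : M) c a : ract x (c *: a) = ract (ract x a) (c%:A).
Proof. by rewrite ractM -scalerAr mulr1. Qed.
Lemma ract_suml M (I : Type) (r : seq I) (P : pred I) (F : I -> M) a :
  ract (\sum_(i <- r | P i) F i) a = \sum_(i <- r | P i) ract (F i) a.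
Proof. exact: scaler_sumr. Qed.
Lemma ract_sumr M (x : M) (I : Type) (r : seq I) (P : pred I) (F : I -> A) :
  ract x (\sum_(i <- r | P i) F i) = \sum_(i <- r | P i) ract x (F i).
Proof. exact: scaler_suml. Qed.
Lemma ract_lin M N (f : {linear M -> N}) x a : f (ract x a) = ract (f x) a.
Proof. exact: linearZ. Qed.
Lemma ract_reg (x : (A^c)^o) a : ract x a = ((x : A) * a : A).
Proof. by []. Qed.

Lemma mk_linear M N (f : M -> N) :
  (forall x y a, f (ract x a + y) = ract (f x) a + f y) ->
  exists F : {linear M -> N}, F =1 f.
Proof.
move=> fl; have fL : linear f by move=> a x y; exact: fl.
pose F : {linear M -> N} := HB.pack f (GRing.isLinear.Build A^c M N *:%R f fL).
by exists F.
Qed.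
End Ract.

Section RightIdeal.
Variables (k : comNzRingType) (A : algType k) (b : A).

Definition principal : {pred (A^c)^o} := fun x => `[< exists y : A, (x : A) = b * y >].

Lemma principal_closed : submod_closed principal.
Proof.
split; first by apply/asboolP; exists 0; rewrite mulr0.
move=> a x y /asboolP[u hu] /asboolP[v hv]; apply/asboolP.
exists (u * (a : A) + v); rewrite mulrDr mulrA -hu -hv //.
Qed.
HB.instance Definition _ := GRing.isSubmodClosed.Build A^c (A^c)^o principal principal_closed.

Definition principal_ideal := {x : (A^c)^o | x \in principal}.
HB.instance Definition _ := SubChoice.on principal_ideal.
HB.instance Definition _ := [SubChoice_isSubLmodule of principal_ideal by <:].
End RightIdeal.

Lemma not_hereditary (k : fieldType) (B : algType k) (V : finType) (R : rel V) bas cf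
    (c d e : V) : @inc_alg k B V R bas cf -> R c d -> R d e -> ~~ R c e ->
  ~ right_hereditary B.
Proof.
move=> incB Rcd Rde nRce her.
pose b := bas c d.
have [v vP] : exists v : {linear principal_ideal b -> (B^c)^o}, v =1 val.
  by apply: mk_linear => x y a.
have vinj : injective v by move=> x y; rewrite !vP => /val_inj.
have pr (y : (B^c)^o) : (b * (y : B) : (B^c)^o) \in principal b by apply/asboolP; exists y.
have [g gP] : exists g : {linear (B^c)^o ->
  principal_ideal b}, g =1 (fun y => exist (fun x => x \in principal b) _ (pr y)).
  apply: mk_linear => x y a; apply: val_inj => /=.
  by rewrite ract_reg mulrDr mulrA.
have gs : surj g.
  move=> [x px]; have /asboolP[y e'] := px; exists y; rewrite gP; apply: val_inj => /=.
  by rewrite e'.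
have [s sP] := her _ v vinj _ _ g gs [the {linear principal_ideal b -> principal_ideal b} of idfun].
have mp : (b : (B^c)^o) \in principal b by apply/asboolP; exists 1; rewrite mulr1.
pose m : principal_ideal b := exist (fun x => x \in principal b) _ mp; pose u : B := s m.
have e1 : b * u = b by have := congr1 val (sP m); rewrite gP.
have e2 : u * bas d e = 0.
  rewrite -[_ * _]/(ract (s m) (bas d e)) -ract_lin.
  have -> : ract m (bas d e) = 0.
    apply: val_inj; rewrite -[LHS]/(b * bas d e) /b (bas_mul incB) //.
    by rewrite (negPf nRce).
  by rewrite linear0.
have := congr1 (fun x => cf x d e) e2.
rewrite (cf_mul_basr incB) // Rde eqxx /= (cf0 incB) => u0.
have := congr1 (fun x => cf x c d) e1.
rewrite (cf_mul_basl incB) // Rcd eqxx /= u0 (cf_bas incB _ _ Rcd) !eqxx => /eqP.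
by rewrite eq_sym oner_eq0.
Qed.

Section Hereditary.
Variables (k : fieldType) (B : algType k) (V : finType) (R : rel V).
Variables (bas : V -> V -> B) (cf : B -> V -> V -> k).
Hypothesis incB : inc_alg R bas cf.
Hypotheses (Ra : antisymmetric R) (Rt : transitive R).
Hypothesis Rchain : forall u d d' e, R u d -> R d e -> R u d' -> R d' e -> R d d' || R d' d.
Variables (M : lmodType B^c) (f : {linear M -> (B^c)^o}).
Hypothesis finj : injective f.
Variables (X Y : lmodType B^c) (g : {linear X -> Y}) (h : {linear M -> Y}).
Hypothesis gs : surj g.

Definition fcf (x : M) u v := cf (f x) u v.
Definition below (j : nat) (x : M) :=
  forall u : V, (j <= enum_rank u)%N -> forall v, fcf x u v = 0.

Lemma fcfD x y u v : fcf (x + y) u v = fcf x u v + fcf y u v.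
Proof. by rewrite /fcf linearD (cfD incB). Qed.
Lemma fcfB x y u v : fcf (x - y) u v = fcf x u v - fcf y u v.
Proof. by rewrite /fcf linearB (cfB incB). Qed.
Lemma fcf_sum (I : Type) (r : seq I) (P : pred I) (F : I -> M) u v :
  fcf (\sum_(i <- r | P i) F i) u v = \sum_(i <- r | P i) fcf (F i) u v.
Proof. by rewrite /fcf linear_sum (cf_sum incB). Qed.
Lemma fcf_ract x a u v : fcf (ract x a) u v = if R u v then \sum_e fcf x u e * cf a e v else 0.
Proof. by rewrite /fcf ract_lin ract_reg (cf_mul incB). Qed.

Lemma below_ract j x a : below j x -> below j (ract x a).
Proof.
move=> bx u hu v; rewrite fcf_ract; case: ifP => // _.
by rewrite big1 // => e _; rewrite bx // mul0r.
Qed.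
Definition partial_lift (j : nat) (h' : M -> X) :=
  (forall x y a, below j x -> below j y -> h' (ract x a + y) = ract (h' x) a + h' y) /\
  forall x, below j x -> g (h' x) = h x.

(* One row of coefficients at a time: modulo the rows below, an element of [M]
   is determined by its coefficients in row [u], and the rows [u] occurring are
   freely generated by the minimal columns in which they do not vanish. *)
Lemma partial_lift_step (u : V) h' : partial_lift (enum_rank u) h' ->
  exists h2, partial_lift (enum_rank u).+1 h2.
Proof.
move=> [hl hg]; set j := enum_rank u in hl hg *.
pose U d := `[< exists2 x, below j.+1 x & fcf x u d != 0 >].
have URu d : U d -> R u d.
  move=> /asboolP[x _]; apply: contraNT => nR.
  by rewrite /fcf (cf_out incB).
pose D d := U d && [forall d', U d' && R d' d ==> (d' == d)].
have Dex e : U e -> exists2 d, D d & R d e.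
  move=> Ue; have Pe : U e && R e e by rewrite Ue (inc_refl incB).
  case: (@arg_minnP _ e (fun d => U d && R d e) (fun d =>
    #|[set v | R v d]|) Pe) => d /andP[Ud Rde] dmin.
  exists d => //; rewrite /D Ud; apply/forallP => d'; apply/implyP => /andP[Ud' Rd'd].
  have sub : [set v | R v d'] \subset [set v | R v d].
    by apply/subsetP => v; rewrite !inE => /Rt; apply.
  have Pd' : U d' && R d' e by rewrite Ud' (Rt Rd'd Rde).
  have /eqP e1 : [set v | R v d'] == [set v | R v d].
    by rewrite eqEcard sub dmin.
  have : d \in [set v | R v d] by rewrite inE (inc_refl incB).
  by rewrite -e1 inE => Rdd'; apply/eqP/Ra; rewrite Rd'd.
have Duniq d d' e : D d -> D d' -> R d e -> R d' e -> d = d'.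
  move=> /andP[Ud /forallP hd] /andP[Ud' /forallP hd'] Rde Rd'e.
  case/orP: (Rchain (URu _ Ud) Rde (URu _ Ud') Rd'e) => [r|r].
    by have := hd' d; rewrite Ud r => /eqP.
  by have := hd d'; rewrite Ud' r => /eqP.
have /choice[gen genP] : forall d, exists x, D d ->
    below j.+1 x /\ forall v, fcf x u v = (v == d)%:R.
  move=> d; have [Dd|nD] := boolP (D d); last by exists 0.
  have Ud : U d by case/andP: Dd.
  have /asboolP[x bx x0] := Ud.
  exists (ract x ((fcf x u d)^-1 *: bas d d)) => _; split; first exact: below_ract.
  move=> v; rewrite /fcf ract_lin ract_reg -scalerAr (cfZ incB) (cf_mul_basr incB)
    ?(inc_refl incB) //.
  case: (v =P d) => [->|]; last by rewrite andbF mulr0.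
  by rewrite (URu _ Ud) /= mulVf.
have /choice[y yP] : forall d, exists y, g y = h (gen d) by move=> d; exact: gs.
pose be d x := \sum_(c | c == d) \sum_(e | R c e) fcf x u e *: bas c e.
have beE d x p q : cf (be d x) p q = if (p == d) && R d q then fcf x u q else 0.
  have -> : be d x = \sum_c \sum_(e | R c e) (if c == d then fcf x u e else 0) *: bas c e.
    rewrite /be [RHS](bigID (pred1 d)) /= [X in _ = _ + X]big1 ?addr0.
      by apply: eq_bigr => c /eqP ->; apply: eq_bigr => e _; rewrite eqxx.
    by move=> c /negPf nc; rewrite big1 // => e _; rewrite nc scale0r.
  rewrite (inc_comb incB); case: eqP => [->|]; by case: ifP.
have beL d x z a : D d -> below j.+1 x -> below j.+1 z ->
    be d (ract x a + z) = be d x * a + be d z.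
  move=> Dd bx bz; apply: (cf_inj incB) => p q; rewrite (cfD incB) (cf_mul incB) !beE.
  have [->|np] /= := eqVneq p d; last first.
    rewrite addr0; case: ifP => // _; rewrite big1 // => e _.
    by rewrite beE (negPf np) mul0r.
  case: ifP => // Rdq; last by rewrite addr0.
  have Ud : U d by case/andP: Dd.
  rewrite fcfD fcf_ract (Rt (URu _ Ud) Rdq); congr (_ + _).
  apply: eq_bigr => e _; rewrite beE eqxx /=; case: ifP => // nRde.
  rewrite mul0r; apply/eqP; rewrite mulf_eq0; apply/norP => -[x0 a0].
  have Req : R e q by apply: contraNT a0 => nR; rewrite (cf_out incB).
  have [d' Dd' Rd'e] : exists2 d', D d' & R d' e by apply: Dex; apply/asboolP; exists x.
  by rewrite (Duniq _ _ _ Dd Dd' Rdq (Rt Rd'e Req)) Rd'e in nRde.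
pose rho x := x - \sum_(d | D d) ract (gen d) (be d x).
have rhoL x z a : below j.+1 x -> below j.+1 z -> rho (ract x a + z) = ract (rho x) a + rho z.
  move=> bx bz; rewrite /rho ractBl ract_suml addrACA -opprD; congr (_ - _).
  rewrite -big_split; apply: eq_bigr => d Dd /=.
  by rewrite beL // ractDr ractM.
have rhob x : below j.+1 x -> below j (rho x).
  move=> bx v; rewrite leq_eqVlt => /orP[/eqP/val_inj/enum_rank_inj <-|lt] w; last first.
    rewrite fcfB bx // fcf_sum big1 ?subrr // => d Dd.
    by have [bg _] := genP d Dd; rewrite (below_ract _ bg).
  rewrite fcfB fcf_sum.
  have tm d : D d -> fcf (ract (gen d) (be d x)) u w = if R d w then fcf x u w else 0.
    move=> Dd; have [bg gE] := genP d Dd; have Ud : U d by case/andP: Dd.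
    rewrite fcf_ract (bigD1 d) //= gE eqxx mul1r beE eqxx /= big1 ?addr0.
      by case: ifP => // nR; case: ifP => // Rdw; rewrite (Rt (URu _ Ud) Rdw) in nR.
    by move=> e ne; rewrite gE (negPf ne) mul0r.
  rewrite (eq_bigr _ tm); have [->|nz] := eqVneq (fcf x u w) 0.
    by rewrite big1 ?subrr // => d _; case: ifP.
  have [d Dd Rdw] : exists2 d, D d & R d w by apply: Dex; apply/asboolP; exists x.
  rewrite (bigD1 d) //= Rdw big1 ?addr0 ?subrr // => d' /andP[Dd' nd].
  by case: ifP => // Rd'w; rewrite (Duniq _ _ _ Dd' Dd Rd'w Rdw) eqxx in nd.
exists (fun x => h' (rho x) + \sum_(d | D d) ract (y d) (be d x)); split.
  move=> x z a bx bz; rewrite rhoL // hl; [|exact: rhob|exact: rhob].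
  rewrite ractDl ract_suml addrACA; congr (_ + _).
  rewrite -big_split; apply: eq_bigr => d Dd /=.
  by rewrite beL // ractDr ractM.
move=> x bx; rewrite linearD hg; last exact: rhob.
rewrite linear_sum /= (eq_bigr (fun d => h (ract (gen d) (be d x)))).
  by rewrite -linear_sum -linearD /rho subrK.
by move=> d _; rewrite !ract_lin yP.
Qed.

Lemma full_lift : exists h' : {linear M -> X}, forall x, g (h' x) = h x.
Proof.
have lift j : (j <= #|V|)%N -> exists h', partial_lift j h'.
  elim: j => [|j IH] hj.
    have b0 x : below 0 x -> x = 0.
      move=> bx; apply: finj; rewrite linear0; apply: (cf_inj incB) => u v.
      by rewrite (cf0 incB) -/(fcf x u v) bx.
    exists (fun=> 0); split=> [x y a _ _|x /b0 ->]; first by rewrite ract0l addr0.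
    by rewrite !linear0.
  have [h' hh] := IH (ltnW hj).
  pose u := enum_val (Ordinal hj : 'I_#|V|).
  by have := @partial_lift_step u h'; rewrite /u enum_valK; apply.
have [h' [hl hg]] := lift _ (leqnn _).
have all_below x : below #|V| x by move=> u; rewrite leqNgt ltn_ord.
have [F FE] := mk_linear (fun x y a => hl x y a (all_below x) (all_below y)).
by exists F => x; rewrite FE hg.
Qed.
End Hereditary.

Lemma hereditary (k : fieldType) (B : algType k) (V : finType) (R : rel V) bas cf :
  @inc_alg k B V R bas cf -> antisymmetric R -> transitive R ->
  (forall u d d' e, R u d -> R d e -> R u d' -> R d' e -> R d d' || R d' d) ->
  right_hereditary B.
Proof.
move=> incB Ra Rt Rc M f finj X Y g gs h.
exact: (full_lift incB Ra Rt Rc finj h gs).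
Qed.

(** * Interval modules *)

Section PointwiseModules.
Variables (k : fieldType) (n : nat) (A : algType k).
Variables (p : 'I_n -> 'I_n -> A) (ca : A -> 'I_n -> 'I_n -> k).

(* M is the direct sum over s : S of the modules with a one-dimensional space at
   each vertex i with D s i, on which the paths act as identities whenever
   possible; co gives the coordinates. *)
Record coord_module (S : finType) (D : S -> 'I_n -> bool) (M : lmodType A^c)
    (co : M -> S -> 'I_n -> k) : Prop := CoordModule {
  pm_add : forall x y s i, co (x + y) s i = co x s i + co y s i;
  pm_act : forall x a s j,
    co (ract x a) s j = if D s j then \sum_i co x s i * ca a i j else 0;
  pm_out : forall x s i, ~~ D s i -> co x s i = 0;
  pm_inj : forall x y, (forall s i, D s i -> co x s i = co y s i) -> x = y;
  pm_surj : forall F : S -> 'I_n -> k, exists x, forall s i, D s i -> co x s i = F s i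
}.

Hypothesis HA : inc_alg (fun i j : 'I_n => i <= j)%N p ca.

Definition convex (S : finType) (D : S -> 'I_n -> bool) : Prop :=
  forall s (i j l : 'I_n), (i <= j <= l)%N -> D s i -> D s l -> D s j.

Lemma coord_module_ex (S : finType) (D : S -> 'I_n -> bool) : convex D ->
  exists (M : lmodType A^c) (co : M -> S -> 'I_n -> k), coord_module D co.
Proof.
move=> cD; pose T := {ffun {q : S * 'I_n | D q.1 q.2} -> k}.
pose co (x : T) s i := if insub (s, i) is Some q then x q else 0.
pose mk (F : S -> 'I_n -> k) : T := [ffun q => F (val q).1 (val q).2].
have comk F s i : co (mk F) s i = if D s i then F s i else 0.
  rewrite /co; case: insubP => [q Dq e|/negPf nD]; last by rewrite /= in nD; rewrite nD.
  by rewrite ffunE e; rewrite /= in Dq; rewrite Dq.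
have coin (x : T) q : co x (val q).1 (val q).2 = x q.
  by rewrite /co -surjective_pairing valK.
have coext x y : (forall s i, D s i -> co x s i = co y s i) -> x = y.
  by move=> h; apply/ffunP => q; rewrite -!coin; apply: h; exact: valP q.
have coD x y s i : co (x + y) s i = co x s i + co y s i.
  by rewrite /co; case: insub => [q|]; rewrite ?ffunE ?addr0.
have coout x s i : ~~ D s i -> co x s i = 0.
  by move=> nD; rewrite /co insubF //=; exact: negbTE.
pose act (a : A^c) (x : T) : T := mk (fun s j => \sum_i co x s i * ca a i j).
have actA a b x : act a (act b x) = act (a * b) x.
  apply: coext => s l Dl; rewrite !comk Dl.
  have e : forall i, ca (a * b : A^c) i l =
     if (i <= l)%N then \sum_j ca b i j * ca a j l else 0.
    by move=> i; rewrite -[(a * b)%R]/((b : A) * (a : A)) (cf_mul HA).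
  under [RHS]eq_bigr do rewrite e.
  under [LHS]eq_bigr do rewrite comk.
  transitivity (\sum_i \sum_j co x s i * (ca b i j * ca a j l)); last first.
    apply: eq_bigr => i _; rewrite -mulr_sumr; case: ifP => // nil.
    rewrite big1 // => j _; case: (leqP i j) => ij; last first.
      by rewrite [ca b i j](cf_out HA) ?mul0r // -ltnNge.
    rewrite [ca a j l](cf_out HA) ?mulr0 //; apply: contraFN nil; exact: leq_trans.
  rewrite exchange_big; apply: eq_bigr => j _ /=; case: ifP => [_|nDj].
    by rewrite mulr_suml; apply: eq_bigr => i _; rewrite mulrA.
  rewrite mul0r big1 // => i _.
  have [Di|nDi] := boolP (D s i); last by rewrite coout ?mul0r.
  case: (leqP i j) => ij; last by rewrite [ca b i j](cf_out HA) ?mul0r ?mulr0 // -ltnNge.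
  case: (leqP j l) => jl; last by rewrite [ca a j l](cf_out HA) ?mulr0 // -ltnNge.
  by rewrite (cD s i j l) ?ij ?jl // in nDj.
have act1 : left_id 1 act.
  move=> x; apply: coext => s l Dl; rewrite comk Dl.
  rewrite (bigD1 l) //= -[(1 : A^c)]/(1 : A) (cf_one HA) eqxx mulr1.
  by rewrite big1 ?addr0 // => i /negPf ni; rewrite (cf_one HA) ni mulr0.
have actDr : right_distributive act +%R.
  move=> a x y; apply: coext => s l Dl; rewrite coD !comk Dl -big_split /=.
  by apply: eq_bigr => i _; rewrite coD mulrDl.
have actDl x : {morph act^~ x : a b / a + b}.
  move=> a b; apply: coext => s l Dl; rewrite coD !comk Dl -big_split /=.
  by apply: eq_bigr => i _; rewrite (cfD HA) mulrDr.
pose M : lmodType A^c := HB.pack T (GRing.Zmodule_isLmodule.Build A^c T actA act1 actDr actDl).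
exists M, co; split=> //.
- by move=> x a s j; rewrite /ract -[_ *: _]/(act a x) comk.
- by move=> F; exists (mk F) => s i Ds; rewrite comk Ds.
Qed.

Section Basics.
Variables (S : finType) (D : S -> 'I_n -> bool) (M : lmodType A^c) (co : M -> S -> 'I_n -> k).
Hypothesis HM : coord_module D co.

Lemma pm0 s i : co 0 s i = 0.
Proof. by apply: (addrI (co 0 s i)); rewrite -(pm_add HM) !addr0. Qed.

Lemma pm_sum (I : Type) (r : seq I) (P : pred I) (F : I -> M) s i :
  co (\sum_(j <- r | P j) F j) s i = \sum_(j <- r | P j) co (F j) s i.
Proof. by apply: (big_morph (fun x => co x s i)) => [x y|]; [exact: (pm_add HM)|exact: pm0]. Qed.

Lemma pm_basis x (i j : 'I_n) s l : (i <= j)%N ->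
  co (ract x (p i j)) s l = if D s l && (l == j) then co x s i else 0.
Proof.
move=> ij; rewrite (pm_act HM); case: ifP => //= Dl.
rewrite (bigD1 i) //= (cf_bas HA _ _ ij) eqxx /= big1 ?addr0.
  by case: (l == j); rewrite ?mulr1 ?mulr0.
by move=> e /negPf ne; rewrite (cf_bas HA _ _ ij) ne mulr0.
Qed.

Lemma pm_scale x c s i : co (ract x (c%:A)) s i = c * co x s i.
Proof.
rewrite (pm_act HM); case: ifP => [Ds|/negbT nD]; last by rewrite (pm_out HM) ?mulr0.
rewrite (bigD1 i) //= (cfZ HA) (cf_one HA) eqxx mulr1 mulrC big1 ?addr0 // => j nj.
by rewrite (cfZ HA) (cf_one HA) (negPf nj) !mulr0.
Qed.

Lemma pm_make (F : S -> 'I_n -> k) : exists x, forall s i, co x s i = if D s i then F s i else 0.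
Proof.
have [x hx] := pm_surj HM F; exists x => s i; case: ifP => [/hx //|/negbT].
exact: (pm_out HM).
Qed.

End Basics.

Lemma coord_module_hom (S S' : finType) D D' (M M' : lmodType A^c) co co' (c : S' -> S -> k) :
  @coord_module S D M co -> @coord_module S' D' M' co' ->
  (forall s' s (i j : 'I_n), c s' s != 0 -> (i <= j)%N -> D s i -> D' s' j -> D s j = D' s' i) ->
  exists f : {linear M -> M'}, forall x s' i,
    co' (f x) s' i = if D' s' i then \sum_s c s' s * co x s i else 0.
Proof.
move=> HM HM' hc.
have /choice[f fP] : forall x, exists y, forall s' i,
    co' y s' i = if D' s' i then \sum_s c s' s * co x s i else 0.
  by move=> x; exact: (pm_make HM').
have [F FE] : exists F : {linear M -> M'}, F =1 f.
  apply: mk_linear => x y a; apply: (pm_inj HM') => s' j Dj.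
  rewrite (pm_add HM') !fP (pm_act HM') Dj.
  transitivity (\sum_s c s' s * co (ract x a) s j + \sum_s c s' s * co y s j).
    by rewrite -big_split; apply: eq_bigr => s _; rewrite (pm_add HM) mulrDr.
  congr (_ + _); under [RHS]eq_bigr do rewrite fP.
  transitivity (\sum_i \sum_s (c s' s * (if D s j then co x s i * ca a i j else 0))).
    rewrite exchange_big; apply: eq_bigr => s _; rewrite (pm_act HM) -mulr_sumr.
    by case: ifP => // _; rewrite big1 ?mulr0.
  apply: eq_bigr => i _; case: (leqP i j) => ij; last first.
    rewrite (cf_out HA) -?ltnNge // mulr0 big1 // => s _.
    by rewrite mulr0 if_same mulr0.
  have [Di|Di] := boolP (D' s' i).
    rewrite mulr_suml; apply: eq_bigr => s _; have [->|cn] := eqVneq (c s' s) 0.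
      by rewrite !mul0r.
    case: (boolP (D s i)) => Dsi; last by rewrite (pm_out HM) // mul0r if_same mulr0 mul0r.
    by rewrite (hc _ _ _ _ cn ij Dsi Dj) Di mulrA.
  rewrite mul0r big1 // => s _; have [->|cn] := eqVneq (c s' s) 0; first by rewrite mul0r.
  case: (boolP (D s i)) => Dsi; last by rewrite (pm_out HM) // mul0r if_same mulr0.
  by rewrite (hc _ _ _ _ cn ij Dsi Dj) (negPf Di) mulr0.
by exists F => x s' i; rewrite FE fP.
Qed.

Lemma coord_module_regular : @coord_module 'I_n (fun s i => (s <= i)%N) (A^c)^o (fun x s i =>
  ca (x : A) s i).
Proof.
split.
- by move=> x y s i; exact: (cfD HA).
- by move=> x a s j; rewrite ract_reg (cf_mul HA).
- by move=> x s i; exact: (cf_out HA).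
- move=> x y h; apply: (cf_inj HA) => s i; have [si|si] := boolP (s <= i)%N; first exact: h.
  by rewrite !(cf_out HA).
move=> F; exists ((\sum_(s : 'I_n) \sum_(i : 'I_n | (s <= i)%N) F s i *: p s i : A) :
  (A^c)^o) => s i si.
by rewrite (inc_comb HA) si.
Qed.

Lemma coord_module_ffun (m : nat) (S : finType) D (M : lmodType A^c) co : @coord_module S D M co ->
  @coord_module ('I_m * S)%type (fun q i => D q.2 i) {ffun 'I_m ->
    M} (fun x q i => co (x q.1) q.2 i).
Proof.
move=> HM; split.
- by move=> x y [j s] i; rewrite ffunE (pm_add HM).
- by move=> x a [j s] i; rewrite /ract ffunE /= (pm_act HM).
- by move=> x [j s] i; exact: (pm_out HM).
- move=> x y h; apply/ffunP => j; apply: (pm_inj HM) => s i Ds; exact: (h (j, s)).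
move=> F; have /choice[f fP] : forall j, exists x, forall s i, D s i -> co x s i = F (j, s) i.
  by move=> j; exact: (pm_surj HM).
by exists [ffun j => f j] => -[j s] i Ds; rewrite ffunE fP.
Qed.

Section Intervals.
Variables (S : finType) (l r : S -> nat) (M : lmodType A^c) (co : M -> S -> 'I_n -> k).
Hypothesis lr : forall s, (l s < r s <= n)%N.
Definition ivl (s : S) (i : 'I_n) : bool := (l s <= i < r s)%N.
Hypothesis HM : coord_module ivl co.

Lemma top_lt s : (l s < n)%N.
Proof. by have := lr s; lia. Qed.
Definition top s : 'I_n := Ordinal (top_lt s).

Lemma gen_ex : exists u : S -> M,
  forall s t i, co (u s) t i = ((t == s) && (i == top s))%:R.
Proof.
suff /choice[u hu] : forall s, exists x, forall t i,
    co x t i = ((t == s) && (i == top s))%:R by exists u.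
move=> s; have [x hx] := pm_make HM (fun t i => ((t == s) && (i == top s))%:R : k).
exists x => t i; rewrite hx; case: ifP => //; case: eqP => //= ->; case: eqP => // ->.
by rewrite /ivl /= leqnn; have := lr s; lia.
Qed.

Lemma gen_top (u : S -> M) s : (forall s t i, co (u s) t i = ((t == s) && (i == top s))%:R) ->
  ract (u s) (p (top s) (top s)) = u s.
Proof.
move=> hu; apply: (pm_inj HM) => t i Di; rewrite (pm_basis HM) // Di /= !hu eqxx andbT.
by case: (i == top s); rewrite ?andbT ?andbF.
Qed.

Lemma gen_end (u : S -> M) s (j : 'I_n) :
  (forall s t i, co (u s) t i = ((t == s) && (i == top s))%:R) ->
  j = r s :> nat -> ract (u s) (p (top s) j) = 0.
Proof.
move=> hu jr; have tj : (top s <= j)%N by rewrite /= jr; have := lr s; lia.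
apply: (pm_inj HM) => t i Di; rewrite (pm_basis HM) // Di (pm0 HM) /= hu eqxx andbT.
case: eqP => // ij; case: eqP => // ts; move: Di; rewrite /ivl ts ij jr; lia.
Qed.

Definition gen_coeff x s : A := \sum_(i : 'I_n | (l s <= i)%N) co x s i *: p (top s) i.

Lemma cf_gen_coeff x s i j : ca (gen_coeff x s) i j = if i == top s then co x s j else 0.
Proof.
rewrite /gen_coeff (cf_sum HA); have [->|ni] := eqVneq i (top s); last first.
  by rewrite big1 // => e le;
    rewrite (cfZ HA) (cf_bas HA _ _ (le : (top s <= e)%N)) (negPf ni) mulr0.
case: (boolP (l s <= j)%N) => lj.
  rewrite (bigD1 j) //= (cfZ HA) (cf_bas HA _ _ (lj : (top s <= j)%N)) !eqxx mulr1.
  rewrite big1 ?addr0 // => e /andP[le ne].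
  by rewrite (cfZ HA) (cf_bas HA _ _ (le : (top s <= e)%N)) eqxx eq_sym (negPf ne) mulr0.
rewrite (pm_out HM) ?big1 // => [e le|]; last by rewrite /ivl (negPf lj).
rewrite (cfZ HA) (cf_bas HA _ _ (le : (top s <= e)%N)) eqxx /=.
by case: eqP => [je|]; [rewrite je le in lj | rewrite mulr0].
Qed.

Lemma gen_expand (u : S -> M) x : (forall s t i, co (u s) t i = ((t == s) && (i == top s))%:R) ->
  x = \sum_s ract (u s) (gen_coeff x s).
Proof.
move=> hu; apply: (pm_inj HM) => t i Di; rewrite (pm_sum HM) (bigD1 t) //=.
rewrite (pm_act HM) Di (bigD1 (top t)) //= hu !eqxx mul1r cf_gen_coeff eqxx.
rewrite !big1 ?addr0 // => [s ns|j nj]; last by rewrite cf_gen_coeff (negPf nj) mulr0.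
rewrite (pm_act HM) Di big1 // => j _; by rewrite hu eq_sym (negPf ns) mul0r.
Qed.

(* An interval module is presented by its top generators, subject to the
   vanishing of the paths leaving the interval. *)
Lemma hom_from_gen (N : lmodType A^c) (y : S -> N) (u : S -> M) :
  (forall s t i, co (u s) t i = ((t == s) && (i == top s))%:R) ->
  (forall s, ract (y s) (p (top s) (top s)) = y s) ->
  (forall s (j : 'I_n), j = r s :> nat -> ract (y s) (p (top s) j) = 0) ->
  exists f : {linear M -> N}, forall s, f (u s) = y s.
Proof.
move=> hu y1 y0.
have yz s (j : 'I_n) : (r s <= j)%N -> ract (y s) (p (top s) j) = 0.
  move=> rj; have rn : (r s < n)%N by apply: leq_ltn_trans (ltn_ord j).
  have le1 : (top s <= Ordinal rn)%N by have := lr s; rewrite /=; lia.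
  have -> : p (top s) j = p (top s) (Ordinal rn) * p (Ordinal rn) j.
    by rewrite (bas_mul HA) // (leq_trans le1 rj).
  by rewrite -ractM y0 // ract0l.
have [f fE] : exists f : {linear M -> N}, f =1 (fun x => \sum_s ract (y s) (gen_coeff x s)).
  apply: mk_linear => x z a; rewrite ract_suml -big_split; apply: eq_bigr => s _ /=.
  rewrite ractM -ractDr.
  have -> : gen_coeff (ract x a + z) s = gen_coeff x s * a + gen_coeff z s
     - \sum_(j : 'I_n | (r s <= j)%N) (ca (gen_coeff x s * a) (top s) j) *: p (top s) j.
    apply: (cf_inj HA) => i j; rewrite (cfB HA) (cfD HA) !cf_gen_coeff (cf_mul HA) (cf_sum HA).
    have [->|ni] := eqVneq i (top s); last first.
      rewrite !big1 ?if_same ?addr0 ?subr0 // => e he;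
        last by rewrite cf_gen_coeff (negPf ni) mul0r.
      rewrite (cfZ HA) (cf_bas HA) ?(negPf ni) ?mulr0 //.
      by have := lr s; rewrite /=; lia.
    rewrite (pm_add HM) (pm_act HM) addrAC; congr (_ + _).
    have -> : \sum_e ca (gen_coeff x s) (top s) e * ca a e j = \sum_e co x s e * ca a e j.
      by apply: eq_bigr => e _; rewrite cf_gen_coeff eqxx.
    have le_t (e : 'I_n) : (r s <= e)%N -> (top s <= e)%N by have := lr s; rewrite /=; lia.
    have E : \sum_(e : 'I_n | (r s <= e)%N) ca (ca (gen_coeff x s * a) (top s) e *: p (top s) e)
        (top s) j = if (r s <= j)%N then \sum_e co x s e * ca a e j else 0.
      case: ifPn => rj.
        have tj := le_t j rj.
        rewrite (bigD1 j) //= (cfZ HA) (cf_bas HA _ _ tj) !eqxx mulr1 (cf_mul HA) tj.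
        rewrite [X in _ + X]big1 => [|e /andP[re ne]].
          by rewrite addr0; apply: eq_bigr => e _; rewrite cf_gen_coeff eqxx.
        by rewrite (cfZ HA) (cf_bas HA _ _ (le_t e re)) eqxx eq_sym (negPf ne) mulr0.
      rewrite big1 // => e re; rewrite (cfZ HA) (cf_bas HA _ _ (le_t e re)) eqxx /=.
      by case: eqP => [je|]; [rewrite je re in rj | rewrite mulr0].
    rewrite E /ivl; case: (ltnP j (r s)) => jr; first by rewrite andbT subr0.
    by rewrite andbF (le_t j jr) subrr.
  rewrite ractBr ract_sumr [X in _ - X]big1 ?subr0 // => j rj.
  by rewrite ractZr yz // ract0l.
exists f => s; rewrite fE (bigD1 s) //= big1 ?addr0 => [|t nt]; last first.
  rewrite (_ : gen_coeff _ _ = 0) ?ract0r //; apply: (cf_inj HA) => i j.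
  by rewrite cf_gen_coeff hu eq_sym eq_sym (negPf nt) if_same (cf0 HA).
rewrite (_ : gen_coeff _ _ = p (top s) (top s)) ?y1 //; apply: (cf_inj HA) => i j.
by rewrite cf_gen_coeff hu (cf_bas HA) // eqxx; case: (i == top s).
Qed.

End Intervals.
End PointwiseModules.

Section IntervalModules.
Variables (k : fieldType) (n : nat) (A : algType k).
Variables (p : 'I_n -> 'I_n -> A) (ca : A -> 'I_n -> 'I_n -> k).
Hypothesis HA : inc_alg (fun i j : 'I_n => i <= j)%N p ca.
Local Notation coord_module := (coord_module ca).

Lemma ivl_convex (S : finType) (l r : S -> nat) : convex (ivl (n := n) l r).
Proof. by move=> s i j m; rewrite /ivl; lia. Qed.

Lemma hom_ivl (S S' : finType) (l r : S -> nat) (l' r' : S' -> nat) (M M' : lmodType A^c)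
    (co : M -> S -> 'I_n -> k) (co' : M' -> S' -> 'I_n -> k)
    (c : S' -> S -> k) : coord_module (ivl l r) co -> coord_module (ivl l' r') co' ->
  (forall s' s, c s' s != 0 -> (l' s' <= l s)%N && (r' s' <= r s)%N) ->
  exists f : {linear M -> M'}, forall x s' i,
    co' (f x) s' i = if ivl l' r' s' i then \sum_s c s' s * co x s i else 0.
Proof.
move=> HM HM' hc; apply: (coord_module_hom HA HM HM') => s' s i j /hc.
by rewrite /ivl; lia.
Qed.

Lemma projective_ivl (S : finType) (l : S -> nat) (M : lmodType A^c)
    (co : M -> S -> 'I_n -> k) :
  (forall s, l s < n)%N -> coord_module (ivl l (fun=> n)) co -> projective M.
Proof.
move=> ln HM X Y g gs h; have lr s : (l s < n <= n)%N by rewrite ln /=.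
have [u hu] := gen_ex lr HM.
have /choice[y yP] : forall s, exists y, g y = h (u s) by move=> s; exact: gs.
have [f fP] : exists f : {linear M -> X}, forall s, f (u s) = ract (y s) (p (top lr s) (top lr s)).
  apply: (hom_from_gen HA HM) => // s; first by rewrite ractM (bas_mul HA) // leqnn.
  by move=> j; have := ltn_ord j; lia.
exists f => x; rewrite {2}(gen_expand HA HM x hu) {1}(gen_expand HA HM x hu).
rewrite !linear_sum; apply: eq_bigr => s _; rewrite !ract_lin fP ract_lin yP.
by rewrite -{2}(gen_top HA HM s hu) ract_lin.
Qed.

Section OneModule.
Variables (S : finType) (l r : S -> nat) (M : lmodType A^c) (co : M -> S -> 'I_n -> k).
Hypothesis lr : forall s, (l s < r s <= n)%N.
Hypothesis HM : coord_module (ivl l r) co.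

Lemma fin_gen_ivl : fin_gen M.
Proof.
have [u hu] := gen_ex lr HM.
exists #|S|, (fun i => u (enum_val i)) => x.
exists (fun i => gen_coeff p co lr x (enum_val i)).
rewrite {1}(gen_expand HA HM x hu).
by rewrite (reindex _ (onW_bij _ (@enum_val_bij S))).
Qed.

Lemma pd_le1_ivl : pd_le1 M.
Proof.
pose S1 := {s : S | (r s < n)%N}.
have [P0 [c0 H0]] := coord_module_ex HA (@ivl_convex S l (fun=> n)).
have [P1 [c1 H1]] := coord_module_ex HA (@ivl_convex S1 (fun s => r (val s)) (fun=> n)).
have [f fP] : exists f : {linear P1 -> P0}, forall x s i,
    c0 (f x) s i = if ivl l (fun=> n) s i then \sum_s1 (s == val s1)%:R * c1 x s1 i else 0.
  apply: (hom_ivl H1 H0) => s s1; case: (s =P val s1) => [->|]; rewrite ?eqxx //.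
  by have := lr (val s1); lia.
have [g gP] : exists g : {linear P0 -> M}, forall x s i,
    co (g x) s i = if ivl l r s i then \sum_t (s == t)%:R * c0 x t i else 0.
  apply: (hom_ivl H0 HM) => s t; case: (s =P t) => [->|]; rewrite ?eqxx //.
  by have := lr t; lia.
have sum1 (T : finType) (t : T) (F : T -> k) : \sum_s (t == s)%:R * F s = F t.
  rewrite (bigD1 t) //= eqxx mul1r big1 ?addr0 // => s /negPf.
  by rewrite eq_sym => ->; rewrite mul0r.
have fP1 x (s1 : S1) i : ivl (fun s => r (val s)) (fun=> n) s1 i -> c0 (f x) (val s1) i = c1 x s1 i.
  move=> Di; rewrite fP ifT; last first.
    case/andP: Di => d1 d2; have /andP[/ltnW h _] := lr (val s1).
    by rewrite /ivl d2 andbT; exact: leq_trans h d1.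
  by rewrite -(sum1 _ s1 (fun s => c1 x s i)); apply: eq_bigr => s _; rewrite (inj_eq val_inj).
have fP0 x s (i : 'I_n) : (i < r s)%N -> c0 (f x) s i = 0.
  move=> ir; rewrite fP; case: ifP => // _; rewrite big1 // => s1 _.
  case: eqP => [e|]; last by rewrite mul0r.
  by rewrite (pm_out H1) ?mulr0 // /ivl -e; lia.
exists P1, P0, f, g; split; [apply: (projective_ivl _ H1)|apply: (projective_ivl _ H0)|split].
- by move=> s; exact: (valP s).
- by move=> s; have := lr s; lia.
- move=> x y e; apply: (pm_inj H1) => s1 i Di.
  by rewrite -!fP1 // e.
- move=> y; have [x hx] := pm_make H0 (co y); exists x.
  apply: (pm_inj HM) => s i Di; rewrite gP Di sum1 hx ifT //.
  by move: Di; rewrite /ivl; have := lr s; lia.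
move=> y; split=> [gy|[x <-]].
  have [x hx] := pm_make H1 (fun s1 i => c0 y (val s1) i); exists x.
  apply: (pm_inj H0) => s i Di; case: (ltnP i (r s)) => ri.
    rewrite fP0 //; have := congr1 (fun z => co z s i) gy.
    rewrite (pm0 HM) gP sum1 ifT //; by move: Di; rewrite /ivl; lia.
  have rn : (r s < n)%N by have := ltn_ord i; lia.
  rewrite -[s]/(val (exist (fun s => (r s < n)%N) s rn : S1)) fP1 ?hx ?ifT //=;
    rewrite /ivl /= ltn_ord andbT //.
apply: (pm_inj HM) => s i Di; rewrite gP Di sum1 (pm0 HM) fP0 //.
by move: Di; rewrite /ivl; lia.
Qed.

Lemma Ext1_zero_ivl (N : lmodType A^c) :
  (forall s (j : 'I_n), j = r s :> nat -> forall w : N,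
     exists z : N, ract z (p (top lr s) j) = ract w (p j j)) ->
  Ext1_zero M N.
Proof.
move=> hN E f g [finj gs ex].
have [u hu] := gen_ex lr HM.
have tt s : p (top lr s) (top lr s) * p (top lr s) (top lr s) = p (top lr s) (top lr s).
  by rewrite (bas_mul HA) // leqnn.
have /choice[y yP] : forall s, exists y, [/\ g y = u s, ract y (p (top lr s) (top lr s)) = y
    & forall j : 'I_n, j = r s :> nat -> ract y (p (top lr s) j) = 0].
  move=> s; have [e0 he0] := gs (u s); pose e1 := ract e0 (p (top lr s) (top lr s)).
  have ge1 : g e1 = u s by rewrite ract_lin he0 (gen_top HA HM s hu).
  have e1t : ract e1 (p (top lr s) (top lr s)) = e1 by rewrite ractM tt.
  case: (ltnP (r s) n) => rn; last first.
    by exists e1; split=> // j; have := ltn_ord j; lia.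
  pose j := Ordinal rn; have tj : (top lr s <= j)%N by rewrite /=; have := lr s; lia.
  have [w hw] : exists w, f w = ract e1 (p (top lr s) j).
    by apply/ex; rewrite ract_lin ge1 (gen_end HA HM hu).
  have [z hz] := hN s j erefl w.
  have wj : ract w (p j j) = w.
    by apply: finj; rewrite ract_lin hw ractM (bas_mul HA) // tj.
  have gf x : g (f x) = 0 by apply/ex; exists x.
  exists (e1 - f (ract z (p (top lr s) (top lr s)))); split.
  - by rewrite linearB ge1 gf subr0.
  - by rewrite ractBl e1t -ract_lin ractM tt.
  move=> j' ej'; have -> : j' = j by apply: val_inj.
  by rewrite ractBl -hw -ract_lin ractM (bas_mul HA) ?leqnn // tj hz wj subrr.
have [s sP] : exists s : {linear M -> E}, forall i, s (u i) = y i.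
  by apply: (hom_from_gen HA HM) => // i; have [] := yP i.
exists s => x; rewrite {2}(gen_expand HA HM x hu) {1}(gen_expand HA HM x hu).
rewrite !linear_sum; apply: eq_bigr => i _; rewrite !ract_lin sP.
by have [-> _ _] := yP i.
Qed.

End OneModule.

Lemma Ext1_zero_self (S : finType) (l r : S -> nat) (M : lmodType A^c)
    (co : M -> S -> 'I_n -> k) :
  (forall s, l s < r s <= n)%N -> coord_module (ivl l r) co ->
  (forall s t, l s < l t -> l t <= r s -> r s < r t -> False)%N -> Ext1_zero M M.
Proof.
move=> lr HM nc; apply: (Ext1_zero_ivl (lr := lr) HM) => s j jr w.
have [z hz] := pm_make HM (fun t i => if i == top lr s then co w t j else 0).
have tj : (top lr s <= j)%N by rewrite /= jr; have := lr s; lia.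
exists z; apply: (pm_inj HM) => t i Di; rewrite !(pm_basis HA HM) // Di /=.
case: eqP => // ij; rewrite hz eqxx ifT //.
move: Di; rewrite /ivl ij jr /= => Di.
by have := lr s; have [h|h] := leqP (l t) (l s); [lia | case: (nc s t); lia].
Qed.

Lemma in_add_ivl (S S' : finType) (l r : S -> nat) (l' r' : S' -> nat) (M M' : lmodType A^c)
    (co : M -> S -> 'I_n -> k) (co' : M' -> S' -> 'I_n -> k) :
  coord_module (ivl l r) co -> coord_module (ivl l' r') co' ->
  (forall s', (r' s' <= l' s')%N \/ exists s, l s = l' s' /\ r s = r' s') ->
  in_add M M'.
Proof.
move=> HM HM' hs.
have /choice[ph phP] : forall s' : S', exists s : option S,
    if s is Some s then l s = l' s' /\ r s = r' s' else (r' s' <= l' s')%N.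
  by move=> s'; case: (hs s') => [h|[s h]]; [exists None | exists (Some s)].
have HF := coord_module_ffun #|S'| HM.
pose c (s' : S') (q : 'I_#|S'| * S) : k := ((q.1 == enum_rank s') && (Some q.2 == ph s'))%:R.
have [i iP] : exists i : {linear M' -> {ffun 'I_#|S'| -> M}}, forall x q j,
   co (i x q.1) q.2 j = if ivl l r q.2 j then \sum_s' c s' q * co' x s' j else 0.
  apply: (coord_module_hom HA HM' HF) => q s' a b; rewrite /c.
  case: (_ =P enum_rank s') => /= [_|]; last by rewrite eqxx.
  case: (_ =P ph s') => [e|]; last by rewrite eqxx.
  by move=> _; have := phP s'; rewrite -e /ivl => -[-> ->]; clear; lia.
have [f fP] : exists f : {linear {ffun 'I_#|S'| -> M} -> M'}, forall x s' j,
   co' (f x) s' j = if ivl l' r' s' j then \sum_q c s' q * co (x q.1) q.2 j else 0.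
  apply: (coord_module_hom HA HF HM') => s' q a b; rewrite /c.
  case: (_ =P enum_rank s') => /= [_|]; last by rewrite eqxx.
  case: (_ =P ph s') => [e|]; last by rewrite eqxx.
  by move=> _; have := phP s'; rewrite -e /ivl => -[-> ->]; clear; lia.
exists #|S'|, i, f => x; apply: (pm_inj HM') => s' j Dj; rewrite fP Dj.
have := phP s'; case e : (ph s') => [s|]; last by move: Dj; rewrite /ivl; lia.
move=> [ls rs]; rewrite (bigD1 (enum_rank s', s)) //= big1 ?addr0 => [|q nq].
  rewrite /c /= e !eqxx mul1r -[enum_rank s']/(enum_rank s', s).1 -[X in co _ X]/(enum_rank s', s).2 iP.
  rewrite /= {1}/ivl ls rs -/(ivl l' r' s' j) Dj (bigD1 s') //= /c /= e !eqxx mul1r.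
  rewrite big1 ?addr0 // => t /negPf nt; rewrite (inj_eq enum_rank_inj) eq_sym nt mul0r //.
rewrite /c e; case: eqP => [e1|]; last by rewrite mul0r.
case: eqP => [[e2]|]; last by rewrite mul0r.
by move: nq; rewrite -e1 -e2 -surjective_pairing eqxx.
Qed.

End IntervalModules.

(** * From triangulations to tilting modules *)

Lemma chain_ex (n : nat) (V : Type) (L H : V -> nat) : (0 < n)%N -> tri_family n L H ->
  exists Lc Rc : nat -> nat -> nat, forall i, (i <= n)%N ->
    [/\ Lc i 0 = i /\ Rc i 0 = i, Lc i n = 0 /\ Rc i n = n
      & forall j, [/\ (Lc i j.+1 <= Lc i j)%N, (Rc i j <= Rc i j.+1)%N,
          exists v, L v = Lc i j.+1 /\ H v = Rc i j.+1
        & seg n L H (Lc i j.+1) (Rc i j)]]%N.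
Proof.
move=> n0 F; pose K q := seg n L H q.1 q.2.
have /choice[nx nxP] : forall q : nat * nat, exists q', K q ->
    [/\ K q', (q'.1 <= q.1)%N && (q.2 <= q'.2)%N, (q'.1 < q'.2)%N, seg n L H q'.1 q.2
     & q = (0, n) \/ (q.2 - q.1 < q'.2 - q'.1)%N].
  move=> q; have [Kq|nK] := pselect (K q); last by exists q.
  have [eq|nq] := pselect (q = (0, n)).
    exists q => _; split=> //; [by rewrite !leqnn|by rewrite eq|by left].
  have rq := seg_range F Kq; rewrite [q]surjective_pairing in nq.
  case: (seg_parent F Kq nq) => [[h' lt [K1 K2]]|[l' lt [K1 K2]]].
    by exists (q.1, h') => _; split=> //=; [lia|lia|right; lia].
  by exists (l', q.2) => _; split=> //=; [lia|lia|right; lia].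
exists (fun i j => (iter j nx (i, i)).1), (fun i j => (iter j nx (i, i)).2) => i hi.
have Kit j : K (iter j nx (i, i)).
  by elim: j => [|j /nxP[]] //; left.
have size j : iter j nx (i, i) = (0, n) \/ (j <= (iter j nx (i, i)).2 - (iter j nx (i, i)).1)%N.
  elim: j => [|j IH]; first by right.
  have [Ki /andP[r1 r2] lt _ st] := nxP _ (Kit j).
  have rg := seg_range F Ki.
  case: IH => [e|le].
    left; rewrite iterS; move: r1 r2 rg; rewrite e [nx _]surjective_pairing /=.
    by move=> ? ? ?; congr pair; lia.
  case: st => [e|st]; last by right; rewrite iterS; lia.
  left; rewrite iterS; move: r1 r2 rg; rewrite e [nx _]surjective_pairing /=.
  by move=> ? ? ?; congr pair; lia.
split=> // [|j].
  have rg := seg_range F (Kit n).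
  by case: (size n) => [-> //|]; lia.
have [Ki /andP[r1 r2] lt K2 _] := nxP _ (Kit j); rewrite iterS; split=> //.
exact: seg_curve Ki lt.
Qed.

Section Tilting.
Variables (k : fieldType) (n : nat) (A : algType k).
Variables (p : 'I_n -> 'I_n -> A) (ca : A -> 'I_n -> 'I_n -> k).
Hypothesis HA : inc_alg (fun i j : 'I_n => i <= j)%N p ca.
Hypothesis n0 : (0 < n)%N.
Variables (V : finType) (L H : V -> nat) (M : lmodType A^c) (co : M -> V -> 'I_n -> k).
Hypothesis F : tri_family n L H.
Hypothesis HM : coord_module ca (ivl L H) co.

(* The projective [i, n) is resolved along the chain of nested intervals
   [Lc i j, Rc i j), j <= n, that starts with the empty interval at i and ends
   with [0, n): it is the kernel of the difference map from the sum of the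
   [Lc i j.+1, Rc i j.+1) to the sum of the overlaps [Lc i j.+1, Rc i j). *)
Lemma coresolution : exists (T' T'' : lmodType A^c) (f : {linear (A^c)^o -> T'})
    (g : {linear T' -> T''}), [/\ in_add M T', in_add M T'' & short_exact f g].
Proof.
have [Lc [Rc ch]] := chain_ex n0 F.
pose S := ('I_n * 'I_n)%type.
pose l (q : S) := Lc q.1 q.2.+1; pose r (q : S) := Rc q.1 q.2.+1; pose r2 (q : S) := Rc q.1 q.2.
have chi (i : 'I_n) := ch i (ltnW (ltn_ord i)).
have stepL (i : 'I_n) j : (Lc i j.+1 <= Lc i j)%N by have [_ _ /(_ j)[]] := chi i.
have stepR (i : 'I_n) j : (Rc i j <= Rc i j.+1)%N by have [_ _ /(_ j)[]] := chi i.
have monoL (i : 'I_n) a b : (a <= b)%N -> (Lc i b <= Lc i a)%N.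
  by elim: b => [|b IH]; [case: a | rewrite leq_eqVlt => /orP[/eqP -> //|/IH];
    have := stepL i b; lia].
have monoR (i : 'I_n) a b : (a <= b)%N -> (Rc i a <= Rc i b)%N.
  by elim: b => [|b IH]; [case: a | rewrite leq_eqVlt => /orP[/eqP -> //|/IH];
    have := stepR i b; lia].
have Li (i : 'I_n) j : (Lc i j <= i)%N.
  by have [[e _] _ _] := chi i; have := monoL i 0 j (leq0n j); rewrite e.
have Ri (i : 'I_n) j : (i <= Rc i j)%N.
  by have [[_ e] _ _] := chi i; have := monoR i 0 j (leq0n j); rewrite e.
have [T' [c1 H1]] := coord_module_ex HA (@ivl_convex n S l r).
have [T'' [c2 H2]] := coord_module_ex HA (@ivl_convex n S l r2).
have lastn : (n.-1 < n)%N by rewrite prednK.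
pose last : 'I_n := Ordinal lastn.
have DlastE i (v : 'I_n) : ivl l r (i, last) v.
  have [_ [e1 e2] _] := chi i.
  by rewrite /ivl /l /r /= prednK // e1 e2 leq0n ltn_ord.
have [f fP] : exists f : {linear (A^c)^o -> T'}, forall x q v,
    c1 (f x) q v = if ivl l r q v then \sum_s (s == q.1)%:R * ca x s v else 0.
  apply: (coord_module_hom HA (coord_module_regular HA) H1) => -[a b] s i j /=.
  case: (s =P a) => [->|]; last by rewrite eqxx.
  move=> _ ij ai /andP[h1 h2]; rewrite (leq_trans ai ij) /ivl /l /r /= in h1 h2 *.
  by rewrite (leq_trans (Li a _) ai) (leq_ltn_trans ij h2).
have {}fP x q v : c1 (f x) q v = if ivl l r q v then ca x q.1 v else 0.
  rewrite fP; case: ifP => // _; rewrite (bigD1 q.1) //= eqxx mul1r big1 ?addr0 //.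
  by move=> s /negPf ->; rewrite mul0r.
pose nxt (q q' : S) := (q.1 == q'.1) && (q.2 == q'.2.+1 :> nat).
pose prev x (q : S) (v : 'I_n) := \sum_(q' | nxt q q') c1 x q' v.
have prevS x (i j j' : 'I_n) v : j = j'.+1 :> nat -> prev x (i, j) v = c1 x (i, j') v.
  move=> e; rewrite /prev (bigD1 (i, j')) /nxt /= ?e ?eqxx // big1 ?addr0 //.
  move=> [a b] /= /andP[/andP[/eqP <-]]; rewrite eqSS => /eqP/val_inj <-.
  by rewrite eqxx.
have prev0 x (i j : 'I_n) v : j = 0%N :> nat -> prev x (i, j) v = 0.
  by move=> e; rewrite /prev big1 // => q; rewrite /nxt /= e andbF.
have [g gP] : exists g : {linear T' -> T''}, forall x q v, c2 (g x) q v =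
    if ivl l r2 q v then \sum_q' ((q == q')%:R - (nxt q q')%:R) * c1 x q' v else 0.
  apply: (hom_ivl HA H1 H2) => q q'; case: (q =P q') => [<-|_].
    by move=> _; rewrite leqnn stepR.
  case: (boolP (nxt q q')) => [/andP[/eqP e1 /eqP e2]|]; last by rewrite subrr eqxx.
  by move=> _; rewrite /l /r2 /r e1 e2 stepL leqnn.
have {}gP x q v : c2 (g x) q v = if ivl l r2 q v then c1 x q v - prev x q v else 0.
  rewrite gP; case: ifP => // _; under eq_bigr do rewrite mulrBl.
  rewrite sumrB (bigD1 q) //= eqxx mul1r big1 ?addr0; last first.
    by move=> q' /negPf; rewrite eq_sym => ->; rewrite mul0r.
  congr (_ - _); rewrite /prev [RHS]big_mkcond; apply: eq_bigr => q' _.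
  by case: ifP; rewrite ?mul1r ?mul0r.
have D12 q (v : 'I_n) : ivl l r2 q v -> ivl l r q v.
  by rewrite /ivl /r /r2 => /andP[-> h]; apply: leq_trans h (stepR _ _).
exists T', T'', f, g; split.
- apply: (in_add_ivl HA HM H1) => -[i j]; right.
  by have [_ _ /(_ j)[_ _ ? _]] := chi i.
- apply: (in_add_ivl HA HM H2) => -[i j].
  have [_ _ /(_ j)[_ _ _]] := chi i.
  by case=> [[e _]|]; [left; rewrite /l /r2 /= e | right].
split.
- move=> x y e; apply: (cf_inj HA) => i v.
  by have := congr1 (fun z => c1 z (i, last) v) e; rewrite !fP !DlastE.
- move=> y; have [x hx] := pm_make H1 (fun q v => \sum_(j : 'I_n | (j <= q.2)%N) c2 y (q.1, j) v).
  exists x; apply: (pm_inj H2) => -[i j] v Dv; rewrite gP Dv hx (D12 _ _ Dv) /=.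
  have [j0|jpos] := posnP j.
    rewrite prev0 // subr0 (bigD1 j) //= big1 ?addr0 // => j' /andP[le ne].
    by case/eqP: ne; apply: val_inj; rewrite /= j0 in le *; apply/eqP; rewrite -leqn0.
  have hj' : (j.-1 < n)%N by rewrite (leq_ltn_trans (leq_pred _) (ltn_ord j)).
  pose j' : 'I_n := Ordinal hj'; have ej : j = j'.+1 :> nat by rewrite /= prednK.
  rewrite (prevS _ _ _ j') // hx.
  have -> : (if ivl l r (i, j') v then \sum_(m : 'I_n | (m <= (i, j').2)%N) c2 y (i, m) v else 0)
      = \sum_(m : 'I_n | (m <= j')%N) c2 y (i, m) v.
    case: ifPn => // nD; rewrite big1 // => m mj; apply: (pm_out H2).
    apply: contra nD; rewrite /ivl /l /r /r2 => /andP[h1 h2]; apply/andP; split.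
      by apply: leq_trans h1; apply: monoL.
    by move: Dv; rewrite /ivl /r2 /= ej => /andP[].
  rewrite (bigD1 j) //= -addrA [X in _ + X](_ : _ = 0) ?addr0 //.
  apply/eqP; rewrite subr_eq0; apply/eqP; apply: eq_bigl => m.
  by rewrite [in LHS]ej -(inj_eq val_inj) /= ej; move: (nat_of_ord m) (nat_of_ord j'); clear; lia.
move=> y; split=> [gy|[x <-]]; last first.
  apply: (pm_inj H2) => -[i j] v Dv; rewrite gP Dv (pm0 H2) fP (D12 _ _ Dv) /=.
  have [[e1 e2] _ _] := chi i.
  have [j0|jpos] := posnP j.
    rewrite prev0 // subr0 (cf_out HA) //; move: Dv; rewrite /ivl /r2 /= j0 e2.
    by case/andP=> _; rewrite -ltnNge.
  have hj' : (j.-1 < n)%N by rewrite (leq_ltn_trans (leq_pred _) (ltn_ord j)).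
  pose j' : 'I_n := Ordinal hj'; have ej : j = j'.+1 :> nat by rewrite /= prednK.
  rewrite (prevS _ _ _ j') // fP; case: ifPn => [|nD] /=; first by rewrite subrr.
  rewrite subr0 (cf_out HA) //; apply: contra nD => iv.
  rewrite /ivl /l /r /= (leq_trans (Li i _) iv) /=.
  by move: Dv; rewrite /ivl /r2 /= ej => /andP[].
have rec (i j v : 'I_n) : ivl l r2 (i, j) v -> c1 y (i, j) v = prev y (i, j) v.
  move=> Dv; have := congr1 (fun z => c2 z (i, j) v) gy.
  by rewrite gP Dv (pm0 H2) => /eqP; rewrite subr_eq0 => /eqP.
have [x hx] := pm_make (coord_module_regular HA) (fun i v => c1 y (i, last) v).
exists x; apply: (pm_inj H1) => -[i j] v Dv; rewrite fP Dv /= hx.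
case: (leqP i v) => iv.
  have [m] := ubnP (n - j); elim: m j Dv => // m IH j Dv hm.
  have [e|nl] := eqVneq j last; first by rewrite e.
  have hj : (j.+1 < n)%N.
    have := ltn_ord j; rewrite leq_eqVlt => /orP[/eqP e|//].
    by case/eqP: nl; apply: val_inj; rewrite /= -[in RHS]e.
  pose j2 : 'I_n := Ordinal hj.
  have D2 : ivl l r2 (i, j2) v.
    by move: Dv; rewrite /ivl /l /r /r2 /= => /andP[_ ->]; rewrite (leq_trans (Li i _) iv).
  rewrite (IH j2 (D12 _ _ D2)); last by rewrite /=; have h := hj; move: hm h; clear; lia.
  by rewrite (rec _ _ _ D2) (prevS _ _ _ j).
have [m] := ubnP (nat_of_ord j); elim: m j Dv => // m IH j Dv hm; apply/esym.
have D2 : ivl l r2 (i, j) v.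
  by move: Dv; rewrite /ivl => /andP[-> _]; exact: leq_trans iv (Ri i _).
rewrite (rec _ _ _ D2); have [j0|jpos] := posnP j; first by rewrite prev0.
have hj' : (j.-1 < n)%N by rewrite (leq_ltn_trans (leq_pred _) (ltn_ord j)).
pose j' : 'I_n := Ordinal hj'; have ej : j = j'.+1 :> nat by rewrite /= prednK.
rewrite (prevS _ _ _ j') //; have [Dj'|nD] := boolP (ivl l r (i, j') v); last exact: (pm_out H1).
by rewrite -(IH j' Dj') //=; have h := jpos; move: hm h; clear; lia.
Qed.

Lemma tilting_ivl : tilting M.
Proof.
have lr := tf_range F; split.
- refine (fin_gen_ivl HA lr HM).
- refine (pd_le1_ivl HA lr HM).
- refine (Ext1_zero_self HA lr HM (tf_nocross F)).
- exact: coresolution.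
Qed.

End Tilting.

(** * Endomorphism algebras of interval modules *)

Section Endo.
Variables (k : fieldType) (n : nat) (A : algType k).
Variables (p : 'I_n -> 'I_n -> A) (ca : A -> 'I_n -> 'I_n -> k).
Hypothesis HA : inc_alg (fun i j : 'I_n => i <= j)%N p ca.
Variables (V : finType) (L H : V -> nat) (M : lmodType A^c) (co : M -> V -> 'I_n -> k).
Hypothesis lr : forall v, (L v < H v <= n)%N.
Hypothesis HM : coord_module ca (ivl L H) co.
Variable u : V -> M.
Hypothesis hu : forall s t i, co (u s) t i = ((t == s) && (i == top lr s))%:R.
Local Notation R := (hom_rel L H).

Definition cfE (f : {linear M -> M}) c d : k := co (f (u d)) c (top lr d).

Lemma end_supp (f : {linear M -> M}) c d i : i != top lr d -> co (f (u d)) c i = 0.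
Proof.
move=> ni; rewrite -(gen_top HA HM d hu) ract_lin (pm_basis HA HM) //.
by rewrite (negPf ni) andbF.
Qed.

Lemma cfE_out (f : {linear M -> M}) c d : ~~ R c d -> cfE f c d = 0.
Proof.
rewrite /hom_rel => nR; rewrite /cfE.
have [D|nD] := boolP (ivl L H c (top lr d)); last exact: (pm_out HM).
have hd : (H d < n)%N by move: nR D; rewrite /ivl /=; have := lr c; lia.
pose j := Ordinal hd.
have tj : (top lr d <= j)%N by rewrite /=; have := lr d; lia.
have Dj : ivl L H c j by move: nR D; rewrite /ivl /=; have := lr d; lia.
have := gen_end HA HM hu (erefl : j = H d :> nat).
move/(congr1 (fun x => co (f x) c j)); rewrite ract_lin (pm_basis HA HM) // Dj eqxx.
by rewrite linear0 (pm0 HM).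
Qed.

Lemma end_gen (f : {linear M -> M}) d :
  f (u d) = \sum_e ract (ract (u e) (p (top lr e) (top lr d))) ((cfE f e d)%:A).
Proof.
apply: (pm_inj HM) => c i Di; rewrite (pm_sum HM).
have T e : co (ract (ract (u e) (p (top lr e) (top lr d))) ((cfE f e d)%:A)) c i =
    (e == c)%:R * co (f (u d)) c i.
  rewrite (pm_scale HA HM); have [Red|nR] := boolP (R e d); last first.
    rewrite cfE_out // mul0r; case: eqP => [ec|]; last by rewrite mul0r.
    have [->|ni] := eqVneq i (top lr d); first by rewrite -ec -/(cfE f e d) cfE_out ?mulr0.
    by rewrite end_supp ?mulr0.
  have ted : (top lr e <= top lr d)%N by case/and3P: Red.
  rewrite (pm_basis HA HM) // Di /= hu eqxx andbT [c == e]eq_sym.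
  case: (e =P c) => [->|]; last by rewrite if_same mulr0 mul0r.
  have [->|ni] := eqVneq i (top lr d); first by rewrite mulr1 mul1r.
  by rewrite mulr0 end_supp ?mulr0.
rewrite (eq_bigr _ (fun e _ => T e)) (bigD1 c) //= eqxx mul1r big1 ?addr0 //.
by move=> e /negPf ->; rewrite mul0r.
Qed.

Lemma cfE_comp (f g h : {linear M -> M}) c d : (forall x, h x = f (g x)) ->
  cfE h c d = if R c d then \sum_e cfE f c e * cfE g e d else 0.
Proof.
move=> hE; case: ifPn => Rcd; last exact: cfE_out.
rewrite [LHS]/cfE hE (end_gen g) linear_sum (pm_sum HM); apply: eq_bigr => e _.
have [Red|nR] := boolP (R e d); last first.
  by rewrite [cfE g e d]cfE_out // scale0r ract0r linear0 (pm0 HM) mulr0.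
have ted : (top lr e <= top lr d)%N by case/and3P: Red.
rewrite ract_lin (pm_scale HA HM) ract_lin (pm_basis HA HM) // eqxx andbT mulrC.
by rewrite /ivl /=; case/and3P: Rcd => -> ->.
Qed.

Lemma cfE_inj (f g : {linear M -> M}) : (forall c d, cfE f c d = cfE g c d) -> f =1 g.
Proof.
move=> h x; rewrite (gen_expand HA HM x hu) !linear_sum; apply: eq_bigr => d _.
rewrite !ract_lin; congr ract; rewrite !end_gen; apply: eq_bigr => e _.
by rewrite h.
Qed.

Lemma cfE_id (f : {linear M -> M}) c d : f =1 id -> cfE f c d = (c == d)%:R.
Proof. by move=> fE; rewrite /cfE fE hu eqxx andbT. Qed.

Lemma cfE_basis c d : exists f : {linear M -> M}, R c d ->
  forall c' d', cfE f c' d' = ((c' == c) && (d' == d))%:R.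
Proof.
have [f fP] : exists f : {linear M -> M}, forall x s' i, co (f x) s' i =
   if ivl L H s' i then \sum_s [&& s' == c, s == d & R c d]%:R * co x s i else 0.
  apply: (hom_ivl HA HM HM) => s' s; case: and3P => [[/eqP -> /eqP ->]|]; last by rewrite eqxx.
  by rewrite /hom_rel => /and3P[-> _ ->].
exists f => Rcd c' d'; rewrite /cfE fP.
have -> : \sum_s [&& c' == c, s == d & R c d]%:R * co (u d') s (top lr d') =
    ((c' == c) && (d' == d))%:R.
  rewrite (bigD1 d') //= hu !eqxx Rcd andbT mulr1 big1 ?addr0 // => s ns.
  by rewrite hu (negPf ns) mulr0.
case: ifPn => // nD; case: eqP => //= ec; case: eqP => //= ed.
by case/negP: nD; rewrite ec ed /ivl /=; case/and3P: Rcd => -> ->.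
Qed.

Local Notation E := (End_alg M).

Lemma cfED (f g : E) c d : cfE (f + g : E) c d = cfE f c d + cfE g c d.
Proof. exact: (pm_add HM). Qed.

Lemma cfEZ a (f : E) c d : cfE (a *: f : E) c d = a * cfE f c d.
Proof. exact: (pm_scale HA HM). Qed.

Lemma cfEM (f g : E) c d :
  cfE (f * g : E) c d = if R c d then \sum_e cfE f c e * cfE g e d else 0.
Proof. exact: cfE_comp. Qed.

Lemma cfE1 c d : cfE (1 : E) c d = (c == d)%:R.
Proof. exact: cfE_id. Qed.

Lemma cfEI (f g : E) : (forall c d, cfE f c d = cfE g c d) -> f = g.
Proof. by move=> h; apply: endP; exact: cfE_inj. Qed.

Lemma inc_of_end (B : algType k) (f : {lrmorphism B -> E}) : bijective f ->
  exists bas cf, @inc_alg k B V R bas cf.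
Proof.
case=> g fg gf; have /choice[b0 hb] := fun cd : V * V => cfE_basis cd.1 cd.2.
exists (fun c d => g (b0 (c, d))), (fun x c d => cfE (f x) c d); split.
- by move=> a x y c d; rewrite linearP cfED; congr (_ + _); exact: cfEZ.
- by move=> x y c d; rewrite rmorphM cfEM.
- by move=> c d; rewrite rmorph1 cfE1.
- by move=> x c d; exact: cfE_out.
- by move=> c d c' d' Rcd; rewrite gf (hb (c, d)).
by move=> x y h; apply: (can_inj fg); apply: cfEI.
Qed.

Lemma end_of_inc (B : algType k) (bas : V -> V -> B) cf : inc_alg R bas cf ->
  exists f : {lrmorphism B -> E}, bijective f.
Proof.
move=> incB; have /choice[b0 hb] := fun cd : V * V => cfE_basis cd.1 cd.2.
pose f (x : B) : E := \sum_c \sum_(d | R c d) cf x c d *: (b0 (c, d) : E).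
have cfE0 c d : cfE (0 : E) c d = 0.
  by have := cfEZ 0 (0 : E) c d; rewrite scale0r mul0r.
have cfEsum (I : Type) (r : seq I) (P : pred I) (F : I -> E) c d :
    cfE (\sum_(i <- r | P i) F i) c d = \sum_(i <- r | P i) cfE (F i) c d.
  by apply: (big_morph (fun x : E => cfE x c d)) => [x y|]; [exact: cfED|exact: cfE0].
have fE x c d : cfE (f x) c d = cf x c d.
  rewrite /f cfEsum [in RHS](cf_expand incB x) (cf_sum incB); apply: eq_bigr => e _.
  rewrite cfEsum (cf_sum incB); apply: eq_bigr => e' Re.
  by rewrite cfEZ (cfZ incB) (hb (e, e')) // (cf_bas incB).
pose g (y : E) : B := \sum_c \sum_(d | R c d) cfE y c d *: bas c d.
have gE y c d : cf (g y) c d = cfE y c d.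
  by rewrite (inc_comb incB); case: ifPn => // nR; rewrite cfE_out.
have fB : zmod_morphism f.
  move=> x y; apply: cfEI => c d; by rewrite -[- f y]scaleN1r cfED cfEZ !fE (cfB incB) mulN1r.
have fM : monoid_morphism f.
  split=> [|x y]; apply: cfEI => c d; rewrite fE; first by rewrite cfE1 (cf_one incB).
  by rewrite cfEM (cf_mul incB); case: ifP => // _; apply: eq_bigr => e _; rewrite !fE.
have fZ : scalable f.
  by move=> a x; apply: cfEI => c d; rewrite cfEZ !fE (cfZ incB).
pose m1 := GRing.isZmodMorphism.Build B E f fB.
pose m2 := GRing.isMonoidMorphism.Build B E f fM.
pose m3 := GRing.isScalable.Build k B E *:%R f fZ.
pose F : {lrmorphism B -> E} := HB.pack f m1 m2 m3.
exists F; exists g => [x|y].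
  by apply: (cf_inj incB) => c d; rewrite gE fE.
by apply: cfEI => c d; rewrite fE gE.
Qed.

End Endo.

Section Basic.
Variables (k : fieldType) (n : nat) (A : algType k).
Variables (p : 'I_n -> 'I_n -> A) (ca : A -> 'I_n -> 'I_n -> k).
Hypothesis HA : inc_alg (fun i j : 'I_n => i <= j)%N p ca.

Lemma indecomposable_ivl (l r : nat) (X : lmodType A^c) (co : X -> unit -> 'I_n -> k) :
  (l < r <= n)%N -> coord_module ca (ivl (fun=> l) (fun=> r)) co -> indecomposable X.
Proof.
move=> lr HX; have lr' (s : unit) : (l < r <= n)%N by [].
have [u hu] := gen_ex lr' HX; set t := top lr' tt.
have u1 : co (u tt) tt t = 1 by rewrite hu !eqxx.
split.
  by exists (u tt) => u0; move/eqP: u1; rewrite u0 (pm0 HX) eq_sym oner_eq0.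
have span x : ract x (p t t) = x -> x = ract (u tt) ((co x tt t)%:A).
  move=> xt; apply: (pm_inj HX) => -[] i Di; rewrite (pm_scale HA HX) hu eqxx /=.
  by rewrite -[in LHS]xt (pm_basis HA HX) // Di /= -/t; case: (i =P t) => _; rewrite ?mulr1 ?mulr0.
have gens x : exists a, x = ract (u tt) a.
  exists (gen_coeff p co lr' x tt); rewrite {1}(gen_expand HA HX x hu) /index_enum.
  by rewrite (bigD1 tt) //= big1 ?addr0 // => -[].
move=> Y Z [f [g fg gf]].
have ut := gen_top HA HX tt hu.
have fu : f (u tt) = ((f (u tt)).1, (f (u tt)).2) by rewrite -surjective_pairing.
pose x := g ((f (u tt)).1, 0).
have pr1 (y : (Y * Z)%type) a : (ract y a).1 = ract y.1 a by [].
have pr2 (y : (Y * Z)%type) a : (ract y a).2 = ract y.2 a by [].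
have xt : ract x (p t t) = x.
  apply: (can_inj fg); rewrite ract_lin gf.
  rewrite [LHS]surjective_pairing pr1 pr2 /= ract0l -pr1 -ract_lin ut //.
have xs := span _ xt; set c := co x tt t in xs.
have e2 : ract (f (u tt)).2 (c%:A) = 0.
  by rewrite -pr2 -ract_lin -xs gf.
have e1 : ract (f (u tt)).1 (c%:A) = (f (u tt)).1.
  by rewrite -pr1 -ract_lin -xs gf.
have [c0|nc] := eqVneq c 0.
  left=> y; have [a ha] := gens (g (y, 0)).
  have : y = (f (g (y, 0))).1 by rewrite gf.
  by move=> ->; rewrite ha ract_lin pr1 -e1 c0 scale0r ract0r ract0l.
right=> z; have [a ha] := gens (g (0, z)).
have z0 : (f (u tt)).2 = 0.
  rewrite -[LHS]ract1 -(_ : (c%:A : A) * (c^-1)%:A = 1) -?ractM ?e2 ?ract0l //.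
  by rewrite -scalerAl mul1r scalerA divff // scale1r.
have : z = (f (g (0, z))).2 by rewrite gf.
by move=> ->; rewrite ha ract_lin pr2 z0 ract0l.
Qed.

Lemma ivl_iso (l r l' r' : nat) (X X' : lmodType A^c) (co : X -> unit -> 'I_n -> k)
    (co' : X' -> unit -> 'I_n -> k) : (l < r <= n)%N -> (l' < r' <= n)%N ->
  coord_module ca (ivl (fun=> l) (fun=> r)) co -> coord_module ca (ivl (fun=> l') (fun=> r')) co' ->
  mod_iso X X' -> l = l' /\ r = r'.
Proof.
move=> lr lr' HX HX' [f [g fg gf]].
have supp m q (Y : lmodType A^c) (cy : Y -> unit -> 'I_n -> k) (i : 'I_n) :
    coord_module ca (ivl (fun=> m) (fun=> q)) cy ->
    (exists x : Y, ract x (p i i) <> 0) <-> (m <= i < q)%N.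
  move=> HY; split=> [[x nx]|Di].
    apply/negPn/negP => nD; case: nx; apply: (pm_inj HY) => s j Dj.
    rewrite (pm_basis HA HY) // Dj (pm0 HY) /=; case: eqP => // ji.
    by move: Dj nD; rewrite /ivl ji => ->.
  have [x hx] := pm_make HY (fun _ _ => 1); exists x => /(congr1 (fun y => cy y tt i)).
  rewrite (pm_basis HA HY) // (pm0 HY) eqxx andbT hx /ivl Di => /eqP.
  by rewrite oner_eq0.
have E (i : 'I_n) : (l <= i < r)%N = (l' <= i < r')%N.
  apply/idP/idP => [/(supp _ _ _ _ _ HX)[x nx]|/(supp _ _ _ _ _ HX')[y ny]].
    apply/(supp _ _ _ _ _ HX'); exists (f x); rewrite -ract_lin => e.
    by apply: nx; apply: (can_inj fg); rewrite e linear0.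
  apply/(supp _ _ _ _ _ HX); exists (g y) => e; apply: ny.
  by rewrite -[y]gf -ract_lin e linear0.
have h1 : (l < n)%N by lia.
have h2 : (l' < n)%N by lia.
have h3 : (r.-1 < n)%N by lia.
have h4 : (r'.-1 < n)%N by lia.
have := E (Ordinal h1); have := E (Ordinal h2); have := E (Ordinal h3); have := E (Ordinal h4).
by rewrite /=; move: lr lr'; clear; lia.
Qed.

Lemma basic_ivl (V : finType) (L H : V -> nat) (M : lmodType A^c) (co : M -> V -> 'I_n -> k) :
  (forall v, L v < H v <= n)%N -> (forall v w, L v = L w -> H v = H w -> v = w) ->
  coord_module ca (ivl L H) co -> basic_module M.
Proof.
move=> lr inj HM.
have /choice[X XP] : forall j : 'I_#|V|, exists X : {X : lmodType A^c & X -> unit -> 'I_n -> k},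
    coord_module ca (ivl (fun=> L (enum_val j)) (fun=> H (enum_val j))) (projT2 X).
  move=> j; have [X [c hX]] :=
    coord_module_ex HA (@ivl_convex n unit (fun=> L (enum_val j)) (fun=> H (enum_val j))).
  by exists (existT _ X c).
exists #|V|, (fun j => projT1 (X j)); split; last first.
- move=> j l nj /(ivl_iso (lr _) (lr _) (XP j) (XP l)) [e1 e2].
  by apply/nj/enum_val_inj/inj.
- by move=> j; exact: indecomposable_ivl (lr _) (XP j).
have fiP (j : 'I_#|V|) : exists i : {linear projT1 (X j) -> M}, forall x s v,
    co (i x) s v = if ivl L H s v then \sum_t (s == enum_val j)%:R * projT2 (X j) x t v else 0.
  apply: (hom_ivl HA (XP j) HM) => s t; case: (s =P enum_val j) => [->|]; last by rewrite eqxx.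
  by rewrite !leqnn.
have fpP (j : 'I_#|V|) : exists i : {linear M -> projT1 (X j)}, forall x (s : unit) v,
    projT2 (X j) (i x) s v = if ivl (fun=> L (enum_val j)) (fun=> H (enum_val j)) s v
      then \sum_t (t == enum_val j)%:R * co x t v else 0.
  apply: (hom_ivl HA HM (XP j)) => s t; case: (t =P enum_val j) => [->|]; last by rewrite eqxx.
  by rewrite !leqnn.
pose fi j := projT1 (cid (fiP j)); pose fp j := projT1 (cid (fpP j)).
have fiE j x s v : co (fi j x) s v =
    if (s == enum_val j) && ivl L H s v then projT2 (X j) x tt v else 0.
  rewrite /fi; case: cid => i /= ->; case: ifP; rewrite ?andbF ?andbT // => _.
  rewrite (bigD1 tt) //= big1 ?addr0 => [|[]//].
  by case: (s == enum_val j); rewrite ?mul1r ?mul0r.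
have fpE j x v : projT2 (X j) (fp j x) tt v =
    if ivl L H (enum_val j) v then co x (enum_val j) v else 0.
  rewrite /fp; case: cid => i /= ->.
  rewrite (_ : ivl _ _ tt v = ivl L H (enum_val j) v) //; case: ifP => // _.
  rewrite (bigD1 (enum_val j)) //= eqxx mul1r big1 ?addr0 // => t /negPf ->.
  by rewrite mul0r.
exists fi, fp; split.
- move=> j x; apply: (pm_inj (XP j)) => -[] v Dv; rewrite fpE fiE eqxx /=.
  by rewrite (_ : ivl L H (enum_val j) v).
- move=> j l nj x; apply: (pm_inj (XP l)) => -[] v Dv; rewrite fpE fiE (pm0 (XP l)).
  case: (enum_val l =P enum_val j) => [/enum_val_inj e|]; first by case: nj.
  by rewrite if_same.
move=> x; apply: (pm_inj HM) => s v Dv; rewrite (pm_sum HM) (bigD1 (enum_rank s)) //=.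
rewrite fiE enum_rankK eqxx Dv fpE enum_rankK Dv big1 ?addr0 // => j nj.
rewrite fiE; case: eqP => //= e; by rewrite e enum_valK eqxx in nj.
Qed.

End Basic.

(** * From tilting modules to triangulations *)

Section Kernel.
Variables (k : comNzRingType) (A : algType k) (X Y : lmodType A^c) (f : {linear X -> Y}).

Definition in_kernel : {pred X} := fun x => f x == 0.

Lemma in_kernel_closed : submod_closed in_kernel.
Proof.
split; first by rewrite unfold_in linear0.
by move=> a x y; rewrite !unfold_in linearP => /eqP -> /eqP ->; rewrite scaler0 addr0.
Qed.
HB.instance Definition _ := GRing.isSubmodClosed.Build A^c X in_kernel in_kernel_closed.

Definition kernel := {x : X | x \in in_kernel}.
HB.instance Definition _ := SubChoice.on kernel.
HB.instance Definition _ := [SubChoice_isSubLmodule of kernel by <:].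

Lemma split_kernel (i : {linear Y -> X}) : cancel i f -> mod_iso X (Y * kernel)%type.
Proof.
move=> fi.
have kx x : x - i (f x) \in in_kernel by rewrite unfold_in linearB /= fi subrr.
have [F FE] : exists F : {linear X -> (Y * kernel)%type},
    F =1 (fun x => (f x, exist (fun x => x \in in_kernel) _ (kx x))).
  apply: mk_linear => x y a; rewrite [RHS]surjective_pairing; congr pair.
    by rewrite linearD ract_lin.
  apply: val_inj; rewrite /= linearD ract_lin linearD ract_lin /ract.
  by rewrite scalerBr opprD addrACA.
exists F; exists (fun q => i q.1 + val q.2) => [x|[y [x hx]]].
  by rewrite FE /= addrC subrK.
have /eqP fx : f x == 0 by move: hx; rewrite unfold_in.
rewrite FE /=; congr pair; first by rewrite linearD fi fx addr0.
by apply: val_inj; rewrite /= linearD fi fx addr0 addrAC subrr add0r.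
Qed.
End Kernel.

Section Functional.
Variables (k : fieldType) (A : algType k) (X : lmodType A^c).
Local Notation sc c x := (ract x (c%:A)).

Lemma scD a b (x : X) : sc (a + b) x = sc a x + sc b x.
Proof. by rewrite scalerDl ractDr. Qed.
Lemma scM a b (x : X) : sc (a * b) x = sc a (sc b x).
Proof. by rewrite ractM -scalerAl mul1r scalerA mulrC. Qed.

Lemma dual_functional (T : finType) (w : T -> X) (v : X) : v <> 0 ->
  (forall x, exists c : T -> k, x = \sum_t sc (c t) (w t)) ->
  exists la : X -> k, [/\ forall x y, la (x + y) = la x + la y,
    forall c x, la (sc c x) = c * la x & la v = 1].
Proof.
move=> v0 spanw.
pose comb a (c : T -> k) (I : {set T}) : X := sc a v + \sum_(t in I) sc (c t) (w t).
pose P (I : {set T}) := `[< forall x, exists a c, x = comb a c I >].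
have combD a b c d I : comb a c I + comb b d I = comb (a + b) (fun t => c t + d t) I.
  rewrite /comb scD addrACA; congr (_ + _).
  by rewrite -big_split; apply: eq_bigr => t _; rewrite scD.
have combZ a b c I : sc b (comb a c I) = comb (b * a) (fun t => b * c t) I.
  rewrite /comb ractDl ract_suml scM; congr (_ + _).
  by apply: eq_bigr => t _; rewrite scM.
have PT : P setT.
  apply/asboolP => x; have [c hc] := spanw x; exists 0, c.
  rewrite /comb scale0r ract0r add0r [LHS]hc; apply: eq_bigl => t; by rewrite inE.
case: (@arg_minnP _ setT P (fun I => #|I|) PT) => I /asboolP PI Imin.
have indep a c : comb a c I = 0 -> a = 0.
  move=> e; have c0 t : t \in I -> c t = 0.
    move=> tI; apply/eqP; apply: contraT => ct.
    suff PD : P (I :\ t).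
      by have := Imin _ PD; rewrite (cardsD1 t I) tI ltnn.
    apply/asboolP => x; have [b [d hx]] := PI x; pose m := - (d t / c t).
    exists (b + m * a), (fun s => d s + m * c s).
    have -> : x = comb (b + m * a) (fun s => d s + m * c s) I.
      by rewrite -combD -combZ e ract0l addr0.
    rewrite /comb (bigD1 t) //= [d t + _](_ : _ = 0) ?scale0r ?ract0r ?add0r.
      by congr (_ + _); apply: eq_bigl => s; rewrite !inE andbC.
    by rewrite /m mulNr -mulrA mulVf // mulr1 subrr.
  apply/eqP; apply: contraT => na; case: v0.
  have : sc a v = 0 by move: e; rewrite /comb big1 ?addr0 // => t /c0 ->; rewrite scale0r ract0r.
  move/(congr1 (fun x => sc a^-1 x)); rewrite -scM mulVf // ract0l scale1r ract1 //.
have uniq a b c d : comb a c I = comb b d I -> a = b.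
  move=> e; have : comb (a + -1 * b) (fun t => c t + -1 * d t) I = 0.
    by rewrite -combD e -combZ scaleN1r /ract scaleNr scale1r subrr.
  by move/indep/eqP; rewrite mulN1r subr_eq0 => /eqP.
have /choice[la laP] : forall x, exists a, exists c, x = comb a c I by exact: PI.
exists la; split=> [x y|b x|].
- have [c hx] := laP x; have [d hy] := laP y; have [e hxy] := laP (x + y).
  by apply: (@uniq _ _ e (fun t => c t + d t)); rewrite -hxy -combD -hx -hy.
- have [c hx] := laP x; have [d hbx] := laP (sc b x).
  by apply: (@uniq _ _ d (fun t => b * c t)); rewrite -hbx -combZ -hx.
have [c hv] := laP v; apply: (@uniq _ _ c (fun=> 0)).
rewrite -hv /comb big1 => [|t _]; last by rewrite scale0r ract0r.
by rewrite scale1r ract1 addr0.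
Qed.
End Functional.

Section Classify.
Variables (k : fieldType) (n : nat) (A : algType k).
Variables (p : 'I_n -> 'I_n -> A) (ca : A -> 'I_n -> 'I_n -> k).
Hypothesis HA : inc_alg (fun i j : 'I_n => i <= j)%N p ca.

Lemma coord_module_transport (S : finType) D (X Y : lmodType A^c) (co : Y -> S -> 'I_n -> k)
    (f : {linear X -> Y}) : bijective f -> coord_module ca D co ->
      coord_module ca D (fun x => co (f x)).
Proof.
move=> [g fg gf] HY; split.
- by move=> x y s i; rewrite linearD (pm_add HY).
- by move=> x a s j; rewrite ract_lin (pm_act HY).
- by move=> x s i; exact: (pm_out HY).
- by move=> x y h; apply: (can_inj fg); exact: (pm_inj HY).
by move=> F; have [y hy] := pm_surj HY F; exists (g y) => s i; rewrite gf; exact: hy.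
Qed.

Lemma vertex_idem (i : 'I_n) : p i i * p i i = p i i.
Proof. by rewrite (bas_mul HA) leqnn. Qed.

Lemma fin_gen_span (X : lmodType A^c) : fin_gen X ->
  exists (T : finType) (w : T -> X), forall x, exists c : T -> k, x = \sum_t ract (w t) ((c t)%:A).
Proof.
move=> [m [e he]]; pose T := ('I_m * ('I_n * 'I_n))%type.
exists T, (fun t : T => if (t.2.1 <= t.2.2)%N then ract (e t.1) (p t.2.1 t.2.2) else 0) => x.
have [c hx] := he x; exists (fun t => ca (c t.1) t.2.1 t.2.2).
pose G a (i j : 'I_n) := ract (if (i <= j)%N then ract (e a) (p i j) else 0) ((ca (c a) i j)%:A).
transitivity (\sum_a \sum_q G a q.1 q.2); last first.
  by rewrite (pair_bigA _ (fun a q => G a q.1 q.2)).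
rewrite [LHS]hx; apply: eq_bigr => a _.
rewrite -(pair_bigA _ (fun i j => G a i j)) -[_ *: _]/(ract (e a) (c a)).
rewrite {1}(cf_expand HA (c a)) ract_sumr; apply: eq_bigr => i _ /=.
rewrite ract_sumr big_mkcond; apply: eq_bigr => j _; rewrite /G.
by case: ifP => ij; [rewrite ractZr | rewrite ract0l].
Qed.

(* Let i be the first vertex with X_i <> 0, x in X_i and j maximal with
   x p_ij <> 0.  A functional on X that is 1 at x p_ij yields a retraction of X
   onto the interval module generated by x. *)
Lemma indecomposable_interval (X : lmodType A^c) : fin_gen X -> indecomposable X ->
  exists (l r : nat) (co : X -> unit -> 'I_n -> k), (l < r <= n)%N /\
    coord_module ca (ivl (fun=> l) (fun=> r)) co.
Proof.
move=> fgX [[x1 nx1] indX].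
have [T [w spw]] := fin_gen_span fgX.
have ex_i : exists i : nat, `[< exists (i' : 'I_n) (x : X), i' =
  i :> nat /\ ract x (p i' i') <> 0 >].
  apply: contrapT => /forallNP h; apply: nx1.
  rewrite -[x1]ract1 (bas_one HA) ract_sumr big1 // => i _.
  by apply: contrapT => nz; apply: (h i); apply/asboolP; exists i, x1.
case: (ex_minnP ex_i) => i0 /asboolP[i [x2 [<- nx2]]] imin {i0 ex_i}.
have low (i' : 'I_n) (x : X) : (i' < i)%N -> ract x (p i' i') = 0.
  move=> lt; apply: contrapT => nz.
  have : (i <= i')%N by apply: imin; apply/asboolP; exists i', x.
  by rewrite leqNgt lt.
pose x0 := ract x2 (p i i).
have x0i : ract x0 (p i i) = x0 by rewrite ractM vertex_idem.
have ex_j : exists j : nat, `[< exists j' : 'I_n, [/\ j' =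
  j :> nat, (i <= j')%N & ract x0 (p i j') <> 0] >].
  by exists i; apply/asboolP; exists i; rewrite x0i.
have ub j : `[< exists j' : 'I_n, [/\ j' =
  j :> nat, (i <= j')%N & ract x0 (p i j') <> 0] >] -> (j <= n)%N.
  by move=> /asboolP[j' [<- _ _]]; exact: ltnW.
case: (ex_maxnP ex_j ub) => j0 /asboolP[j [<- ij nz]] jmax {j0 ex_j ub}.
have high (j' : 'I_n) : (j < j')%N -> ract x0 (p i j') = 0.
  move=> lt; apply: contrapT => nz'.
  have : (j' <= j)%N.
    by apply: jmax; apply/asboolP; exists j'; split=> //; exact: leq_trans ij (ltnW lt).
  by rewrite leqNgt lt.
have [la [laD laZ la1]] := dual_functional nz spw.
have la0 : la 0 = 0 by apply: (addrI (la 0)); rewrite -laD !addr0.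
have la_sum (I : Type) (s : seq I) (Q : pred I) (F : I -> X) :
    la (\sum_(a <- s | Q a) F a) = \sum_(a <- s | Q a) la (F a).
  by apply: (big_morph la) => //; exact: laD.
have lr (s : unit) : (i < j.+1 <= n)%N by rewrite ltnS ij ltn_ord.
have [Y [cy HY]] := coord_module_ex HA (@ivl_convex n unit (fun=> nat_of_ord i) (fun=> j.+1)).
have /choice[rho0 rho0P] : forall m : X, exists y : Y, forall s l,
    cy y s l = if ivl (fun=> nat_of_ord i) (fun=> j.+1) s l then la (ract m (p l j)) else 0.
  by move=> m; exact: (pm_make HY (fun _ l => la (ract m (p l j)))).
have [rho rhoP] : exists rho : {linear X -> Y}, rho =1 rho0.
  apply: mk_linear => m m' a; apply: (pm_inj HY) => s l Dl.
  rewrite (pm_add HY) (pm_act HY) !rho0P Dl ractDl laD; congr (_ + _).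
  have [il lj] : (i <= l)%N /\ (l <= j)%N by move/andP: Dl => [? ?].
  have -> : ract (ract m a) (p l j) =
      \sum_(l' : 'I_n) ract (if (l' <= j)%N then ract m (p l' j) else 0) ((ca a l' l)%:A).
    have E : a * p l j = \sum_(l' : 'I_n) (if (l' <= j)%N then ca a l' l *: p l' j else 0).
      rewrite [LHS](cf_expand HA); apply: eq_bigr => l' _.
      rewrite big_mkcond (bigD1 j) //= big1 ?addr0 => [|c nc].
        by case: ifP => // l'j; rewrite (cf_mul_basr HA) // l'j eqxx.
      by case: ifP => // l'c; rewrite (cf_mul_basr HA) // l'c (negPf nc) scale0r.
    rewrite ractM E ract_sumr; apply: eq_bigr => l' _.
    by case: ifP => _; [exact: ractZr | rewrite ract0r ract0l].
  rewrite la_sum; apply: eq_bigr => l' _; rewrite laZ rho0P mulrC.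
  have [l'l|nl'l] := boolP (l' <= l)%N; last first.
    by rewrite (cf_out HA _ nl'l) !mulr0.
  congr (_ * _); rewrite /ivl ltnS (leq_trans l'l lj) andbT; case: ifP => // /negbT.
  rewrite -ltnNge => l'i; have -> : p l' j = p l' l' * p l' j.
    by rewrite (bas_mul HA) // (leq_trans l'l lj).
  by rewrite -ractM low // ract0l la0.
have [u hu] := gen_ex lr HY.
have [io ioP] : exists f : {linear Y -> X}, forall s, f (u s) = x0.
  apply: (hom_from_gen HA (lr := lr) HY hu) => [s|s j' ej'].
    by rewrite (_ : top lr s = i) //; apply: val_inj.
  by rewrite (_ : top lr s = i) ?high ?ej' //; apply: val_inj.
have rio : cancel io rho.
  move=> y; rewrite {2}(gen_expand HA HY y hu) {1}(gen_expand HA HY y hu).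
  rewrite !linear_sum; apply: eq_bigr => s _; rewrite !ract_lin ioP; congr ract.
  apply: (pm_inj HY) => s' l Dl; rewrite rhoP rho0P Dl hu.
  have -> : (s' == s) = true by apply/eqP; case: (s); case: (s').
  rewrite (_ : top lr s = i); last exact: val_inj.
  case: eqP => [->|nl]; first by rewrite la1.
  have lj : (l <= j)%N by move/andP: Dl => [_].
  by rewrite -x0i ractM (bas_mul0 HA) // ?ract0r ?la0 // eq_sym; apply/eqP.
have isoX := split_kernel rio.
have Y0 : u tt <> 0.
  move=> /(congr1 (fun y => cy y tt (top lr tt))); rewrite hu !eqxx (pm0 HY) => /eqP.
  by rewrite oner_eq0.
case: (indX _ _ isoX) => [/(_ (u tt))//|ker0].
have iro : cancel rho io.
  move=> x; have kx : x - io (rho x) \in in_kernel rho by rewrite unfold_in linearB /= rio subrr.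
  have := congr1 val (ker0 (exist (fun x => x \in in_kernel rho) _ kx)) => /eqP.
  by rewrite /= subr_eq0 => /eqP.
exists i, j.+1, (fun x => cy (rho x)); split; first exact: (lr tt).
by apply: (coord_module_transport _ HY); exists io.
Qed.

Lemma coord_module_sum (r : nat) (T : lmodType A^c) (X : 'I_r -> lmodType A^c) (l h : 'I_r -> nat)
    (co : forall j, X j -> unit -> 'I_n -> k) (i : forall j, {linear X j -> T})
    (q : forall j, {linear T -> X j}) :
  (forall j, coord_module ca (ivl (fun=> l j) (fun=> h j)) (co j)) ->
  (forall j, cancel (i j) (q j)) -> (forall j m, j <> m -> forall x, q m (i j x) = 0) ->
  (forall x, x = \sum_j i j (q j x)) ->
  coord_module ca (ivl l h) (fun x j v => co j (q j x) tt v).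
Proof.
move=> HX iq iq0 sum; split.
- by move=> x y j v; rewrite linearD (pm_add (HX j)).
- by move=> x a j v; rewrite ract_lin (pm_act (HX j)).
- by move=> x j v; exact: (pm_out (HX j)).
- move=> x y e; rewrite (sum x) (sum y); apply: eq_bigr => j _; congr (i j _).
  by apply: (pm_inj (HX j)) => -[] v Dv; exact: e.
move=> F; have /fin_all_exists[y hy] : forall j, exists y : X j, forall s v,
    ivl (fun=> l j) (fun=> h j) s v -> co j y s v = F j v.
  by move=> j; exact: (pm_surj (HX j) (fun _ v => F j v)).
exists (\sum_j i j (y j)) => j v Dv; rewrite linear_sum (bigD1 j) //= iq big1 ?addr0.
  exact: hy.
by move=> m nm; apply: iq0; exact/eqP.
Qed.

Lemma mod_iso_ivl (l r : nat) (X X' : lmodType A^c) (co : X -> unit -> 'I_n -> k)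
    (co' : X' -> unit -> 'I_n -> k) :
  coord_module ca (ivl (fun=> l) (fun=> r)) co ->
    coord_module ca (ivl (fun=> l) (fun=> r)) co' -> mod_iso X X'.
Proof.
move=> HX HX'.
have mk (Y Y' : lmodType A^c) cy cy' : coord_module ca (ivl (fun=> l) (fun=> r)) cy ->
    coord_module ca (ivl (fun=> l) (fun=> r)) cy' ->
    exists f : {linear Y -> Y'}, forall y (s : unit) v, cy' (f y) s v = cy y s v.
  move=> HY HY'; have [f hf] := hom_ivl HA HY HY' (c := fun _ _ => 1) ltac:(by move=> *;
    rewrite !leqnn).
  exists f => y [] v; rewrite hf; case: ifPn => [_|nD]; last by rewrite (pm_out HY).
  by rewrite (bigD1 tt) //= mul1r big1 ?addr0 // => -[].
have [f hf] := mk _ _ _ _ HX HX'; have [g hg] := mk _ _ _ _ HX' HX.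
exists f; exists g => x; [apply: (pm_inj HX)|apply: (pm_inj HX')] => s v _.
  by rewrite hg hf.
by rewrite hf hg.
Qed.

End Classify.

Section FromTilting.
Variables (k : fieldType) (n : nat) (A : algType k).
Variables (p : 'I_n -> 'I_n -> A) (ca : A -> 'I_n -> 'I_n -> k).
Hypothesis HA : inc_alg (fun i j : 'I_n => i <= j)%N p ca.
Variables (S : finType) (L H : S -> nat) (M : lmodType A^c) (co : M -> S -> 'I_n -> k).
Hypothesis lr : forall s, (L s < H s <= n)%N.
Hypothesis HM : coord_module ca (ivl L H) co.

(* For crossing intervals [a, b) and [c, d), a < c <= b < d, the sequence
   0 -> [c, d) -> [a, d) + [c, b) -> [a, b) -> 0 does not split; it is
   completed here to an extension of [M] by itself. *)
Lemma Ext1_nocross : Ext1_zero M M ->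
  forall s t, (L s < L t -> L t <= H s -> H s < H t -> False)%N.
Proof.
move=> ext s t st1 st2 st3.
have [u hu] := gen_ex lr HM.
have nst : s != t by apply/eqP => e; rewrite e in st3; lia.
pose l (q : S + S) := match q with
  | inl v => if v == t then L s else L v
  | inr v => if v == s then L t else L v end.
pose h (q : S + S) := match q with inl v => H v | inr v => H v end.
have [E [ce HE]] := coord_module_ex HA (@ivl_convex n (S + S)%type l h).
pose cf (q : S + S) (v : S) : k := match q with
  | inl w => (w == v)%:R
  | inr w => ((w == s) && (v == t))%:R end.
pose cg (v : S) (q : S + S) : k := match q with
  | inl w => - ((v == s) && (w == t))%:R
  | inr w => (v == w)%:R end.
have [f fP] : exists f : {linear M -> E}, forall x q i,
    ce (f x) q i = if ivl l h q i then \sum_v cf q v * co x v i else 0.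
  apply: (hom_ivl HA HM HE) => -[w|w] v /=.
    case: (w =P v) => [->|]; last by rewrite eqxx.
    by case: (v =P t) => [->|_]; rewrite ?(ltnW st1) ?leqnn.
  case: (w =P s) => [->|]; last by rewrite eqxx.
  case: (v =P t) => [->|]; last by rewrite eqxx.
  by rewrite (ltnW st3) leqnn.
have [g gP] : exists g : {linear E -> M}, forall x v i,
    co (g x) v i = if ivl L H v i then \sum_q cg v q * ce x q i else 0.
  apply: (hom_ivl HA HE HM) => v [w|w] /=.
    case: (v =P s) => [->|]; last by rewrite oppr0 eqxx.
    case: (w =P t) => [->|]; last by rewrite oppr0 eqxx.
    by rewrite leqnn (ltnW st3).
  case: (v =P w) => [->|]; last by rewrite eqxx.
  by case: (w =P s) => [->|_]; rewrite ?(ltnW st1) ?leqnn.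
have fl x v i : ivl l h (inl v) i -> ce (f x) (inl v) i = co x v i.
  move=> Di; rewrite fP Di (bigD1 v) //= eqxx mul1r big1 ?addr0 // => w /negPf.
  by rewrite eq_sym => ->; rewrite mul0r.
have fr x v i : ivl l h (inr v) i -> ce (f x) (inr v) i = if v == s then co x t i else 0.
  move=> Di; rewrite fP Di /=; case: ifP => _ /=; last by rewrite big1 // => w _; rewrite mul0r.
  rewrite (bigD1 t) //= eqxx mul1r big1 ?addr0 // => w /negPf ->.
  by rewrite mul0r.
have gE x v i : ivl L H v i ->
    co (g x) v i = ce x (inr v) i - (if v == s then ce x (inl t) i else 0).
  move=> Di; rewrite gP Di big_sumType /= addrC; congr (_ + _).
    rewrite (bigD1 v) //= eqxx mul1r big1 ?addr0 // => w /negPf.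
    by rewrite eq_sym => ->; rewrite mul0r.
  case: ifP => _ /=; last by rewrite big1 ?oppr0 // => w _; rewrite mul0r.
  rewrite (bigD1 t) //= eqxx mulr1n mulN1r big1 ?addr0 // => w /negPf ->.
  by rewrite mulr0n oppr0 mul0r.
have Dl v i : ivl L H v i -> ivl l h (inl v) i.
  by rewrite /ivl /=; case: (v =P t) => [->|] // /andP[h1 ->]; rewrite (leq_trans (ltnW st1) h1).
have Dr v i : v != s -> ivl l h (inr v) i = ivl L H v i.
  by rewrite /ivl /= => /negPf ->.
have ex : short_exact f g.
  split.
  - move=> x y e; apply: (pm_inj HM) => v i Di.
    by rewrite -!fl ?e //; exact: Dl.
  - move=> z; have [y hy] := pm_make HE (fun q i => match q with
      | inl w => if w == t then - co z s i else 0
      | inr w => if w == s then 0 else co z w i end).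
    exists y; apply: (pm_inj HM) => v i Di; rewrite gE // !hy eqxx.
    case: (v =P s) => [e|/eqP nvs]; last by rewrite Dr // Di subr0.
    subst v; rewrite if_same sub0r ifT ?opprK //.
    by move: Di; rewrite /ivl /= eqxx => /andP[-> h2]; exact: ltn_trans h2 st3.
  move=> y; split=> [gy|[x <-]]; last first.
    apply: (pm_inj HM) => v i Di; rewrite gE // (pm0 HM).
    case: (v =P s) => [e|/eqP nvs]; last first.
      by rewrite fr ?(negPf nvs) ?subrr // Dr.
    subst v; have Dt : ivl l h (inl t) i.
      by move: Di; rewrite /ivl /= eqxx => /andP[-> h2]; exact: ltn_trans h2 st3.
    rewrite fl //; have [Ds|nDs] := boolP (ivl l h (inr s) i).
      by rewrite fr // eqxx subrr.
    rewrite (pm_out HE) // (pm_out HM) ?subrr //; apply: contra nDs.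
    by rewrite /ivl /= eqxx => /andP[-> _]; case/andP: Di => _ ->.
  have rec v i : ivl L H v i -> ce y (inr v) i = if v == s then ce y (inl t) i else 0.
    move=> Di; have := congr1 (fun z => co z v i) gy; rewrite gE // (pm0 HM).
    by move/eqP; rewrite subr_eq0 => /eqP.
  have [x hx] := pm_make HM (fun v i => ce y (inl v) i).
  exists x; apply: (pm_inj HE) => -[v|v] i Di.
    rewrite fl // hx; case: ifPn => // nD; move: Di nD; rewrite /ivl /=.
    case: (v =P t) => [->|_] /andP[h1 h2]; last by rewrite h1 h2.
    rewrite h2 andbT -ltnNge => it.
    have Ds : ivl L H s i by rewrite /ivl h1 (leq_trans it st2).
    have := rec s i Ds; rewrite eqxx => <-; rewrite (pm_out HE) //.
    by rewrite /ivl /= eqxx negb_and -ltnNge it.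
  rewrite fr //; case: (v =P s) => [e|/eqP nvs]; last first.
    by rewrite rec ?(negPf nvs) // -Dr.
  subst v; move: Di; rewrite /ivl /= eqxx => /andP[h1 h2].
  have Ds : ivl L H s i by rewrite /ivl h2 (leq_trans (ltnW st1) h1).
  by rewrite rec // eqxx hx /ivl h1 (ltn_trans h2 st3).
have [sec secP] := ext E f g ex.
pose i := top lr s.
have Hn : (H s < n)%N by have := lr t; lia.
pose j := Ordinal Hn; have ij : (i <= j)%N by rewrite /=; have := lr s; lia.
have z1 : ce (sec (u s)) (inl t) i = 0.
  have := congr1 (fun x => ce (sec x) (inl t) j) (gen_end HA HM hu (erefl : j = H s :> nat)).
  rewrite ract_lin (pm_basis HA HE) // linear0 (pm0 HE) eqxx andbT ifT //.
  by rewrite /ivl /= eqxx st3; have := lr s; lia.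
have Di : ivl L H s i by rewrite /ivl /= leqnn; have := lr s; lia.
have := congr1 (fun x => co x s i) (secP (u s)); rewrite gE // eqxx z1 subr0.
rewrite (pm_out HE); last by rewrite /ivl /= eqxx negb_and -ltnNge st1.
by rewrite hu !eqxx => /eqP; rewrite eq_sym oner_eq0.
Qed.

Definition vertex_iso (i j : 'I_n) (N : lmodType A^c) : Prop :=
  (forall y : N, ract y (p j j) = y -> exists x, ract x (p i i) = x /\ ract x (p i j) = y) /\
  (forall x : N, ract x (p i i) = x -> ract x (p i j) = 0 -> x = 0).

Definition vertex_zero (m : 'I_n) (N : lmodType A^c) : Prop := forall x : N, ract x (p m m) = 0.

Lemma vertex_iso_retract i j (N X : lmodType A^c) (io : {linear N -> X}) (pr : {linear X -> N}) :
  cancel io pr -> vertex_iso i j X -> vertex_iso i j N.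
Proof.
move=> ip [h1 h2]; split.
  move=> y yj; have [|x [x1 x2]] := h1 (io y); first by rewrite -ract_lin yj.
  by exists (pr x); rewrite -!ract_lin x1 x2.
move=> x xi xj; rewrite -[x]ip (_ : io x = 0) ?linear0 //.
by apply: h2; rewrite -ract_lin ?xi ?xj ?linear0.
Qed.

Lemma vertex_zero_retract m (N X : lmodType A^c) (io : {linear N -> X}) (pr : {linear X -> N}) :
  cancel io pr -> vertex_zero m X -> vertex_zero m N.
Proof. by move=> ip h x; rewrite -[LHS]ip ract_lin h linear0. Qed.

Lemma coord_module_vertex_iso (T : finType) D (X : lmodType A^c) (cx : X -> T -> 'I_n ->
  k) (i j : 'I_n) :
  (i <= j)%N -> coord_module ca D cx -> (forall t, D t i = D t j) -> vertex_iso i j X.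
Proof.
move=> ij HX same; split=> [y yj|x xi xj].
  have [x hx] := pm_make HX (fun s v => if v == i then cx y s j else 0).
  exists x; split; apply: (pm_inj HX) => s v Dv.
    rewrite (pm_basis HA HX) // Dv /=; case: (v =P i) => [->//|nv].
    by rewrite hx Dv; case: eqP.
  rewrite (pm_basis HA HX) // Dv /= -[in RHS]yj (pm_basis HA HX) // Dv /=.
  by case: (v =P j) => [e|] //; rewrite hx eqxx same -e Dv.
apply: (pm_inj HX) => s v Dv; rewrite (pm0 HX) -xi (pm_basis HA HX) // Dv /=.
case: (v =P i) => [e|] //; have Dj : D s j by rewrite -same -e.
have := congr1 (fun z => cx z s j) xj.
by rewrite (pm_basis HA HX) // Dj eqxx (pm0 HX).
Qed.

Lemma coord_module_vertex_zero (T : finType) D (X : lmodType A^c) (cx : X -> T -> 'I_n ->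
  k) (m : 'I_n) :
  coord_module ca D cx -> (forall t, ~~ D t m) -> vertex_zero m X.
Proof.
move=> HX none x; apply: (pm_inj HX) => s v Dv; rewrite (pm_basis HA HX) // (pm0 HX).
by case: eqP => [e|]; rewrite ?andbF // e (negPf (none s)).
Qed.

Hypothesis tilt : tilting M.

(* Otherwise the path from i to j acts bijectively from M_i to M_j, hence also
   from A_i to A_j, but the idempotent p j j of A_j is not in A_i p_ij. *)
Lemma no_vertex_iso (i j : 'I_n) : (i < j)%N -> ~ (forall s, ivl L H s i = ivl L H s j).
Proof.
move=> ij same; have ij' := ltnW ij; have [_ _ _ [T' [T'' [f [g [a1 a2 [finj gs ex]]]]]]] := tilt.
have iso_add (N : lmodType A^c) : in_add M N -> vertex_iso i j N.
  move=> [m [io [pr ip]]]; apply: (vertex_iso_retract ip).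
  by apply: (coord_module_vertex_iso ij' (coord_module_ffun m HM)) => -[q s]; exact: same.
have [b1 _] := iso_add _ a1; have [_ c2] := iso_add _ a2.
pose e : (A^c)^o := p j j.
have ej : ract e (p j j) = e by exact: (vertex_idem HA).
have [|x [xi xj]] := b1 (f e); first by rewrite -ract_lin ej.
have gx : g x = 0.
  apply: c2; first by rewrite -ract_lin xi.
  by rewrite -ract_lin xj; apply/ex; exists e.
have [a ha] := (ex x).1 gx.
have /(congr1 (fun z : A => ca z j j)) : ract a (p i j) = e by apply: finj; rewrite ract_lin ha.
rewrite ract_reg (cf_mul_basr HA) // leqnn eqxx (cf_bas HA _ _ (leqnn j)) !eqxx (cf_out HA).
  by move/eqP; rewrite eq_sym oner_eq0.
by rewrite -ltnNge.
Qed.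

Lemma no_vertex_zero (m : 'I_n) : exists s, ivl L H s m.
Proof.
apply: contrapT => /forallNP none.
have [_ _ _ [T' [T'' [f [g [a1 a2 [finj gs ex]]]]]]] := tilt.
have zero_add (N : lmodType A^c) : in_add M N -> vertex_zero m N.
  move=> [q [io [pr ip]]]; apply: (vertex_zero_retract ip).
  by apply: (coord_module_vertex_zero (coord_module_ffun q HM)) => -[a s]; exact/negP/none.
have zT := zero_add _ a1.
have : p m m = 0.
  apply: (finj (p m m : (A^c)^o) 0); rewrite linear0.
  by rewrite -[p m m](vertex_idem HA) -[_ * _]/(ract (p m m : (A^c)^o) (p m m)) ract_lin zT.
by apply: (bas_neq0 HA); rewrite leqnn.
Qed.

(* If the chord (a, b) could be added, let (a, rho) be the longest chord or
   segment from a below it: then the same members of the family contain rho and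
   b, or rho and a.-1. *)
Lemma tilting_family : (forall v w, L v = L w -> H v = H w -> v = w) -> tri_family n L H.
Proof.
move=> inj; have [_ _ ext _] := tilt; have nc := Ext1_nocross ext.
split=> // a b ab ncv; apply: contrapT => /forallNP none.
have none' s : L s = a -> H s = b -> False by move=> e1 e2; apply: (none s).
pose P q := `[< q = a \/ exists s, [/\ L s = a, H s = q & (q < b)%N] >].
have exP : exists q, P q by exists a; apply/asboolP; left.
have ubP q : P q -> (q <= n)%N by move=> /asboolP[->|[s [_ _]]]; lia.
case: (ex_maxnP exP ubP) => rho /asboolP Prho rmax.
have rr : (a <= rho < b)%N.
  by case: Prho => [->|[s [e1 e2 e3]]]; [lia | have := lr s; lia].
have rn : (rho < n)%N by lia.
pose m := Ordinal rn.
have cov s : ivl L H s m -> (L s <= a)%N && (b <= H s)%N.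
  rewrite /ivl /= => D; have [nc1 nc2] := ncv s; have rs := lr s.
  have [h|[h|h]] : (L s < a \/ L s = a \/ a < L s)%N by lia.
  - by clear -h D nc1 nc2 rr; lia.
  - have [hb|hb] : (H s < b \/ b <= H s)%N by lia.
      have : (H s <= rho)%N by apply: rmax; apply/asboolP; right; exists s.
      by lia.
    by clear -h hb; lia.
  case: Prho => [e|[s0 [e1 e2 e3]]]; first by lia.
  by case: (nc s0 s); lia.
have left_iso : (0 < a)%N -> (b = n \/ exists s0, (L s0 < a)%N /\ H s0 = b) -> False.
  move=> a0 hb; have an : (a.-1 < n)%N by lia.
  apply: (@no_vertex_iso (Ordinal an) m); first by rewrite /=; lia.
  move=> s; have [nc1 nc2] := ncv s; have rs := lr s.
  apply/idP/idP => [|D].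
    by rewrite /ivl /=; clear -rr a0 nc1 nc2; lia.
  have /andP[c1 c2] := cov s D.
  suff : (L s < a)%N by rewrite /ivl /=; clear -c2 rr ab; lia.
  have [//|e] : (L s < a \/ L s = a)%N by lia.
  have nb : H s <> b by move=> e2; exact: none' e e2.
  case: hb => [bn|[s0 [h1 h2]]]; first by lia.
  by case: (nc s0 s); lia.
have [bn|bn] : (b = n \/ b < n)%N by lia.
  have [a0|a0] := posnP a; last by apply: left_iso; [|left].
  have [s /cov/andP[c1 c2]] := no_vertex_zero m.
  by apply: (none' s); have := lr s; lia.
have [hb|hb] := pselect (exists s0, (L s0 < a)%N /\ H s0 = b).
  by apply: left_iso; [case: hb => s0 [h1 _]; lia | right].
apply: (@no_vertex_iso m (Ordinal bn)); first by rewrite /=; lia.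
move=> s; have [nc1 nc2] := ncv s; have rs := lr s.
apply/idP/idP => [D|].
  have /andP[c1 c2] := cov s D.
  have ne : H s <> b.
    move=> e; have [h|h] : (L s < a \/ L s = a)%N by lia.
      by apply: hb; exists s.
    exact: none' h e.
  by rewrite /ivl /=; clear -c1 c2 ne ab; lia.
by rewrite /ivl /=; clear -nc1 nc2 rr ab; lia.
Qed.

End FromTilting.

Section NoCompleteTriangle.
Variables (n : nat) (V : Type) (L H : V -> nat).
Hypothesis F : tri_family n L H.
Hypothesis none : forall c y z, left_child n L H c y -> right_child n L H z y -> False.
Local Notation R := (hom_rel L H).

Lemma hom_rel_trans : transitive R.
Proof.
move=> d c e /(hom_relE F) Rcd /(hom_relE F) Rde; apply/(hom_relE F).
have rc := tf_range F c; have rd := tf_range F d; have re := tf_range F e.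
case: Rcd Rde => [[l1 h1]|[h1 l1]] [[l2 h2]|[h2 l2]]; try lia.
  have [e1|lt1] : (H c = H d \/ H c < H d)%N by lia.
    by right; lia.
  have [e2|lt2] : (L d = L e \/ L d < L e)%N by lia.
    by left; lia.
  have [m [lm K1 K2]] := seg_split F (seg_of n L H d) ltac:(lia).
  have cm : (H c <= m)%N.
    rewrite leqNgt; apply/negP => mc.
    by apply: (seg_nocross F (seg_of n L H c) K2); lia.
  have me : (m < L e)%N.
    rewrite ltnNge; apply/negP => em.
    by apply: (seg_nocross F K1 (seg_of n L H e)); lia.
  have [v [Lv Hv]] := seg_curve K1 ltac:(lia).
  have [w [Lw Hw]] := seg_curve K2 ltac:(lia).
  by case: (@none v d w); split; rewrite ?Hv ?Lw //; lia.
have [e1|lt1] : (L c = L d \/ L c < L d)%N by lia.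
  by left; lia.
have [e2|lt2] : (H d = H e \/ H d < H e)%N by lia.
  by right; lia.
by case: (tf_nocross F (v := c) (w := e)); lia.
Qed.

Lemma hom_rel_chain u d d' e : R u d -> R d e -> R u d' -> R d' e -> R d d' || R d' d.
Proof.
move=> ud de ud' d'e; have ue := hom_rel_trans ud de.
apply/orP; move: ud de ud' d'e ue.
move=> /(hom_relE F) h1 /(hom_relE F) h2 /(hom_relE F) h3 /(hom_relE F) h4 /(hom_relE F) h5.
have [h|h] : (L d = L d' /\ (H d <= H d')%N \/ H d = H d' /\ (L d <= L d')%N) \/
  (L d' = L d /\ (H d' <= H d)%N \/ H d' = H d /\ (L d' <= L d)%N) by lia.
  by left; apply/(hom_relE F).
by right; apply/(hom_relE F).
Qed.
End NoCompleteTriangle.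

Section Main.
Variables (k : closedFieldType) (n : nat) (n_gt0 : (0 < n)%N).

Lemma tri_alg_tilted (G : Tri_ct n) : nonhereditary_tilted_typeA n_gt0 (tri_alg k (Tri_ct_P1 G)).
Proof.
case: (and3P (valP G)) => G1 G2 G3.
have [L [H [GE F]]] := tri_family_of G1 G2.
have [bas [cf incB]] := tri_inc_alg k (Tri_ct_P1 G) GE F.
have [p [ca HA]] := linear_inc_alg k n_gt0.
split.
  have [M [co HM]] := coord_module_ex HA (@ivl_convex n _ L H).
  have [u hu] := gen_ex (tf_range F) HM.
  exists M; split.
  - exact: (tilting_ivl HA n_gt0 F HM).
  - exact: (basic_ivl HA (tf_range F) (tf_inj F) HM).
  - exact: (end_of_inc HA HM hu incB).
have [c [y [z [hc hz]]]] := (complete_triangleP GE F).1 G3.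
have [cy [yz ncz]] := rel_arr F hc hz.
exact: (not_hereditary incB (arr_hom F cy) (arr_hom F yz) ncz).
Qed.

Lemma tri_alg_inj (G G' : Tri_ct n) :
  alg_iso (tri_alg k (Tri_ct_P1 G)) (tri_alg k (Tri_ct_P1 G')) -> G = G'.
Proof.
case: (and3P (valP G)) => G1 G2 G3; case: (and3P (valP G')) => G1' G2' G3'.
have [L [H [GE F]]] := tri_family_of G1 G2.
have [L' [H' [GE' F']]] := tri_family_of G1' G2'.
have [bas [cf incB]] := tri_inc_alg k (Tri_ct_P1 G) GE F.
have [bas' [cf' incB']] := tri_inc_alg k (Tri_ct_P1 G') GE' F'.
move/(alg_iso_rel incB incB' (hom_rel_anti F) (hom_rel_anti F')) => [s [t st ts] Rs].
have [c [y [z [hc hz]]]] := (complete_triangleP GE F).1 G3.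
have rg := rigid F F' st ts Rs hc hz.
have vs d : val (s d) = val d by rewrite GE GE'; have [-> ->] := rg d.
apply: val_inj; apply/setP => d; apply/idP/idP => dG.
  by rewrite -[d]/(val (exist (fun c => c \in val G) _ dG)) -vs; exact: valP.
by rewrite -[d]/(val (exist (fun c => c \in val G') _ dG)) -[exist _ _ _]ts vs; exact: valP.
Qed.

Lemma tilted_tri_alg (B : algType k) : nonhereditary_tilted_typeA n_gt0 B ->
  exists G : Tri_ct n, alg_iso (tri_alg k (Tri_ct_P1 G)) B.
Proof.
move=> [[T [tilt [r [X [[i [q [iq iq0 sum]]] indX nisoX]]] [f bf]]] nher].
have [p [ca HA]] := linear_inc_alg k n_gt0.
have [[m [e he]] _ _ _] := tilt.
have fgX j : fin_gen (X j).
  exists m, (fun a => q j (e a)) => x; have [c hc] := he (i j x); exists c.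
  by rewrite -[LHS](iq j) hc linear_sum; apply: eq_bigr => a _; exact: linearZ.
have /choice[lh hlh] : forall j, exists lh : nat * nat, exists co : X j -> unit -> 'I_n -> k,
    (lh.1 < lh.2 <= n)%N /\ coord_module ca (ivl (fun=> lh.1) (fun=> lh.2)) co.
  move=> j; have [l [h [co [lr hco]]]] := indecomposable_interval HA (fgX j) (indX j).
  by exists (l, h), co.
pose L j := (lh j).1; pose H j := (lh j).2.
pose co j := projT1 (cid (hlh j)).
have lr j : (L j < H j <= n)%N by have [? []] := hlh j.
have HX j : coord_module ca (ivl (fun=> L j) (fun=> H j)) (co j) by rewrite /co; case: cid => ? [].
have HM := coord_module_sum HX iq iq0 sum.
have LHinj v w : L v = L w -> H v = H w -> v = w.
  move=> e1 e2; apply: contrapT => nvw; apply: (nisoX v w nvw).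
  have := HX w; rewrite -e1 -e2 => hw; refine (mod_iso_ivl HA (HX v) hw).
have F := tilting_family HA lr HM tilt LHinj.
have [u hu] := gen_ex lr HM.
have [bas [cf incB]] := inc_of_end HA HM hu bf.
have /andP[G1 G2] := triangulation_of F n_gt0; set G := [set _ | _ in _] in G1 G2.
have [L' [H' [GE F']]] := tri_family_of G1 G2.
have inG j : chord n (L j) (H j) \in G by apply: imset_f.
pose s j : {c | c \in G} := exist (fun c => c \in G) _ (inG j).
have le_ F0 (W : Type) (l h : W -> nat) (FW : tri_family F0 l h) w : (l w <= h w <= F0)%N.
  by have := tf_range FW w; lia.
have sE j : L' (s j) = L j /\ H' (s j) = H j.
  by have [-> ->] := chord_inj (le_ _ _ _ _ F j) (le_ _ _ _ _ F' (s j)) (GE (s j)).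
have sb : bijective s.
  have /choice[t ht] : forall c : {c | c \in G}, exists j, s j = c.
    move=> [c cG]; have /imsetP[j _ ej] := cG; exists j; exact: val_inj.
  exists t => [j|c]; last exact: ht.
  apply: LHinj; have [e1 e2] := sE j; have [e3 e4] := sE (t (s j)).
    by rewrite -e1 -e3 ht.
  by rewrite -e2 -e4 ht.
have Rs c d : hom_rel L' H' (s c) (s d) = hom_rel L H c d.
  by rewrite /hom_rel; have [-> ->] := sE c; have [-> ->] := sE d.
have G3 : has_complete_triangle G.
  apply: contrapT => nct; apply: nher.
  have segs l h : seg n L H l h -> seg n L' H' l h.
    case=> [?|[v [<- <-]]]; [by left | right; exists (s v)].
    by have [-> ->] := sE v.
  have none c y z : left_child n L H c y -> right_child n L H z y -> False.
    move=> [a1 a2 a3] [b1 b2 b3]; apply: nct; apply/(complete_triangleP GE F').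
    have [c1 c2] := sE c; have [y1 y2] := sE y; have [z1 z2] := sE z.
    exists (s c), (s y), (s z); split; split; rewrite ?c1 ?c2 ?y1 ?y2 ?z1 ?z2 //; exact: segs.
  apply: (hereditary incB (hom_rel_anti F)); first exact: hom_rel_trans F none.
  exact: hom_rel_chain F none.
have Gct : [&& triangulation G, c_P1 n \in G & has_complete_triangle G] by rewrite G1 G2.
pose Gt : Tri_ct n := exist _ G Gct.
have [bas' [cf' incB']] := tri_inc_alg k (Tri_ct_P1 Gt) GE F'.
exists Gt; case: sb => t st ts.
apply: (inc_alg_iso incB' incB (s := t)); first by exists s.
by move=> c d; rewrite -Rs !ts.
Qed.

End Main.

Theorem theorem3p12 (k : closedFieldType) (n : nat) (n_gt0 : (0 < n)%N) :
  [/\ forall G : Tri_ct n,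
        nonhereditary_tilted_typeA n_gt0 (tri_alg k (Tri_ct_P1 G)),
      forall G G' : Tri_ct n,
        alg_iso (tri_alg k (Tri_ct_P1 G)) (tri_alg k (Tri_ct_P1 G')) -> G = G'
    & forall B : algType k, nonhereditary_tilted_typeA n_gt0 B ->
        exists G : Tri_ct n, alg_iso (tri_alg k (Tri_ct_P1 G)) B].
Proof.
split; [exact: tri_alg_tilted | exact: tri_alg_inj | exact: tilted_tri_alg].
Qed.
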